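(* Let $\mathcal{B}$ be a bi-infinite ordered Bratteli diagram satisfying the standing assumptions, with a state $\nu_r,\nu_s$. For each $n\ge1$ and $p\in E^{r/s}_{-n,n}$, define $Y(p)=\pi(V(p))\subseteq S_{\mathcal{B}}$ and let $\eta^p:Y(p)\to\mathbb{R}^2$ be the unique map satisfying $\psi^p=\eta^p\circ\pi$ on $V(p)$. Then each $Y(p)$ is open and $\eta^p$ is a homeomorphism to its image. The space $S_{\mathcal{B}}$ is a surface and the collection of maps $\eta^p$, where $p$ ranges over $\bigcup_{n\ge1}E^{r/s}_{-n,n}$, is an atlas for $S_{\mathcal{B}}$ making it a translation surface.
   Context: A bi-infinite ordered Bratteli diagram $\mathcal B=(V,E,r,s,\le_r,\le_s)$ consists of pairwise disjoint finite nonempty sets $V_n,E_n$ ($n\in\mathbb Z$), $V=\bigcup_nV_n$, $E=\bigcup_nE_n$, surjections $r:E_n\to V_n$, $s:E_n\to V_{n-1}$, and partial orders $\le_s,\le_r$ on $E$ such that $e,f$ are $\le_s$-comparable iff $s(e)=s(f)$ and $\le_r$-comparable iff $r(e)=r(f)$. For $m<n$, $E_{m,n}$ is the set of paths $p=(p_{m+1},\dots,p_n)$, $p_i\in E_i$, $r(p_i)=s(p_{i+1})$; $s(p)=s(p_{m+1})$, $r(p)=r(p_n)$. On $E_{m,n}$, $p<_sq$ means that for some $i$, $p_j=q_j$ for $j<i$ and $p_i<_sq_i$; $p<_rq$ means that for some $i$, $p_j=q_j$ for $j>i$ and $p_i<_rq_i$. Edges or paths are $s$-maximal, $s$-minimal,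 $r$-maximal, $r$-minimal if they are so for the corresponding order. $S_s(p)$, $S_r(p)$ denote the immediate $\le_s$-, $\le_r$-successor of $p$ in $E_{m,n}$. $X_{\mathcal B}$ is the space of bi-infinite paths $x=(x_n)_{n\in\mathbb Z}$, $x_n\in E_n$, $r(x_n)=s(x_{n+1})$, with the relative product topology. For $v\in V_n$, $X_v^+$ is the set of one-sided paths $(x_{n+1},x_{n+2},\dots)$ starting at $v$ and $X_v^-$ the set of one-sided paths $(\dots,x_{n-1},x_n)$ ending at $v$. Juxtaposition denotes concatenation (also of sets). $x_v^{s\text{-}max},x_v^{s\text{-}min}\in X_v^+$ are the unique paths all of whose edges are $s$-maximal, resp. $s$-minimal; $x_v^{r\text{-}max},x_v^{r\text{-}min}\in X_v^-$ are defined similarly. The orders $\le_s,\le_r$ on $X_{\mathcal B}$, and on $X_v^+$, $X_v^-$ respectively, are defined by the same formulas as on $E_{m,n}$. $X^{ext}_{\mathcal B}$ is the set of $x\in X_{\mathcal B}$ all of whose edges are $r$-maximal, or all $r$-minimal, or all $s$-maximal, or all $s$-minimal. $\partial_rX_{\mathcal B}$ is the set of $x$ having an immediate successor or an immediate predecessor in $(X_{\mathcal B},\le_r)$; such $x$ has only one of these, denoted $\Delta_r(x)$. $\partial_sX_{\mathcal B}$ and $\Delta_s$ are defined in the same way using $\le_s$. $\Sigma_{\mathcal B}=\{x\in\partial_sX_{\mathcal B}\cap\partial_rX_{\mathcal B}\mid\Delta_s\circ\Delta_r(x)\ne\Delta_r\circ\Delta_s(x)\}$ and $Y_{\mathcal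 B}=X_{\mathcal B}\setminus(X^{ext}_{\mathcal B}\cup\Sigma_{\mathcal B})$. Standing assumptions: (i) finite rank: $\sup_n\#V_n<\infty$; (ii) strongly simple: for every $m$ there are $l<m<n$ such that there are at least two paths from every vertex of $V_l$ to every vertex of $V_m$ and at least two from every vertex of $V_m$ to every vertex of $V_n$; (iii) $X^{ext}_{\mathcal B}\cap\partial_sX_{\mathcal B}$ and $X^{ext}_{\mathcal B}\cap\partial_rX_{\mathcal B}$ are empty. A state is a pair of functions $\nu_r,\nu_s:V\to[0,\infty)$, neither identically zero, with $\nu_r(v)=\sum_{r(e)=v}\nu_r(s(e))$ and $\nu_s(v)=\sum_{s(e)=v}\nu_s(r(e))$. (For strongly simple $\mathcal B$ these are strictly positive.) For $v\in V$, $\nu_s$ also denotes the measure on $X_v^+$ with $\nu_s(pX^+_{r(p)})=\nu_s(r(p))$ for finite paths $p$ with $s(p)=v$, and $\nu_r$ the measure on $X_v^-$ with $\nu_r(X^-_{s(p)}p)=\nu_r(s(p))$ for finite paths $p$ with $r(p)=v$. Set $\varphi_s^v(x)=\nu_s\{y\in X_v^+\mid y\le_sx\}$ for $x\in X_v^+$ and $\varphi_r^v(x)=\nu_r\{y\in X_v^-\mid y\le_rx\}$ for $x\in X_v^-$. $S_{\mathcal B}$ is the quotient space of $Y_{\mathcal B}$ obtained by identifying $x$ with $\Delta_r(x)$ for all $x\in\partial_rX_{\mathcal B}\cap Y_{\mathcal B}$ and $y$ with $\Delta_s(y)$ for all $y\in\partial_sX_{\mathcal B}\cap Y_{\mathcal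 B}$; $\pi:Y_{\mathcal B}\to S_{\mathcal B}$ is the quotient map. $E^Y_{m,n}$ is the set of $p\in E_{m,n}$ that are neither $s$-maximal, $s$-minimal, $r$-maximal nor $r$-minimal and such that $X^-_{s(p)}pX^+_{r(p)}\subseteq Y_{\mathcal B}$. $E^{r/s}_{m,n}$ is the set of quadruples $p=(p^{1,1},p^{1,2},p^{2,1},p^{2,2})$ of distinct paths in $E^Y_{m,n}$ with $p^{1,2}=S_s(p^{1,1})$, $p^{2,1}=S_r(p^{1,1})$, $p^{2,2}=S_s(p^{2,1})=S_r(p^{1,2})$. For such $p$ put $V(p)=\bigcup_{i,j\in\{1,2\}}V_{i,j}(p)$, where $$V_{i,j}(p)=\bigl(X^-_{s(p^{i,j})}\setminus\{a_i\}\bigr)\,p^{i,j}\,\bigl(X^+_{r(p^{i,j})}\setminus\{b_j\}\bigr),$$ with $a_1=x^{r\text{-}min}_{s(p^{1,j})}$, $a_2=x^{r\text{-}max}_{s(p^{2,j})}$, $b_1=x^{s\text{-}min}_{r(p^{i,1})}$, $b_2=x^{s\text{-}max}_{r(p^{i,2})}$. Define $\psi^p:V(p)\to\mathbb R^2$ for $x\in V_{i,j}(p)$ by $$\psi^p(x)=\bigl(\varphi_r^{s(p^{i,j})}(\dots,x_{m-1},x_m)-\delta_{i,1}\nu_r(s(p^{i,j})),\ \varphi_s^{r(p^{i,j})}(x_{n+1},x_{n+2},\dots)-\delta_{j,1}\nu_s(r(p^{i,j}))\bigr),$$ with $\delta$ the Kronecker delta. The map $\psi^p$ identifies exactly those points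 of $V(p)$ identified by $\pi$. A translation surface is a surface with an atlas of charts to $\mathbb R^2$ whose transition maps are translations (locally of the form $z\mapsto z+c$). *)

(* Defs.v *)
From Stdlib Require Import Relations.
From HB Require Import structures.
From mathcomp Require Import all_boot all_order all_algebra.
From mathcomp Require Import all_classical all_reals all_analysis.

Set Implicit Arguments.
Unset Strict Implicit.
Unset Printing Implicit Defensive.

Import Order.TTheory GRing.Theory Num.Theory.
Import numFieldNormedType.Exports.

Local Open Scope classical_set_scope.
Local Open Scope ring_scope.

(* V and E are the disjoint unions of the V_n and of the E_n; the partition
   into levels is recorded by the level functions lvV and lvE.  Given [lv_rng]
   and [lv_src], surjectivity of r and s on the whole is the same as
   surjectivity of every r : E_n -> V_n and every s : E_n -> V_(n-1). *)
Record bratteli := Bratteli {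
  BV : choiceType;
  BE : choiceType;
  lvV : BV -> int;
  lvE : BE -> int;
  rng : BE -> BV;
  src : BE -> BV;
  ler : rel BE;
  les : rel BE;
  finV : forall n, finite_set [set v | lvV v = n];
  finE : forall n, finite_set [set e | lvE e = n];
  neV : forall n, [set v | lvV v = n] !=set0;
  neE : forall n, [set e | lvE e = n] !=set0;
  lv_rng : forall e, lvV (rng e) = lvE e;
  lv_src : forall e, lvV (src e) = lvE e - 1;
  surj_rng : forall v, exists e, rng e = v;
  surj_src : forall v, exists e, src e = v;
  ler_refl : reflexive ler;
  ler_anti : antisymmetric ler;
  ler_trans : transitive ler;
  ler_cmp : forall e f, ler e f || ler f e = (rng e == rng f);
  les_refl : reflexive les;
  les_anti : antisymmetric les;
  les_trans : transitive les;
  les_cmp : forall e f, les e f || les f e = (src e == src f)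
}.

Definition imm_succ {T : Type} (A : set T) (lt : T -> T -> Prop) (x y : T) :=
  [/\ A x, A y, lt x y & forall z, A z -> ~ (lt x z /\ lt z y)].

Definition adjacent {T : Type} (A : set T) (lt : T -> T -> Prop) (x y : T) :=
  imm_succ A lt x y \/ imm_succ A lt y x.

Section Edges.
Context {B : bratteli}.
Local Notation E := (BE B).
Local Notation V := (BV B).
Implicit Types (e f : E) (v : V).

Definition ltr e f : bool := (e != f) && ler e f.
Definition lts e f : bool := (e != f) && les e f.

Definition rmax e := forall f, ~~ ltr e f.
Definition rmin e := forall f, ~~ ltr f e.
Definition smax e := forall f, ~~ lts e f.
Definition smin e := forall f, ~~ lts f e.

End Edges.

Section FinitePaths.
Context {B : bratteli}.
Local Notation E := (BE B).
Local Notation V := (BV B).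

(* The entry of index i of p : finpath m n is the edge p_(m+1+i); for m < n the
   number of entries is n - m. *)
Definition fidx (m n : int) := 'I_(absz (n - m)).-1.+1.
Definition finpath (m n : int) := {ffun fidx m n -> E}.

Definition Epath (m n : int) : set (finpath m n) :=
  [set p : finpath m n |
    [/\ m < n,
        forall i : fidx m n, lvE (p i) = m + 1 + (i : nat)%:Z &
        forall i j : fidx m n, j = i.+1 :> nat -> rng (p i) = src (p j)]].

Context {m n : int}.
Implicit Types p q : finpath m n.

Definition fsrc p : V := src (p ord0).
Definition frng p : V := rng (p ord_max).

Definition flts p q :=
  exists i : fidx m n,
    (forall j : fidx m n, (j < i)%N -> p j = q j) /\ lts (p i) (q i).
Definition fltr p q :=
  exists i : fidx m n,
    (forall j : fidx m n, (i < j)%N -> p j = q j) /\ ltr (p i) (q i).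

Definition fsmax p := forall q, Epath q -> ~ flts p q.
Definition fsmin p := forall q, Epath q -> ~ flts q p.
Definition frmax p := forall q, Epath q -> ~ fltr p q.
Definition frmin p := forall q, Epath q -> ~ fltr q p.

(* [fsucc_s p q] means q = S_s(p), and [fsucc_r p q] means q = S_r(p). *)
Definition fsucc_s p q := imm_succ (@Epath m n) flts p q.
Definition fsucc_r p q := imm_succ (@Epath m n) fltr p q.

End FinitePaths.

Arguments finpath : clear implicits.

Section OneSidedPaths.
Context {B : bratteli}.
Local Notation E := (BE B).
Local Notation V := (BV B).
Implicit Types (v : V) (y z : nat -> E).

(* For v in V_n, y in X_v^+ stands for (x_(n+1), x_(n+2), ...) with
   y k = x_(n+1+k), and y in X_v^- stands for (..., x_(n-1), x_n) read
   backwards, y k = x_(n-k). *)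
Definition Xplus v : set (nat -> E) :=
  [set y | src (y 0%N) = v /\ forall k, rng (y k) = src (y k.+1)].
Definition Xminus v : set (nat -> E) :=
  [set y | rng (y 0%N) = v /\ forall k, src (y k) = rng (y k.+1)].

(* The singletons {x_v^(s-max)}, {x_v^(s-min)}, {x_v^(r-max)} and
   {x_v^(r-min)}. *)
Definition xsmax v := [set y | Xplus v y /\ forall k, smax (y k)].
Definition xsmin v := [set y | Xplus v y /\ forall k, smin (y k)].
Definition xrmax v := [set y | Xminus v y /\ forall k, rmax (y k)].
Definition xrmin v := [set y | Xminus v y /\ forall k, rmin (y k)].

(* Because of the backward indexing, the same formula gives the s-order on
   X_v^+ and the r-order on X_v^-. *)
Definition lex_le (lt : rel E) y z :=
  y = z \/ exists k, (forall j, (j < k)%N -> y j = z j) /\ lt (y k) (z k).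

Lemma onesided_neq0 (a b : E -> V) v : (forall w, exists e, a e = w) ->
  exists y : nat -> E, a (y 0%N) = v /\ forall k, b (y k) = a (y k.+1).
Proof.
move=> sa; pose c w := projT1 (cid (sa w)).
have cP w : a (c w) = w by exact: projT2 (cid (sa w)).
by exists (fun k => iter k (c \o b) (c v)); split=> [|k] /=; rewrite cP.
Qed.

Lemma Xplus_neq0 v : exists y, y \in Xplus v.
Proof.
have [y yP] := onesided_neq0 (@rng B) v (@surj_src B).
by exists y; rewrite inE.
Qed.

Lemma Xminus_neq0 v : exists y, y \in Xminus v.
Proof.
have [y yP] := onesided_neq0 (@src B) v (@surj_rng B).
by exists y; rewrite inE.
Qed.

Definition plusT v : Type := set_type (Xplus v).
Definition minusT v : Type := set_type (Xminus v).

HB.instance Definition _ v := Choice.on (plusT v).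
HB.instance Definition _ v := Choice.on (minusT v).
HB.instance Definition _ v := isPointed.Build (plusT v)
  (let c := cid (Xplus_neq0 v) in exist _ (projT1 c) (projT2 c)).
HB.instance Definition _ v := isPointed.Build (minusT v)
  (let c := cid (Xminus_neq0 v) in exist _ (projT1 c) (projT2 c)).

(* p X^+_(r(p)) for a path p with s(p) = v, and X^-_(s(p)) p for a path p with
   r(p) = v. *)
Definition cyl_plus v m n (p : finpath B m n) : set (plusT v) :=
  [set y : plusT v | forall i : fidx m n, (set_val y : nat -> E) i = p i].
Definition cyl_minus v m n (p : finpath B m n) : set (minusT v) :=
  [set y : minusT v | forall i : fidx m n,
    (set_val y : nat -> E) i = p (rev_ord i)].
Arguments cyl_plus v {m n} p.
Arguments cyl_minus v {m n} p.

Definition cyls_plus v : set (set (plusT v)) :=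
  [set A : set (plusT v) | exists m n (p : finpath B m n),
     [/\ Epath p, fsrc p = v & A = cyl_plus v p]].
Definition cyls_minus v : set (set (minusT v)) :=
  [set A : set (minusT v) | exists m n (p : finpath B m n),
     [/\ Epath p, frng p = v & A = cyl_minus v p]].

(* X_v^+ and X_v^- with their Borel sigma-algebras, which are generated by the
   cylinder sets. *)
Definition plusM v := g_sigma_algebraType (@cyls_plus v).
Definition minusM v := g_sigma_algebraType (@cyls_minus v).

End OneSidedPaths.

Arguments cyl_plus {B} v {m n} p.
Arguments cyl_minus {B} v {m n} p.

Section States.
Context {R : realType} {B : bratteli}.
Local Notation E := (BE B).
Local Notation V := (BV B).

Record state := State {
  nur : V -> R;
  nus : V -> R;
  nur_ge0 : forall v, 0 <= nur v;
  nus_ge0 : forall v, 0 <= nus v;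
  nur_neq0 : exists v, nur v != 0;
  nus_neq0 : exists v, nus v != 0;
  nurE : forall v, nur v = \sum_(e \in [set e | rng e = v]) nur (src e);
  nusE : forall v, nus v = \sum_(e \in [set e | src e = v]) nus (rng e)
}.

Context (nu : state).

Definition is_nus_measure v (mu : {measure set (plusM v) -> \bar R}) :=
  forall m n (p : finpath B m n), Epath p -> fsrc p = v ->
    mu (cyl_plus v p) = (nus nu (frng p))%:E.
Definition is_nur_measure v (mu : {measure set (minusM v) -> \bar R}) :=
  forall m n (p : finpath B m n), Epath p -> frng p = v ->
    mu (cyl_minus v p) = (nur nu (fsrc p))%:E.

(* The measures nu_s on X_v^+ and nu_r on X_v^-, by definite description; the
   zero measure is a junk value. *)
Definition nus_measure v : {measure set (plusM v) -> \bar R} :=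
  if pselect (exists mu, is_nus_measure mu) is left h
  then projT1 (cid h) else mzero.
Definition nur_measure v : {measure set (minusM v) -> \bar R} :=
  if pselect (exists mu, is_nur_measure mu) is left h
  then projT1 (cid h) else mzero.

Definition phi_s v (x : nat -> E) : R :=
  fine (nus_measure v [set y : plusT v | lex_le lts (set_val y) x]).
Definition phi_r v (x : nat -> E) : R :=
  fine (nur_measure v [set y : minusT v | lex_le ltr (set_val y) x]).

End States.

Arguments state : clear implicits.

Section PathSpace.
Context (B : bratteli).
Local Notation E := (BE B).
Implicit Types x y : int -> E.

Definition XB : set (int -> E) :=
  [set x | forall n, lvE (x n) = n /\ rng (x n) = src (x (n + 1))].

Definition xlts x y :=
  exists n, (forall j, j < n -> x j = y j) /\ lts (x n) (y n).
Definition xltr x y :=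
  exists n, (forall j, n < j -> x j = y j) /\ ltr (x n) (y n).

Definition Xext : set (int -> E) :=
  [set x | XB x /\ [\/ forall n, rmax (x n), forall n, rmin (x n),
                       forall n, smax (x n) | forall n, smin (x n)]].

Definition bd_r : set (int -> E) := [set x | exists y, adjacent XB xltr x y].
Definition bd_s : set (int -> E) := [set x | exists y, adjacent XB xlts x y].

(* Only meaningful on bd_r, resp. bd_s; the junk value elsewhere is x. *)
Definition Delta_r x := xget x (adjacent XB xltr x).
Definition Delta_s x := xget x (adjacent XB xlts x).

Definition SigmaB : set (int -> E) :=
  [set x | [/\ bd_s x, bd_r x & Delta_s (Delta_r x) <> Delta_r (Delta_s x)]].

Definition YB : set (int -> E) := XB `\` (Xext `|` SigmaB).

(* The product of the E_n is a subspace of the product of copies of E, so that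
   the relative topology of Y_B may be taken from the latter. *)
Definition pathspace : topologicalType :=
  prod_topology (fun _ : int => discrete_topology E).

Definition Yspace : topologicalType := set_type (YB : set pathspace).

Definition ident (x y : Yspace) : Prop :=
  (bd_r (set_val x) /\ set_val y = Delta_r (set_val x)) \/
  (bd_s (set_val x) /\ set_val y = Delta_s (set_val x)).

Definition Yeq (x y : Yspace) : bool := `[< clos_refl_sym_trans _ ident x y >].

Lemma Yeq_refl : reflexive Yeq.
Proof. by move=> x; apply/asboolP; exact: rst_refl. Qed.

Lemma Yeq_sym : symmetric Yeq.
Proof. by move=> x y; apply/asboolP/asboolP; exact: rst_sym. Qed.

Lemma Yeq_trans : transitive Yeq.
Proof.
by move=> y x z /asboolP xy /asboolP yz; apply/asboolP; exact: rst_trans xy yz.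
Qed.

Canonical Yequiv := EquivRel Yeq Yeq_refl Yeq_sym Yeq_trans.

Definition SB : topologicalType :=
  quotient_topology {eq_quot Yequiv}%qT.

Definition piB (x : Yspace) : SB := (\pi_({eq_quot Yequiv}) x)%qT.

End PathSpace.

Arguments XB : clear implicits.
Arguments Xext : clear implicits.
Arguments bd_r : clear implicits.
Arguments bd_s : clear implicits.
Arguments SigmaB : clear implicits.
Arguments YB : clear implicits.

Section StandingAssumptions.
Context (B : bratteli).

Definition finite_rank :=
  exists K : nat, forall n : int, ([set v : BV B | lvV v = n] #<= `I_K)%card.

Definition two_paths (m n : int) :=
  forall v w : BV B, lvV v = m -> lvV w = n ->
  exists p q : finpath B m n, [/\ Epath p, Epath q, p <> q,
    fsrc p = v /\ frng p = w & fsrc q = v /\ frng q = w].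

Definition strongly_simple :=
  forall m : int, exists l n : int,
    [/\ l < m, m < n, two_paths l m & two_paths m n].

Definition ext_not_bd :=
  Xext B `&` bd_s B = set0 /\ Xext B `&` bd_r B = set0.

End StandingAssumptions.

Section Charts.
Context {B : bratteli}.
Local Notation E := (BE B).

Definition ltail (m : int) (x : int -> E) : nat -> E := fun k => x (m - k%:Z).
Definition rtail (n : int) (x : int -> E) : nat -> E :=
  fun k => x (n + 1 + k%:Z).

Definition juxt m n (A : set (nat -> E)) (p : finpath B m n)
    (C : set (nat -> E)) : set (int -> E) :=
  [set x | [/\ A (ltail m x),
               forall i : fidx m n, x (m + 1 + (i : nat)%:Z) = p i &
               C (rtail n x)]].

Definition EY m n : set (finpath B m n) :=
  [set p | [/\ Epath p, ~ fsmax p /\ ~ fsmin p, ~ frmax p /\ ~ frmin p &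
               juxt (Xminus (fsrc p)) p (Xplus (frng p)) `<=` YB B]].

(* A quadruple (p^(i,j)) is a function of two booleans, false standing for the
   index 1 and true for the index 2. *)
Definition quad m n := bool -> bool -> finpath B m n.

Definition Ers m n : set (quad m n) :=
  [set p | [/\ forall i j, EY (p i j),
               forall i j i' j', p i j = p i' j' -> i = i' /\ j = j',
               fsucc_s (p false false) (p false true),
               fsucc_r (p false false) (p true false) &
               fsucc_s (p true false) (p true true) /\
               fsucc_r (p false true) (p true true)]].

Definition Vij m n (p : quad m n) (i j : bool) : set (int -> E) :=
  let v := fsrc (p i j) in let w := frng (p i j) in
  juxt (Xminus v `\` (if i then xrmax v else xrmin v))
       (p i j)
       (Xplus w `\` (if j then xsmax w else xsmin w)).

Definition VB m n (p : quad m n) : set (int -> E) :=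
  [set x | exists i j, Vij p i j x].

Definition YP m n (p : quad m n) : set (SB B) :=
  [set piB x | x in [set x : Yspace B | VB p (set_val x)]].

Context {R : realType} (nu : state R B).

(* The value at x in V_(i,j)(p) of psi^p. *)
Definition psi m n (p : quad m n) (i j : bool) (x : int -> E) : R * R :=
  let v := fsrc (p i j) in let w := frng (p i j) in
  (phi_r nu v (ltail m x) - (i == false)%:R * nur nu v,
   phi_s nu w (rtail n x) - (j == false)%:R * nus nu w).

(* psi^p = f \o pi on V(p); the values of f outside Y(p) are irrelevant. *)
Definition is_eta m n (p : quad m n) (f : SB B -> R * R) :=
  forall i j (x : Yspace B), Vij p i j (set_val x) ->
    f (piB x) = psi p i j (set_val x).

End Charts.

Arguments quad : clear implicits.

Section Surfaces.
Context {R : realType} {T : topologicalType}.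

(* f restricts to a homeomorphism from U to f @` U, for the relative
   topologies. *)
Definition homeo_to_image (U : set T) (f : T -> R * R) :=
  [/\ set_inj U f,
      {within U, continuous f} &
      forall W : set T, open W ->
        exists2 O : set (R * R), open O & f @` (U `&` W) = f @` U `&` O].

Definition planar_chart (U : set T) (f : T -> R * R) :=
  [/\ open U, open (f @` U) & homeo_to_image U f].

(* A set of charts, each given by its domain and a map. *)
Definition translation_atlas (A : set (set T * (T -> R * R))) :=
  [/\ forall c, A c -> planar_chart c.1 c.2,
      \bigcup_(c in A) c.1 = setT &
      forall c d, A c -> A d -> forall t, (d.2 @` (c.1 `&` d.1)) t ->
        exists w : R * R, \forall u \near t, forall z, c.1 z -> d.1 z ->
          d.2 z = u -> c.2 z = u + w].

End Surfaces.

Definition surface (R : realType) (T : topologicalType) :=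
  [/\ hausdorff_space T, @second_countable T &
      forall z : T, exists (U : set T) (f : T -> R * R),
        U z /\ planar_chart U f].

(* Main.v *)
From Stdlib Require Import Relations.
Require Import Defs.
From HB Require Import structures.
From mathcomp Require Import all_boot all_order all_algebra.
From mathcomp Require Import all_classical all_reals all_analysis.
From mathcomp Require Import zify lra.

Set Implicit Arguments.
Unset Strict Implicit.
Unset Printing Implicit Defensive.

Import Order.TTheory GRing.Theory Num.Theory.
Import numFieldNormedType.Exports.

Local Open Scope classical_set_scope.
Local Open Scope ring_scope.

(* For a vertex v, phi_s^v codes X_v^+ by [0, nu_s(v)]: with d(e) the total
   weight of the edges below e, phi_s^v(y) = sum_k d(y_k), and nu_s shrinks to
   0 along every path by strong simplicity.  Hence phi_s^v is onto, and it
   identifies exactly the pairs (immediate predecessor, immediate successor).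
   Applied to both halves of a path this shows that V(p) is saturated, that
   psi^p(V(p)) is an open rectangle, and that psi^p identifies the same points
   as pi.

   The topology is then controlled without compactness.  Around x in Y_B take
   the window [-N, N] of x, completed to the left by r-extremal and to the right
   by s-extremal edges: this point c lies in Y_B, on both boundaries, so its
   four images under the Delta's form a commuting square, and their windows form
   a quadruple p in E^(r/s) with x in V(p).  For N large these four points are
   close to the at most four points identified with x.  So the Y(p) form a
   countable basis, which gives the covering, the Hausdorff property and second
   countability.  If Y(q) is contained in Y(p), then psi^p - psi^q is constant on
   each V_(i,j)(q), and the four constants agree because the corner points of
   V(q) are identified by pi.  Hence eta^p is open and the transition maps are
   translations.

   Everything about <=_r is obtained from <=_s on the diagram read backwards. *)

(** * Edges *)

(** An element of E^Y needs its whole cylinder inside [YB], so [YB] has to be shown open, and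
    [SigmaB] is the only difficulty. Neighbours are odometer carries: an s-neighbour changes a path
    only from an index b on, an r-neighbour only up to an index a. If a < b the two changes commute;
    so a point of [SigmaB] has b <= a, and once a window of it is non-extremal, that window and the
    types of the two extremal tails determine the point. Near a given path only four such points can
    occur.

    A general point of [YB] has no neighbours at all and yields no quadruple by itself; this is why
    a doubly extremal completion c of its window is used.

    The measures are given by definite description. They are first constructed, and then used only
    through the two-sided bounds [is_cdf], which determine the coding functions.

    Since [dual] swaps [src] and [rng] by definition, [Xminus] in [B] is convertible with [Xplus] in
    [dual B]; only bi-infinite paths and windows need an explicit reversal. *)

Section EdgeOrder.
Context {B : bratteli}.
Implicit Types (e f g : BE B) (v : BV B).

Lemma les_src e f : les e f -> src e = src f.
Proof. by move=> h; apply/eqP; rewrite -les_cmp h. Qed.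

Lemma lts_src e f : lts e f -> src e = src f.
Proof. by move=> /andP[_ /les_src]. Qed.

Lemma lts_irr e : ~~ lts e e.
Proof. by rewrite /lts eqxx. Qed.

Lemma lts_trans : transitive (@lts B).
Proof.
move=> f e g /andP[ef lef] /andP[fg lfg]; apply/andP; split.
  by apply: contra_neq ef => eg; apply: les_anti; rewrite lef eg.
exact: les_trans lef lfg.
Qed.

Lemma lts_asym e f : lts e f -> lts f e -> False.
Proof. by move=> ef fe; move: (lts_trans ef fe); rewrite (negbTE (lts_irr e)). Qed.

Lemma lts_total e f : src e = src f -> [\/ e = f, lts e f | lts f e].
Proof.
move=> /eqP; rewrite -les_cmp; have [->|ef] := eqVneq e f; first by constructor 1.
by case/orP=> h; [constructor 2|constructor 3]; rewrite /lts h ?ef // eq_sym ef.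
Qed.

Lemma lts_le_trans e f g : lts e f -> les f g -> lts e g.
Proof.
move=> ef fg; have [<-//|fg'] := eqVneq f g.
by apply: lts_trans ef _; rewrite /lts fg' fg.
Qed.

Lemma finite_src v : finite_set [set e | src e = v].
Proof.
apply: (sub_finite_set _ (finE B (lvV v + 1))) => e /= <-.
by rewrite lv_src subrK.
Qed.

(** A set of edges with a common source is a chain, so finiteness suffices. In [orev B] the same
    statement provides greatest elements. *)
Lemma les_least (A : set (BE B)) : finite_set A -> A !=set0 ->
  (forall e f, A e -> A f -> src e = src f) ->
  exists2 e, A e & forall f, A f -> les e f.
Proof.
move=> /finite_seqP[s ->]; elim: s => [[]//|e s IH] _ As.
have [[f fs]|s0] := pselect ([set` s] !=set0); last first.
  exists e => [|f]; first by rewrite /= mem_head.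
  rewrite /= inE => /predU1P[->|fs]; [exact: les_refl|].
  by exfalso; apply: s0; exists f.
have [|f' f's minf'] := IH (ex_intro _ f fs).
  by move=> x y xs ys; apply: As; rewrite /= inE; apply/orP; right.
have : src e = src f' by apply: As; rewrite /= inE ?eqxx // f's orbT.
move=> /eqP; rewrite -les_cmp => /orP[ef'|f'e].
  exists e => [|g]; rewrite /= ?mem_head // inE => /predU1P[->|/minf' f'g].
    exact: les_refl.
  exact: les_trans ef' f'g.
by exists f' => [|g]; rewrite /= inE ?f's ?orbT // => /predU1P[->|/minf'].
Qed.

Lemma ex_smin v : exists e, src e = v /\ smin e.
Proof.
have [|e <- emin] := les_least (finite_src v) (surj_src v).
  by move=> e f /= -> ->.
exists e; split=> // f; apply/negP => fe.
have := lts_le_trans fe (emin _ (lts_src fe)).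
by rewrite (negbTE (lts_irr f)).
Qed.

Lemma smin_uniq e f : smin e -> smin f -> src e = src f -> e = f.
Proof.
move=> me mf /lts_total[//||] h; first by have := mf e; rewrite h.
by have := me f; rewrite h.
Qed.

(** The second clause asks for a least element above [e] rather than for the absence of edges in
    between. The two agree because a fibre of [src] is a chain, and this form composes directly with
    [lts_le_trans]. *)
Definition esucc e f := lts e f /\ forall g, lts e g -> les f g.

Lemma ex_esucc e : ~ smax e -> exists f, esucc e f.
Proof.
move=> /existsNP[f /negP/negPn ef].
have [|||g eg gmin] := @les_least [set g | lts e g].
- by apply: (sub_finite_set _ (finite_src (src e))) => g /= /lts_src.
- by exists f.
- by move=> g h /= /lts_src <- /lts_src <-.
- by exists g; split.
Qed.

Lemma esucc_uniq e f g : esucc e f -> esucc e g -> f = g.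
Proof.
move=> [ef fmin] [eg gmin]; apply: les_anti.
by rewrite fmin // gmin.
Qed.

Lemma esucc_uniql e f g : esucc e g -> esucc f g -> e = f.
Proof.
move=> [eg emin] [fg fmin].
have /lts_total[//|h|h] : src e = src f by rewrite (lts_src eg) (lts_src fg).
- by have := lts_le_trans fg (emin _ h); rewrite (negbTE (lts_irr f)).
- by have := lts_le_trans eg (fmin _ h); rewrite (negbTE (lts_irr e)).
Qed.

End EdgeOrder.

(* The diagram read backwards: [x] becomes [n |-> x (1 - n)], and the two orders
   are exchanged. *)
Definition dual (B : bratteli) : bratteli.
Proof.
refine (@Bratteli (BV B) (BE B) (fun v => - lvV v) (fun e => 1 - lvE e)
  (@src B) (@rng B) (@les B) (@ler B) _ _ _ _ _ _ (@surj_src B) (@surj_rng B)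
  (@les_refl B) (@les_anti B) (@les_trans B) (@les_cmp B)
  (@ler_refl B) (@ler_anti B) (@ler_trans B) (@ler_cmp B)).
- by move=> n; apply: (sub_finite_set _ (finV B (- n))) => v /= <-; rewrite opprK.
- by move=> n; apply: (sub_finite_set _ (finE B (1 - n))) => v /= <-; lia.
- by move=> n; have [v vn] := neV B (- n); exists v; rewrite /= vn opprK.
- by move=> n; have [v vn] := neE B (1 - n); exists v; rewrite /= vn; lia.
- by move=> e; rewrite lv_src; lia.
- by move=> e; rewrite lv_rng; lia.
Defined.

(* Reversing the s-order exchanges successors and predecessors. *)
Definition orev (B : bratteli) : bratteli.
Proof.
refine (@Bratteli (BV B) (BE B) (@lvV B) (@lvE B)
  (@rng B) (@src B) (@ler B) (fun e f => les f e) (@finV B) (@finE B)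
  (@neV B) (@neE B) (@lv_rng B) (@lv_src B) (@surj_rng B) (@surj_src B)
  (@ler_refl B) (@ler_anti B) (@ler_trans B) (@ler_cmp B)
  (@les_refl B) _ _ _).
- by move=> e f /andP[h1 h2]; apply: les_anti; rewrite h1 h2.
- by move=> f e g ef fg; exact: les_trans fg ef.
- by move=> e f; rewrite orbC; exact: les_cmp.
Defined.

Section Reversal.
Context {B : bratteli}.
Implicit Types (e f g : BE B) (v : BV B).

Lemma lts_orev e f : @lts (orev B) e f = lts f e.
Proof. by rewrite /lts eq_sym. Qed.

Lemma smax_orev e : @smax (orev B) e <-> smin e.
Proof. by split=> h f; have := h f; rewrite lts_orev. Qed.

Lemma smin_orev e : @smin (orev B) e <-> smax e.
Proof. by split=> h f; have := h f; rewrite lts_orev. Qed.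

(** [esucc] is phrased from below, so its behaviour under reversal is not formal: it uses totality
    on the fibres of [src]. *)
Lemma esucc_orev e f : @esucc (orev B) e f <-> esucc f e.
Proof.
split=> -[ef mn].
  rewrite lts_orev in ef; split=> // g fg.
  have [ge||] : [\/ g = e, lts g e | lts e g].
    by apply: lts_total; rewrite -(lts_src ef) (lts_src fg).
  - by rewrite ge; exact: les_refl.
  - move=> ge; have := mn g; rewrite lts_orev => /(_ ge) /= gf.
    by have := lts_le_trans fg gf; rewrite (negbTE (lts_irr f)).
  - by case/andP.
split=> [|g]; rewrite lts_orev // => ge /=.
have [gf||] : [\/ g = f, @lts B g f | @lts B f g].
  by apply: (@lts_total B); rewrite (lts_src ef) (lts_src ge).
- by rewrite gf; exact: les_refl.
- by case/andP.
- by move=> fg; have := lts_le_trans ge (mn _ fg); rewrite (negbTE (@lts_irr B g)).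
Qed.

Lemma ex_smax v : exists e, src e = v /\ smax e.
Proof. by have [e [ev /smin_orev]] := @ex_smin (orev B) v; exists e. Qed.

Lemma smax_uniq e f : smax e -> smax f -> src e = src f -> e = f.
Proof.
by move=> /smin_orev me /smin_orev mf; exact: (@smin_uniq (orev B)) me mf.
Qed.

Lemma esucc_src e f : esucc e f -> src e = src f.
Proof. by move=> [/lts_src]. Qed.

End Reversal.

(** * Bi-infinite paths and their immediate neighbours *)

Section Paths.
Context {B : bratteli}.
Local Notation E := (BE B).
Implicit Types (x y z : int -> E) (m n : int) (l t : nat -> E).

Lemma XB_lv x n : XB B x -> lvE (x n) = n.
Proof. by move=> /(_ n)[]. Qed.

Lemma XB_next x n : XB B x -> rng (x n) = src (x (n + 1)).
Proof. by move=> /(_ n)[]. Qed.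

Lemma XB_prev x n : XB B x -> src (x n) = rng (x (n - 1)).
Proof. by move=> xB; rewrite (XB_next _ xB) subrK. Qed.

Lemma Xplus_rtail x n : XB B x -> Xplus (rng (x n)) (rtail n x).
Proof.
move=> xB; split=> [|k]; first by rewrite /rtail addr0 -(XB_next _ xB).
by rewrite /rtail (XB_next _ xB); congr (src (x _)); lia.
Qed.

Lemma Xminus_ltail x n : XB B x -> Xminus (src (x (n + 1))) (ltail n x).
Proof.
move=> xB; split=> [|k]; first by rewrite /ltail subr0 -(XB_next _ xB).
by rewrite /ltail (XB_prev _ xB); congr (rng (x _)); lia.
Qed.

Lemma Xplus_lv v t k : Xplus v t -> lvE (t k) = lvV v + 1 + k%:Z.
Proof.
move=> [t0 tS]; elim: k => [|k IH]; first by rewrite -t0 lv_src; lia.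
by have := lv_src (t k.+1); rewrite -tS lv_rng IH; lia.
Qed.

Lemma Xminus_lv v l k : Xminus v l -> lvE (l k) = lvV v - k%:Z.
Proof.
move=> [l0 lS]; elim: k => [|k IH]; first by rewrite -l0 lv_rng; lia.
by have := lv_rng (l k.+1); rewrite -lS lv_src IH; lia.
Qed.

(** [l] and [t] carry the one-sided indexings of [ltail] and [rtail]; only the values of [c] on the
    indices in (m, n] matter. *)
Definition join m n (l : nat -> E) (c : int -> E) (t : nat -> E) : int -> E :=
  fun j : int => if j <= m then l (absz (m - j)%R) else
           if j <= n then c j else t (absz (j - n - 1)%R).

Section Join.
Variables (m n : int) (l : nat -> E) (c : int -> E) (t : nat -> E).
Hypothesis mn : m < n.
Local Notation z := (join m n l c t).

Lemma ltail_join : ltail m z = l.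
Proof.
apply/funext => k; rewrite /ltail /join ifT; last by lia.
by congr l; lia.
Qed.

Lemma rtail_join : rtail n z = t.
Proof.
apply/funext => k; rewrite /rtail /join !ifF; [|lia..].
by congr t; lia.
Qed.

Lemma join_mid j : m < j -> j <= n -> z j = c j.
Proof. by move=> mj jn; rewrite /join ifF ?jn //; lia. Qed.

Lemma XB_join : (forall j, m < j -> j <= n -> lvE (c j) = j) ->
  (forall j, m < j -> j < n -> rng (c j) = src (c (j + 1))) ->
  Xminus (src (c (m + 1))) l -> Xplus (rng (c n)) t -> XB B z.
Proof.
move=> clv cS lm tn.
have lvm : lvV (src (c (m + 1))) = m by rewrite lv_src clv; lia.
have lvn : lvV (rng (c n)) = n by rewrite lv_rng clv; lia.
move=> j; rewrite /join; have [jm|mj] := leP j m.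
  split; first by rewrite (Xminus_lv _ lm) lvm; lia.
  have [j1m|] := leP (j + 1) m.
    rewrite [absz _](_ : _ = (absz (m - (j + 1))%R).+1); last by lia.
    by rewrite -lm.2.
  move=> mj1; have -> : j = m by lia.
  by rewrite ifT ?subrr ?lm.1 //; lia.
have -> : (j + 1 <= m) = false by lia.
have [jn|nj] := leP j n.
  split; first exact: clv.
  have [j1n|nj1] := leP (j + 1) n; first by rewrite cS //; lia.
  have -> : j = n by lia.
  by rewrite -tn.1; congr (src (t _)); lia.
split; first by rewrite (Xplus_lv _ tn) lvn; lia.
rewrite ifF ?tn.2; last by lia.
by congr (src (t _)); lia.
Qed.

End Join.

Lemma join_tails m n x : join m n (ltail m x) x (rtail n x) = x.
Proof.
apply/funext => j; rewrite /join /ltail /rtail.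
case: ifP => [|jm]; first by move=> jm; congr x; lia.
by case: ifP => // jn; congr x; lia.
Qed.

Lemma tail_choice (P : E -> Prop) v :
  (forall w, exists e, src e = w /\ P e) ->
  exists2 t, Xplus v t & forall k, P (t k).
Proof.
move=> h; pose g w := projT1 (cid (h w)).
have gP w : src (g w) = w /\ P (g w) by exact: projT2 (cid (h w)).
exists (fun k => iter k (fun e => g (rng e)) (g v)).
  by split=> [|k] /=; rewrite (gP _).1.
by case=> [|k] /=; apply: (gP _).2.
Qed.

Lemma tail_uniq (P : E -> Prop) v t t' :
  (forall e f, P e -> P f -> src e = src f -> e = f) ->
  Xplus v t -> Xplus v t' -> (forall k, P (t k)) -> (forall k, P (t' k)) ->
  t = t'.
Proof.
move=> Puniq tv tv' Pt Pt'; apply/funext; elim=> [|k IH]; apply: Puniq => //.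
  by rewrite tv.1 tv'.1.
by rewrite -tv.2 -tv'.2 IH.
Qed.

(** With [P] trivial this perturbs a single edge; with [P] an extremality condition it builds
    immediate neighbours. *)
Lemma extend (P : E -> Prop) x n e :
  (forall w, exists f, src f = w /\ P f) -> XB B x -> src e = src (x n) ->
  exists z, [/\ XB B z, forall j, j < n -> z j = x j, z n = e &
                forall j, n < j -> P (z j)].
Proof.
move=> hP xB ex; have [t tv Pt] := tail_choice (rng e) hP.
exists (join (n - 1) n (ltail (n - 1) x) (fun=> e) t); split.
- apply: XB_join => //; [lia| |lia|].
    move=> j ? ?; have : lvE e = n.
      by have := lv_src e; rewrite ex lv_src (XB_lv _ xB); lia.
    by lia.
  have := Xminus_ltail (n - 1) xB; by rewrite subrK ex.
- move=> j jn; rewrite /join ifT; last by lia.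
  by rewrite /ltail; congr x; lia.
- by rewrite join_mid //; lia.
- by move=> j nj; rewrite /join !ifF; [|lia..].
Qed.

Definition splice n x y : int -> E := fun j => if j <= n then x j else y j.

Lemma XB_splice n x y : XB B x -> XB B y -> rng (x n) = rng (y n) ->
  XB B (splice n x y).
Proof.
move=> xB yB xyn j; rewrite /splice; have [jn|nj] := leP j n.
  split; first exact: XB_lv.
  have [j1n|] := leP (j + 1) n; first exact: XB_next.
  move=> nj1; have -> : j = n by lia.
  by rewrite xyn (XB_next _ yB).
rewrite ifF; last by lia.
exact: yB.
Qed.

Lemma last_int (P : int -> Prop) n : (forall j, n < j -> ~ P j) ->
  (exists j, P j) -> exists2 j, P j & forall i, j < i -> ~ P i.
Proof.
move=> Pn [j0 Pj0].
have jn j : P j -> j <= n by move=> Pj; rewrite leNgt; apply/negP => /Pn.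
have ex : exists k : nat, `[< P (n - k%:Z) >].
  exists (absz (n - j0)%R); apply/asboolP; rewrite (_ : n - _ = j0) //.
  by have := jn _ Pj0; lia.
have [k /asboolP Pk kmin] := ex_minnP ex.
exists (n - k%:Z) => // i ki Pi.
have /kmin : `[< P (n - (absz (n - i)%R)%:Z) >].
  by apply/asboolP; rewrite (_ : n - _ = i) //; have := jn _ Pi; lia.
by have := jn _ Pi; lia.
Qed.

End Paths.

Section Adjacency.
Context {B : bratteli}.
Local Notation E := (BE B).
Implicit Types (x y z : int -> E) (m n : int).

(** An odometer carry at index [n]: a common past, one step up at [n], and a maximal tail reset to a
    minimal one. *)
Definition sadj n x y :=
  [/\ forall j, j < n -> x j = y j, esucc (x n) (y n),
      forall j, n < j -> smax (x j) & forall j, n < j -> smin (y j)].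

Definition ssucc x y := imm_succ (XB B) (@xlts B) x y.

(** An edge strictly between [x n] and [y n], a later edge above [x j], or a later edge below [y j]
    would each give a path strictly in between. Conversely, the first differences of an intermediate
    path with [x] and with [y] have no admissible positions. *)
Lemma ssuccP x y :
  ssucc x y <-> [/\ XB B x, XB B y & exists n, sadj n x y].
Proof.
split=> [[xB yB [n [xy ltn]] nobetween]|].
  have anyP w : exists e : E, src e = w /\ True.
    by have [e ew] := surj_src w; exists e.
  split=> //; exists n; split=> //.
  - split=> // g xg; have [<-|gy|yg] : [\/ g = y n, lts g (y n) | lts (y n) g].
      by apply: lts_total; rewrite -(lts_src xg) (lts_src ltn).
    + exact: les_refl.
    + have [|z [zB zx zn _]] := extend anyP xB (e := g) (n := n).
        by rewrite (lts_src xg).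
      exfalso; apply: (nobetween z zB); split; exists n; rewrite zn; split=> //.
        by move=> j jn; rewrite zx.
      by move=> j jn; rewrite zx // xy.
    + by case/andP: yg.
  - move=> j nj f; apply/negP => xf.
    have [|z [zB zx zn _]] := extend anyP xB (e := f) (n := j).
      by rewrite (lts_src xf).
    apply: (nobetween z zB); split; [exists j|exists n].
      by rewrite zn; split=> // i ij; rewrite zx.
    by rewrite zx //; split=> // i ij; rewrite zx ?xy //; lia.
  - move=> j nj f; apply/negP => fy.
    have [|z [zB zy zn _]] := extend anyP yB (e := f) (n := j).
      by rewrite (lts_src fy).
    apply: (nobetween z zB); split; [exists n|exists j].
      by rewrite zy //; split=> // i ij; rewrite zy ?xy //; lia.
    by rewrite zn; split=> // i ij; rewrite zy.
move=> [xB yB [n [xy [ltn nmin] xmax ymin]]]; split=> //; first by exists n.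
move=> z zB [[k [xz ltk]] [l [zy ltl]]].
have [nk|kn|kn] := ltgtP n k; first by have := xmax _ nk (z k); rewrite ltk.
  have [kl|lk|kl] := ltgtP k l.
  - by move: ltk; rewrite (zy _ kl) -xy // (negbTE (lts_irr _)).
  - move: ltl; rewrite -xz // xy ?(negbTE (lts_irr _)) //; lia.
  - by move: ltk ltl; rewrite -kl -xy //; exact: lts_asym.
have [nl|ln|nl] := ltgtP n l; first by have := ymin _ nl (z l); rewrite ltl.
  by move: ltl; rewrite -xz -?kn // xy // (negbTE (lts_irr _)).
move: ltk ltl; rewrite -kn -nl => /nmin h1 /lts_le_trans/(_ h1).
by rewrite (negbTE (lts_irr _)).
Qed.

Lemma XB_uniq_right (P : E -> Prop) n x y :
  (forall e f, P e -> P f -> src e = src f -> e = f) ->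
  XB B x -> XB B y -> rng (x n) = rng (y n) ->
  (forall j, n < j -> P (x j)) -> (forall j, n < j -> P (y j)) ->
  forall j, n < j -> x j = y j.
Proof.
move=> Puniq xB yB xyn Px Py j nj.
have xyt : rtail n x = rtail n y.
  apply: (tail_uniq Puniq (Xplus_rtail n xB)).
  - by rewrite xyn; exact: Xplus_rtail.
  - by move=> k; apply: Px; lia.
  - by move=> k; apply: Py; lia.
have := congr1 (fun t => t (absz (j - n - 1)%R)) xyt.
by rewrite /rtail /= (_ : n + 1 + _ = j) //; lia.
Qed.

(** The carry index is the last index at which [x] is not s-maximal, so it depends on [x] alone. *)
Lemma sadj_uniq x y z m n : XB B y -> XB B z ->
  sadj m x y -> sadj n x z -> m = n /\ y = z.
Proof.
move=> yB zB [xy xym xmax ymin] [xz xzn xmax' zmin].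
have mn : m = n.
  have [mn|nm|//] := ltgtP m n.
    by have := xmax _ mn (z n); rewrite (proj1 xzn).
  by have := xmax' _ nm (y m); rewrite (proj1 xym).
split=> //; subst m; have yzn := esucc_uniq xym xzn.
apply/funext => j; have [nj|jn|<-//] := ltgtP n j; last by rewrite -xy // xz.
by apply: (XB_uniq_right (@smin_uniq B) yB zB _ ymin zmin) => //; rewrite yzn.
Qed.

End Adjacency.

Section AdjacencyReversal.
Context {B : bratteli}.
Implicit Types (x y z : int -> BE B) (m n : int).

Lemma sadj_orev n x y : @sadj (orev B) n x y <-> @sadj B n y x.
Proof.
split=> -[xy xyn h1 h2]; split.
- by move=> j jn; rewrite xy.
- exact/(@esucc_orev B).
- by move=> j nj; apply/(@smin_orev B); exact: h2.
- by move=> j nj; apply/(@smax_orev B); exact: h1.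
- by move=> j jn; rewrite xy.
- exact/(@esucc_orev B).
- by move=> j nj; apply/(@smax_orev B); exact: h2.
- by move=> j nj; apply/(@smin_orev B); exact: h1.
Qed.

Lemma sadj_uniql x y z m n : XB B x -> XB B y ->
  sadj m x z -> sadj n y z -> m = n /\ x = y.
Proof.
move=> xB yB /sadj_orev h1 /sadj_orev h2.
exact: (@sadj_uniq (orev B)) xB yB h1 h2.
Qed.

End AdjacencyReversal.

(** * Windows of bi-infinite paths *)

Section Windows.
Context {B : bratteli}.
Local Notation E := (BE B).
Implicit Types (x y z : int -> E) (m n : int).

Definition restr m n x : finpath B m n := [ffun i : fidx m n => x (m + 1 + (i : nat)%:Z)].

Lemma restrE m n x (i : fidx m n) : restr m n x i = x (m + 1 + (i : nat)%:Z).
Proof. by rewrite ffunE. Qed.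

Lemma Epath_restr m n x : m < n -> XB B x -> Epath (restr m n x).
Proof.
move=> mn xB; split=> // [i|i j ij]; rewrite !restrE; first exact: XB_lv.
by rewrite (XB_next _ xB) ij; congr (src (x _)); lia.
Qed.

Lemma restr_inj m n x y : m < n -> restr m n x = restr m n y ->
  forall j, m < j -> j <= n -> x j = y j.
Proof.
move=> mn xy j mj jn.
have jlt : (absz (j - m - 1)%R < (absz (n - m)%R).-1.+1)%N by lia.
have := congr1 (fun p : finpath B m n => p (Ordinal jlt)) xy.
by rewrite !restrE /= (_ : m + 1 + _ = j) //; lia.
Qed.

Lemma eq_restr m n x y : m < n -> (forall j, m < j -> j <= n -> x j = y j) ->
  restr m n x = restr m n y.
Proof.
move=> mn xy; apply/ffunP => i; rewrite !restrE; apply: xy; first by lia.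
by case: i => i /=; lia.
Qed.

Lemma fsrc_restr m n x : XB B x -> fsrc (restr m n x) = rng (x m).
Proof. by move=> xB; rewrite /fsrc restrE addr0 -(XB_next _ xB). Qed.

Lemma frng_restr m n x : m < n -> frng (restr m n x) = rng (x n).
Proof.
by move=> mn; rewrite /frng restrE; congr (rng (x _)); rewrite /=; lia.
Qed.

Lemma ex_XB m n (p : finpath B m n) l t : Epath p ->
  Xminus (fsrc p) l -> Xplus (frng p) t ->
  exists x, [/\ XB B x, restr m n x = p, ltail m x = l & rtail n x = t].
Proof.
move=> [mn plv pS] pl pt; pose c (j : int) := p (inord (absz (j - m - 1)%R)).
have inordK (j : int) : m < j -> j <= n ->
    (inord (absz (j - m - 1)%R) : fidx m n) = absz (j - m - 1)%R :> nat.
  by move=> mj jn; rewrite inordK //; lia.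
have c0 : c (m + 1) = p ord0.
  by congr (p _); apply: val_inj; rewrite /= inordK; lia.
have cn : c n = p ord_max.
  by congr (p _); apply: val_inj; rewrite /= inordK; lia.
exists (join m n l c t); split; last exact: rtail_join.
- apply: XB_join => //.
  + by move=> j mj jn; rewrite plv inordK //; lia.
  + by move=> j mj jn; apply: pS; rewrite !inordK; lia.
  + by rewrite c0.
  + by rewrite cn.
- apply/ffunP => i; have := ltn_ord i; rewrite restrE => ilt.
  by rewrite join_mid //; [congr (p _); apply: val_inj; rewrite /= inordK|..]; lia.
- exact: ltail_join.
Qed.

Lemma ex_XB_restr m n (p : finpath B m n) : Epath p ->
  exists2 x, XB B x & restr m n x = p.
Proof.
move=> pE; have [l /set_mem lp] := Xminus_neq0 (fsrc p).
have [t /set_mem tp] := Xplus_neq0 (frng p).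
by have [x [xB xp _ _]] := ex_XB pE lp tp; exists x.
Qed.

(** [Q] and [P] are the conditions on the two tails: complements of extremal tails for [Vij],
    everything for a full cylinder. *)
Lemma juxtE m n (p : finpath B m n) (Q P : set (nat -> E)) x : Epath p ->
  juxt (Xminus (fsrc p) `&` Q) p (Xplus (frng p) `&` P) x <->
  [/\ XB B x, restr m n x = p, Q (ltail m x) & P (rtail n x)].
Proof.
move=> pE; have mn : m < n by case: pE.
split=> [[[lp lQ] xp [tp tP]]|[xB xp Ql Pt]].
  have xpE : restr m n x = p by apply/ffunP => i; rewrite restrE.
  (* [x] is not yet known to be a path; it is compared with a path [y] assembled from the same three
     pieces. *)
  have [y [yB yp yl yt]] := ex_XB pE lp tp.
  suff yx : y = x by rewrite -yx in lQ tP *; split.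
  rewrite -(join_tails m n y) yl yt; apply/funext => j.
  rewrite /join /ltail /rtail; case: ifP => jm; first by congr x; lia.
  case: ifP => jn; last by congr x; lia.
  by apply: (restr_inj mn) => //; [rewrite yp xpE|lia].
have fs : fsrc p = src (x (m + 1)) by rewrite -xp fsrc_restr // (XB_next _ xB).
have fr : frng p = rng (x n) by rewrite -xp frng_restr.
split.
- by split=> //; rewrite fs; exact: Xminus_ltail.
- by move=> i; rewrite -xp restrE.
- by split=> //; rewrite fr; exact: Xplus_rtail.
Qed.

Lemma smax_path m n (p : finpath B m n) :
  (forall i, smax (p i)) -> fsmax p.
Proof. by move=> pmax q _ [i [_ h]]; have := pmax i (q i); rewrite h. Qed.

Lemma not_fsmax m n x j : m < n -> XB B x -> m < j -> j <= n ->
  ~ smax (x j) -> ~ fsmax (restr m n x).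
Proof.
move=> mn xB mj jn /existsNP[f /negP/negPn xf] pmax.
have anyP w : exists e : E, src e = w /\ True.
  by have [e ew] := surj_src w; exists e.
have [|z [zB zx zj _]] := extend anyP xB (e := f) (n := j).
  by rewrite (lts_src xf).
apply: (pmax (restr m n z)); first exact: Epath_restr.
have jlt : (absz (j - m - 1)%R < (absz (n - m)%R).-1.+1)%N by lia.
exists (Ordinal jlt); split=> [i /= ij|]; rewrite !restrE.
  by rewrite zx //; lia.
by rewrite /= (_ : m + 1 + _ = j) ?zj //; lia.
Qed.

(** To the left of the window [x] and [y] agree; to the right nothing exceeds [x] and nothing lies
    below [y]. So a path strictly between them first departs from each of them inside the window,
    and its window would lie strictly between theirs. *)
Lemma fsucc_ssucc m n x y : m < n -> XB B x -> XB B y ->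
  fsucc_s (restr m n x) (restr m n y) -> (forall j, j <= m -> x j = y j) ->
  (forall j, n < j -> smax (x j)) -> (forall j, n < j -> smin (y j)) ->
  ssucc x y.
Proof.
move=> mn xB yB [_ _ [i [xyi lti]] nobetween] xy xmax ymin.
rewrite !restrE in lti; set k := m + 1 + _ in lti.
have ki : absz (k - m - 1)%R = i by rewrite /k; lia.
have mk : m < k by rewrite /k; lia.
have kn : k <= n by rewrite /k; case: (i) => /= ?; lia.
have xyk j : j < k -> x j = y j.
  have [jm _|mj jk] := leP j m; first exact: xy.
  have jlt : (absz (j - m - 1)%R < (absz (n - m)%R).-1.+1)%N by lia.
  have := xyi (Ordinal jlt); rewrite !restrE /= (_ : m + 1 + _ = j); last by lia.
  by apply; lia.
split=> //; first by exists k.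
move=> z zB [[a [xz lta]] [b [zy ltb]]].
have an : a <= n.
  by rewrite leNgt; apply/negP => /xmax/(_ (z a)); rewrite lta.
have bn : b <= n.
  by rewrite leNgt; apply/negP => /ymin/(_ (z b)); rewrite ltb.
have ma : m < a.
  rewrite ltNge; apply/negP => am; have [ab|ba|ab] := ltgtP a b.
  - by move: lta; rewrite (zy _ ab) xy // (negbTE (lts_irr _)).
  - by move: ltb; rewrite -(xz _ ba) xy ?(negbTE (lts_irr _)) //; lia.
  - by move: lta ltb; rewrite -ab xy //; exact: lts_asym.
have mb : m < b.
  rewrite ltNge; apply/negP => bm.
  by move: ltb; rewrite -xz ?xy ?(negbTE (lts_irr _)) //; lia.
have pick c : m < c -> c <= n ->
    exists2 i : fidx m n, m + 1 + (i : nat)%:Z = c &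
      forall j : fidx m n, (j < i)%N -> m + 1 + (j : nat)%:Z < c.
  move=> mc cn; have clt : (absz (c - m - 1)%R < (absz (n - m)%R).-1.+1)%N by lia.
  by exists (Ordinal clt) => [|j] /=; lia.
apply: (nobetween (restr m n z)); first exact: Epath_restr.
split; [have [i' ia ja] := pick a ma an|have [i' ia ja] := pick b mb bn].
  by exists i'; split=> [j /ja|]; rewrite !restrE ?ia //; exact: xz.
by exists i'; split=> [j /ja|]; rewrite !restrE ?ia //; exact: zy.
Qed.

(** A finite path strictly between the two windows would extend, along the common left tail of [x]
    and [y], to a bi-infinite path strictly between them. *)
Lemma ssucc_fsucc m n k x y : XB B x -> XB B y -> sadj k x y ->
  m < k -> k <= n -> fsucc_s (restr m n x) (restr m n y).
Proof.
move=> xB yB xyk mk kn; have mn : m < n by lia.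
have [xy xyk1 _ _] := xyk.
have [_ _ _ nobetween] : ssucc x y by apply/ssuccP; split=> //; exists k.
have klt : (absz (k - m - 1)%R < (absz (n - m)%R).-1.+1)%N by lia.
have kE : m + 1 + (Ordinal klt : nat)%:Z = k by rewrite /=; lia.
split; [exact: Epath_restr..| |].
  exists (Ordinal klt); split=> [j jk|]; rewrite !restrE.
    by apply: xy; rewrite /= in jk; lia.
  by rewrite kE; case: xyk1.
move=> z zE [[a [xza lta]] [b [zyb ltb]]].
have zsrc : fsrc z = src (x (m + 1)).
  rewrite /fsrc; have [a0|a0] := eqVneq (a : nat) 0%N.
    have <- : a = ord0 by exact: val_inj.
    by rewrite -(lts_src lta) restrE a0 addr0.
  by rewrite -xza ?restrE /= ?addr0 // lt0n.
have [t /set_mem tz] := Xplus_neq0 (frng z).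
have [|Z [ZB Zz Zl _]] := ex_XB zE (l := ltail m x) _ tz.
  by rewrite zsrc; exact: Xminus_ltail.
have Zx j : j <= m -> Z j = x j.
  move=> jm; have := congr1 (fun l => l (absz (m - j)%R)) Zl.
  by rewrite /ltail (_ : m - _ = j) //; lia.
have Zwin (u : int -> E) (i : fidx m n) :
    (forall j : fidx m n, (j < i)%N -> restr m n u j = restr m n Z j) ->
    (forall j, j <= m -> u j = Z j) ->
    forall j, j < m + 1 + (i : nat)%:Z -> u j = Z j.
  move=> uZ uZm j ji; have [/uZm//|mj] := leP j m.
  have jlt : (absz (j - m - 1)%R < (absz (n - m)%R).-1.+1)%N.
    by have := ltn_ord i; lia.
  have := uZ (Ordinal jlt); rewrite !restrE /= (_ : m + 1 + _ = j); last by lia.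
  by apply; lia.
apply: (nobetween Z ZB); rewrite -Zz in lta xza ltb zyb.
split; [exists (m + 1 + (a : nat)%:Z)|exists (m + 1 + (b : nat)%:Z)].
  split; last by rewrite !restrE in lta.
  by apply: Zwin => // j jm; rewrite Zx.
split; last by rewrite !restrE in ltb.
move=> j jb; apply/esym; move: j jb; apply: Zwin.
  by move=> j jb; rewrite zyb.
by move=> j jm; rewrite Zx // -xy //; lia.
Qed.

End Windows.

(** * Weights along paths *)

(* The half of strong simplicity that concerns paths starting at level m; the
   other half is [branching (dual B)]. *)
Definition branching (B : bratteli) := forall m : int, exists k : nat,
  forall v w : BV B, lvV v = m -> lvV w = m + k%:Z ->
  exists y z : nat -> BE B, [/\ Xplus v y, Xplus v z,
    src (y k) = w, src (z k) = w & exists2 i, (i < k)%N & y i <> z i].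

Section Branching.
Context {B : bratteli}.
Implicit Types (v w : BV B).

Lemma finpath_neq m n (p q : finpath B m n) : p <> q -> exists i, p i <> q i.
Proof.
move=> pq; apply: contra_notP pq => /forallNP h.
by apply/ffunP => i; apply: contrapT => /h.
Qed.

Lemma strongly_simple_branching : strongly_simple B -> branching B.
Proof.
move=> h m; have [_ [n [_ mn _ hn]]] := h m.
exists (absz (n - m)%R) => v w vm wn.
have {}wn : lvV w = n by lia.
have [p [q [pE qE pq [pv pw] [qv qw]]]] := hn v w vm wn.
have [x xB xp] := ex_XB_restr pE; have [y yB yq] := ex_XB_restr qE.
have xw (z : int -> BE B) : XB B z -> src (rtail m z (absz (n - m)%R)) = rng (z n).
  by move=> zB; rewrite (XB_next _ zB) /rtail; congr (src (z _)); lia.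
exists (rtail m x), (rtail m y); split.
- by rewrite -pv -xp fsrc_restr //; exact: Xplus_rtail.
- by rewrite -qv -yq fsrc_restr //; exact: Xplus_rtail.
- by rewrite xw // -pw -xp frng_restr.
- by rewrite xw // -qw -yq frng_restr.
have [i pqi] := finpath_neq pq.
exists i; first by have := ltn_ord i; lia.
by move: pqi; rewrite -xp -yq !restrE.
Qed.

Lemma strongly_simple_branching_dual : strongly_simple B -> branching (dual B).
Proof.
move=> h m; have [l [_ [lm _ hl _]]] := h (- m).
exists (absz (- m - l)%R) => v w vm wl.
have {}vm : @lvV B v = - m by rewrite /= in vm; lia.
have {}wl : @lvV B w = l by rewrite /= in wl; lia.
have [p [q [pE qE pq [pw pv] [qw qv]]]] := hl w v wl vm.
have [x xB xp] := ex_XB_restr pE; have [y yB yq] := ex_XB_restr qE.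
have xw (z : int -> BE B) : XB B z ->
    @src (dual B) (ltail (- m) z (absz (- m - l)%R)) = rng (z l).
  by move=> zB; rewrite /ltail /=; congr (rng (z _)); lia.
have xv (z : int -> BE B) : XB B z -> @Xplus (dual B) (rng (z (- m))) (ltail (- m) z).
  by move=> zB; rewrite (XB_next _ zB); exact (Xminus_ltail _ zB).
exists (ltail (- m) x), (ltail (- m) y); split.
- by rewrite -pv -xp frng_restr //; exact: xv.
- by rewrite -qv -yq frng_restr //; exact: xv.
- by rewrite xw // -pw -xp fsrc_restr.
- by rewrite xw // -qw -yq fsrc_restr.
have [i pqi] := finpath_neq pq; have ilt := ltn_ord i.
exists (absz (- m - (l + 1 + (i : nat)%:Z))%R); first by lia.
have iE : - m - (absz (- m - (l + 1 + (i : nat)%:Z))%R)%:Z = l + 1 + (i : nat)%:Z.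
  by lia.
by move: pqi; rewrite -xp -yq !restrE /ltail iE.
Qed.

End Branching.

Section Weights.
Context {R : realType} {B : bratteli} (nu : state R B).
Local Notation E := (BE B).
Local Notation V := (BV B).
Local Notation w := (nus nu).
Implicit Types (e f : E) (v : V) (A D : set E) (y z : nat -> E).

Lemma wsum_le A D : finite_set D -> A `<=` D ->
  \sum_(e \in A) w (rng e) <= \sum_(e \in D) w (rng e).
Proof.
move=> Dfin AD; rewrite [leRHS](fsbigID A) //= setIC (setIidl AD) lerDl.
by apply: fsumr_ge0 => e _; exact: nus_ge0.
Qed.

Definition below e : R := \sum_(f \in [set f | lts f e]) w (rng f).

Lemma finite_below e : finite_set [set f | lts f e].
Proof. by apply: (sub_finite_set _ (finite_src (src e))) => f /= /lts_src. Qed.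

Lemma below_ge0 e : 0 <= below e.
Proof. by apply: fsumr_ge0 => f _; exact: nus_ge0. Qed.

Lemma wsum_below e : \sum_(f \in [set f | lts f e] `|` [set e]) w (rng f) =
  below e + w (rng e).
Proof.
rewrite fsbigU0 ?fsbig_set1 //; first exact: finite_below.
by move=> f [/= + fe]; rewrite fe (negbTE (lts_irr e)).
Qed.

Lemma below_lt e f : lts e f -> below e + w (rng e) <= below f.
Proof.
move=> ef; rewrite -wsum_below; apply: wsum_le; first exact: finite_below.
by move=> g /= [ge|->//]; exact: lts_trans ge ef.
Qed.

Lemma below_src e : below e + w (rng e) <= w (src e).
Proof.
rewrite -wsum_below nusE; apply: wsum_le; first exact: finite_src.
by move=> g /= [/lts_src|->].
Qed.

Lemma below_esucc e f : esucc e f -> below e + w (rng e) = below f.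
Proof.
move=> [ef fmin]; rewrite -wsum_below; apply: eq_fsbigl; apply/seteqP; split.
  by move=> g /= [ge|->//]; exact: lts_trans ge ef.
move=> g /= gf; have [->|ge|eg] : [\/ g = e, lts g e | lts e g].
  by apply: lts_total; rewrite (lts_src ef) (lts_src gf).
- by right.
- by left.
- by have := lts_le_trans gf (fmin _ eg); rewrite (negbTE (lts_irr g)).
Qed.

Lemma below_smin e : smin e -> below e = 0.
Proof. by move=> emin; apply: fsbig1 => f fe; have := emin f; rewrite fe. Qed.

Lemma below_smax e : smax e -> below e + w (rng e) = w (src e).
Proof.
move=> emax; rewrite -wsum_below nusE; apply: eq_fsbigl.
apply/seteqP; split=> g /=; first by case=> [/lts_src|->].
move=> /lts_total[->|ge|eg]; [by right|by left|].
by have := emax g; rewrite eg.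
Qed.

Lemma w_rng_le e : w (rng e) <= w (src e).
Proof. by have := below_src e; have := below_ge0 e; lra. Qed.

Lemma w_path_le v y i j : Xplus v y -> (i <= j)%N ->
  w (src (y j)) <= w (src (y i)).
Proof.
move=> [_ yS] /subnKC <-; elim: (j - i)%N => [|k IH]; first by rewrite addn0.
by rewrite addnS -yS; apply: le_trans (w_rng_le _) IH.
Qed.

Hypothesis br : branching B.

(** Two distinct paths from [v] to [v'] have disjoint cylinders of weight [w v'] each. Concretely,
    at their first difference the two edges share a source, and their weights together do not exceed
    the weight of that source. *)
Lemma w_half m : exists2 k : nat, (0 < k)%N & forall v v', lvV v = m ->
  lvV v' = m + k%:Z -> 2 * w v' <= w v.
Proof.
have [k hk] := br m; exists k => [|v v' vm vm'].
  have [v vm] := neV B m; have [v' vm'] := neV B (m + k%:Z).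
  by have [y [z [_ _ _ _ [i]]]] := hk _ _ vm vm'; case: k {hk vm'}.
have [y [z [yv zv yk zk [i0 i0k yz]]]] := hk v v' vm vm'.
have ex : exists i, y i != z i by exists i0; apply/eqP.
have [i /eqP yzi imin] := ex_minnP ex.
have ik : (i < k)%N by apply: leq_ltn_trans i0k; apply: imin; apply/eqP.
have yzs : src (y i) = src (z i).
  case: i yzi imin {ik} => [|i] _ imin; first by rewrite yv.1 zv.1.
  rewrite -yv.2 -zv.2; congr rng; apply/eqP; apply: contraT => /imin.
  by rewrite ltnn.
suff: w (rng (y i)) + w (rng (z i)) <= w v.
  have := w_path_le yv ik; have := w_path_le zv ik.
  by rewrite -yv.2 -zv.2 yk zk; lra.
have h1 : w (src (y i)) <= w v by rewrite -[v]yv.1; exact: w_path_le yv _.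
apply: le_trans h1; have [//|yz'|zy'] := lts_total yzs.
- have := below_lt yz'; have := below_src (z i); have := below_ge0 (y i).
  by rewrite yzs; lra.
- have := below_lt zy'; have := below_src (y i); have := below_ge0 (z i).
  by lra.
Qed.

(** A zero at [v] forces, through [w_half], a whole level of zeros. Weights decrease along edges, so
    all higher levels vanish, and the state equation makes all lower levels vanish, against
    [nus_neq0]. *)
Lemma nus_gt0 v : 0 < w v.
Proof.
rewrite lt0r nus_ge0 andbT; apply/eqP => v0.
have [k _ hk] := w_half (lvV v).
have {hk}zn v' : lvV v' = lvV v + k%:Z -> w v' = 0.
  move=> /(hk _ _ erefl); rewrite v0 => h.
  by apply: le_anti; rewrite nus_ge0 andbT; lra.
set n := (lvV v + k%:Z) in zn.
have up (j : nat) v' : lvV v' = n + j%:Z -> w v' = 0.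
  elim: j v' => [|j IH] v' v'n; first by apply: zn; lia.
  have [e ev'] := surj_rng v'; apply: le_anti; rewrite nus_ge0 andbT -ev'.
  apply: le_trans (w_rng_le e) _; rewrite IH // lv_src -lv_rng ev' v'n; lia.
have dn (j : nat) v' : lvV v' = n - j%:Z -> w v' = 0.
  elim: j v' => [|j IH] v' v'n; first by apply: zn; lia.
  rewrite nusE; apply: fsbig1 => e /= ev'; apply: IH.
  by rewrite lv_rng; have := lv_src e; rewrite ev' v'n; lia.
have [v' /eqP] := nus_neq0 nu; apply.
have [h|h] := leP n (lvV v').
  by apply: (up (absz (lvV v' - n)%R)); lia.
by apply: (dn (absz (lvV v' - n)%R)); lia.
Qed.

(** The length of a halving step depends on the level, so there is no rate in [N]; [w_half] is
    iterated until 2^k exceeds [w v / eps]. *)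
Lemma w_small v y (eps : R) : Xplus v y -> 0 < eps ->
  exists N, w (src (y N)) < eps.
Proof.
move=> yv eps0.
have lvy i : lvV (src (y i)) = lvV v + i%:Z.
  by rewrite lv_src (Xplus_lv _ yv); lia.
have pw k : exists N, 2 ^+ k * w (src (y N)) <= w v.
  elim: k => [|k [N IH]]; first by exists 0%N; rewrite yv.1 expr0 mul1r.
  have [j _ hj] := w_half (lvV (src (y N))); exists (N + j)%N.
  have := hj (src (y N)) (src (y (N + j)%N)) erefl.
  rewrite !lvy PoszD addrA => /(_ erefl) h.
  apply: le_trans IH; rewrite exprSr -mulrA ler_pM2l ?exprn_gt0 //.
have [k wk] : exists k, w v < 2 ^+ k * eps.
  exists (Num.bound (w v / eps)).
  rewrite -ltr_pdivrMr //.
  have := archi_boundP (divr_ge0 (nus_ge0 nu v) (ltW eps0)).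
  move=> /lt_le_trans; apply.
  by rewrite -natrX ler_nat ltnW // ltn_expl.
have [N hN] := pw k; exists N.
have p0 : 0 < 2 ^+ k :> R by rewrite exprn_gt0.
by rewrite -(ltr_pM2l p0); apply: le_lt_trans hN wk.
Qed.

End Weights.

Section PartialSums.
Context {R : realType} {B : bratteli} (nu : state R B).
Local Notation E := (BE B).
Local Notation V := (BV B).
Local Notation w := (nus nu).
Implicit Types (e f : E) (v : V) (x y z : nat -> E) (N : nat).

(** The left endpoint of the interval attached to the cylinder of the first [N] edges of [x]; the
    length of this interval is the weight of [src (x N)]. *)
Definition psum x N : R := \sum_(k < N) below nu (x k).

Lemma psum0 x : psum x 0%N = 0.
Proof. by rewrite /psum big_ord0. Qed.

Lemma psumS x N : psum x N.+1 = psum x N + below nu (x N).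
Proof. by rewrite /psum big_ord_recr. Qed.

Lemma psum_ge0 x N : 0 <= psum x N.
Proof. by apply: sumr_ge0 => k _; exact: below_ge0. Qed.

Lemma eq_psum x y N : (forall k, (k < N)%N -> x k = y k) -> psum x N = psum y N.
Proof. by move=> xy; apply: eq_bigr => k _; rewrite xy. Qed.

Lemma psum_le x M N : (M <= N)%N -> psum x M <= psum x N.
Proof.
move=> /subnKC <-; elim: (N - M)%N => [|k IH]; first by rewrite addn0.
by rewrite addnS psumS (le_trans IH) // lerDl below_ge0.
Qed.

Lemma psum_w_le v x M N : Xplus v x -> (M <= N)%N ->
  psum x N + w (src (x N)) <= psum x M + w (src (x M)).
Proof.
move=> xv /subnKC <-; elim: (N - M)%N => [|k IH]; first by rewrite addn0.
apply: le_trans IH; rewrite addnS psumS -xv.2 -addrA lerD2l.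
exact: below_src.
Qed.

Lemma ex_first_diff x y : x <> y ->
  exists2 k, x k <> y k & forall j, (j < k)%N -> x j = y j.
Proof.
move=> xy; have ex : exists k, x k != y k.
  apply: contra_notP xy => /forallNP h; apply/funext => k.
  by apply: contrapT => /eqP /h.
have [k /eqP xyk kmin] := ex_minnP ex; exists k => // j jk.
by apply/eqP; apply: contraT => /kmin; rewrite leqNgt jk.
Qed.

Lemma src_first_diff v x y k : Xplus v x -> Xplus v y ->
  (forall j, (j < k)%N -> x j = y j) -> src (x k) = src (y k).
Proof.
case: k => [|k] xv yv xy; first by rewrite xv.1 yv.1.
by rewrite -xv.2 -yv.2 xy.
Qed.

Lemma Xplus_branch v x M e : Xplus v x -> src e = src (x M) ->
  exists t, [/\ Xplus v t, forall j, (j < M)%N -> t j = x j & t M = e].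
Proof.
move=> xv ex; have [z /set_mem[z0 zS]] := Xplus_neq0 (rng e).
pose y k := if k is k'.+1 then z k' else e.
have yS k : rng (y k) = src (y k.+1) by case: k => [|k] /=; rewrite ?z0 ?zS.
exists (fun k => if (k < M)%N then x k else y (k - M)%N); split.
- split=> [|k]; first by case: M ex => [|M] ex; rewrite ?ltn0 -?xv.1 ?ex.
  have [kM|Mk] := ltnP k M.
    have [k1M|Mk1] := ltnP k.+1 M; first exact: xv.2.
    have Mk : M = k.+1 by apply/eqP; rewrite eqn_leq kM Mk1.
    by rewrite Mk subnn /= ex Mk xv.2.
  by rewrite ltnNge (leqW Mk) /= subSn.
- by move=> j ->.
- by rewrite ltnn subnn.
Qed.

Lemma psum_lts v x y k N : Xplus v x -> Xplus v y ->
  (forall j, (j < k)%N -> x j = y j) -> lts (x k) (y k) -> (k < N)%N ->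
  psum x N + w (src (x N)) <= psum y N.
Proof.
move=> xv yv xy ltk kN; apply: le_trans (psum_w_le xv kN) _.
apply: le_trans (psum_le y kN); rewrite !psumS -xv.2 (eq_psum xy) -addrA lerD2l.
exact: below_lt.
Qed.

(** By [psum_lts] the intervals of distinct cylinders of length [N] overlap at most in an endpoint,
    and half-openness removes that case. *)
Lemma psum_sep v x y N s : Xplus v x -> Xplus v y ->
  psum x N <= s < psum x N + w (src (x N)) ->
  psum y N <= s < psum y N + w (src (y N)) ->
  forall k, (k < N)%N -> x k = y k.
Proof.
move=> xv yv /andP[xs sx] /andP[ys sy].
have [->//|/ex_first_diff[k xyk xy]] := pselect (x = y).
have [kN|Nk] := ltnP k N; last by move=> j jN; apply: xy; exact: leq_trans jN Nk.
have [//|lt|lt] := lts_total (src_first_diff xv yv xy).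
- by have := psum_lts xv yv xy lt kN; lra.
- have yx j : (j < k)%N -> y j = x j by move=> /xy.
  by have := psum_lts yv xv yx lt kN; lra.
Qed.

(** The intervals from [below nu e] to [below nu e + w (rng e)] tile [0, w v). The bounds stand
    under an implication so that [pick_edge] is defined for every [s]. *)
Lemma ex_edge v s : exists e, src e = v /\
  (0 <= s < w v -> below nu e <= s < below nu e + w (rng e)).
Proof.
have [sv|] := boolP (0 <= s < w v); last first.
  by have [e ev] := surj_src v; exists e.
suff [e ev h] : exists2 e, src e = v & below nu e <= s < below nu e + w (rng e).
  by exists e.
(* The edge sought is the least one whose interval ends after [s]. Its predecessor, found below as a
   greatest element in [orev B], ends at or before [s], exactly where the interval of the edge
   begins. *)
pose A := [set e | src e = v /\ s < below nu e + w (rng e)].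
have [||e f [-> _] [-> _] //|e [ev es] emin] := @les_least B A.
- by apply: (sub_finite_set _ (finite_src v)) => e [].
- have [e [ev emax]] := ex_smax v.
  by exists e; split=> //; rewrite below_smax // ev; case/andP: sv.
exists e => //; rewrite es andbT.
have [emn|/existsNP[f /negP/negPn fe]] := pselect (smin e).
  by rewrite below_smin //; case/andP: sv.
have [||f' g' /= /lts_src -> /lts_src ->//|g ge gmax] :=
    @les_least (orev B) [set f | @lts B f e].
- exact: (@finite_below B).
- by exists f.
have : @esucc B g e.
  split=> [|h gh]; first exact: ge.
  have [->|he|/andP[]//] : [\/ h = e, @lts B h e | @lts B e h].
      by apply: (@lts_total B); rewrite -(lts_src gh) (lts_src ge).
    exact: les_refl.
  by have := lts_le_trans gh (gmax _ he); rewrite (negbTE (@lts_irr B g)).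
move=> ge'; rewrite -(below_esucc nu ge') leNgt; apply/negP => sg.
have /emin : A g by split=> //; rewrite (lts_src ge).
by move=> /(lts_le_trans ge); rewrite (negbTE (@lts_irr B g)).
Qed.

Definition pick_edge v s : E := projT1 (cid (ex_edge v s)).

(** The current edge together with the remainder of [s] relative to the source of that edge, that
    is, [s] minus the partial sum so far. *)
Definition code_state v s N : E * R :=
  iter N (fun p => (pick_edge (rng p.1) (p.2 - below nu p.1), p.2 - below nu p.1))
    (pick_edge v s, s).

(* The path whose half-open intervals [psum, psum + w) all contain s. *)
Definition path_code v s N : E := (code_state v s N).1.

Lemma src_pick_edge v s : src (pick_edge v s) = v.
Proof. by rewrite /pick_edge; case: cid => e []. Qed.

Lemma Xplus_path_code v s : Xplus v (path_code v s).
Proof. by split=> [|k]; rewrite /path_code /= src_pick_edge. Qed.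

Lemma path_code_bounds v s N : 0 <= s < w v ->
  psum (path_code v s) N <= s < psum (path_code v s) N + w (src (path_code v s N)).
Proof.
move=> sv.
have codeE k : exists v', [/\ path_code v s k = pick_edge v' (s - psum (path_code v s) k),
    (code_state v s k).2 = s - psum (path_code v s) k & src (path_code v s k) = v'].
  elim: k => [|k [v' [IH1 IH2 IH3]]].
    by exists v; rewrite psum0 subr0 /path_code /= src_pick_edge.
  exists (rng (path_code v s k)); rewrite psumS opprD addrA -IH2.
  by rewrite {1 4}/path_code /= src_pick_edge.
elim: N => [|N IH]; first by rewrite psum0 add0r (Xplus_path_code v s).1.
have [v' [h1 _ h3]] := codeE N.
rewrite psumS -(Xplus_path_code v s).2.
suff : below nu (path_code v s N) <= s - psum (path_code v s) N <
    below nu (path_code v s N) + w (rng (path_code v s N)) by lra.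
rewrite h1 /pick_edge; case: cid => e [ev]; apply.
by rewrite h3 in IH; lra.
Qed.

End PartialSums.

(** * The measure of an order interval *)

Section PathMeasure.
Context {R : realType} {B : bratteli} (nu : state R B) (v : BV B).
Local Notation w := (nus nu).
Context {T : pointedType} (h : T -> nat -> BE B) (G : set (set T)).
Hypothesis h_surj : forall y, Xplus v y -> exists t, h t = y.
Implicit Types (x y : nat -> BE B) (N : nat).

(** [T] with its reading map [h] stands for [plusT] or [minusT], so that one argument serves both
    measures. *)
Definition cyl x N : set T := [set t | forall k, (k < N)%N -> h t k = x k].

(* The measure is the image of Lebesgue measure under [path_code]. *)
Lemma ex_path_measure :
  (forall A, G A -> exists x N, Xplus v x /\ A = cyl x N) ->
  exists mu : {measure set (g_sigma_algebraType G) -> \bar R},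
    forall x N, Xplus v x -> mu (cyl x N) = (w (src (x N)))%:E.
Proof.
move=> GC.
pose dec s := projT1 (cid (h_surj (Xplus_path_code nu v s))).
have decE s : h (dec s) = path_code nu v s by rewrite /dec; case: cid.
pose D : set (measurableTypeR R) := `[0, w v[%classic.
have mD : measurable D by exact: measurable_itv.
(* Off [D] the coding takes the junk value [point]. Hence the preimage of a cylinder contains the
   complement of [D] exactly when the cylinder contains [point]; restricting Lebesgue measure to [D]
   discards this part. *)
pose f (s : measurableTypeR R) : g_sigma_algebraType G :=
  if s \in D then dec s else point.
have fD s : D s -> f s = dec s by move=> sD; rewrite /f mem_set.
have fND s : ~ D s -> f s = point.
  by move=> sD; rewrite /f ifF //; apply/negbTE/negP => /set_mem.
have cylD x N s : Xplus v x -> D s ->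
    cyl x N (f s) <-> psum nu x N <= s < psum nu x N + w (src (x N)).
  move=> xv sD; rewrite fD // /cyl /= decE.
  have sv : 0 <= s < w v by move: sD; rewrite /D /= in_itv.
  have cs := path_code_bounds N sv.
  split=> [cx|sx]; last exact: psum_sep (Xplus_path_code nu v s) xv cs sx.
  by rewrite -(eq_psum nu cx) -(src_first_diff (Xplus_path_code nu v s) xv cx).
have mcyl x N : Xplus v x -> measurable (f @^-1` cyl x N).
  move=> xv; pose I : set (measurableTypeR R) :=
    `[psum nu x N, psum nu x N + w (src (x N))[%classic.
  have mI : measurable I by exact: measurable_itv.
  have [Cp|Cp] := pselect (cyl x N point).
    rewrite (_ : _ @^-1` _ = (D `&` I) `|` ~` D).
      apply: measurableU; first exact: measurableI.
      exact: measurableC.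
    apply/seteqP; split=> s /=; have [sD|sD] := pselect (D s).
    - by move=> /cylD -/(_ xv sD) sI; left; split=> //; rewrite /I /= in_itv.
    - by right.
    - move=> [[_]|//]; rewrite /I /= in_itv /= => sI; exact/cylD.
    - by rewrite fND.
  rewrite (_ : _ @^-1` _ = D `&` I); first exact: measurableI.
  apply/seteqP; split=> s /=; have [sD|sD] := pselect (D s).
  - by move=> /cylD -/(_ xv sD) sI; split=> //; rewrite /I /= in_itv.
  - by rewrite fND.
  - move=> [_]; rewrite /I /= in_itv /= => sI; exact/cylD.
  - by case.
have mf : measurable_fun [set: measurableTypeR R] f.
  apply: (@measurability _ _ _ (g_sigma_algebraType G) _ _ G) => //= _ [_ /GC[x [N [xv ->]]] <-].
  by rewrite setTI; exact: mcyl.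
exists (pushforward (mrestr lebesgue_measure mD) f) => x N xv.
rewrite /= /pushforward /mrestr.
rewrite (_ : _ `&` D = `[psum nu x N, psum nu x N + w (src (x N))[%classic).
  rewrite lebesgue_measure_itv /= lte_fin ltrDl.
  have := nus_ge0 nu (src (x N)); rewrite le_eqVlt => /predU1P[<-|w0].
    by rewrite ltxx.
  by rewrite w0 -EFinB addrAC subrr add0r.
apply/seteqP; split=> s /=; first by move=> [/[swap] sD /cylD]; rewrite in_itv; apply.
rewrite in_itv /= => sI.
have sD : D s.
  have := psum_w_le nu xv (leq0n N); rewrite psum0 add0r xv.1.
  by have := psum_ge0 nu x N; rewrite /D /= in_itv /=; lra.
by split=> //; apply/cylD.
Unshelve. exact: mf.
Qed.

Hypothesis GC : forall x N, (0 < N)%N -> Xplus v x -> G (cyl x N).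

(** The paths below [x] are squeezed between those that drop below [x] before index [M] and the same
    set enlarged by the cylinder of [x] of length [M]. The first set is a disjoint union of
    cylinders branching off [x], with total measure [psum nu x M]. *)
Lemma path_measure_bounds (mu : {measure set (g_sigma_algebraType G) -> \bar R}) :
  (forall x N, (0 < N)%N -> Xplus v x -> mu (cyl x N) = (w (src (x N)))%:E) ->
  forall x N, Xplus v x -> psum nu x N <=
    fine (mu [set t | lex_le lts (h t) x]) <= psum nu x N + w (src (x N)).
Proof.
move=> muC x N xv.
pose T' := g_sigma_algebraType G.
have mcyl y M : (0 < M)%N -> Xplus v y -> measurable (cyl y M : set T').
  by move=> M0 yv; apply: sub_sigma_algebra; exact: GC.
pose lower M : set T' := [set t | exists2 k, (k < M)%N &
  (forall j, (j < k)%N -> h t j = x j) /\ lts (h t k) (x k)].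
pose step M (e : BE B) : set T' :=
  [set t | (forall j, (j < M)%N -> h t j = x j) /\ h t M = e].
have stepP M e : lts e (x M) ->
    measurable (step M e) /\ mu (step M e) = (w (rng e))%:E.
  move=> ltex; have [t [tv tx te]] := Xplus_branch xv (lts_src ltex).
  have -> : step M e = cyl t M.+1.
    apply/seteqP; split=> u /=.
      move=> [ux ue] k; rewrite ltnS leq_eqVlt => /predU1P[->|kM].
        by rewrite ue te.
      by rewrite ux // tx.
    by move=> ut; split=> [j jM|]; [rewrite ut ?tx // ltnW|rewrite ut].
  by split; [exact: mcyl|rewrite muC // -tv.2 te].
pose steps M : set T' := \bigcup_(e in [set e | lts e (x M)]) step M e.
have msteps M : measurable (steps M).
  by apply: fin_bigcup_measurable => [|e /stepP[]//]; exact: finite_below.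
have mu_steps M : mu (steps M) = (below nu (x M))%:E.
  rewrite measure_fin_bigcup; [|exact: finite_below| |by move=> e /stepP[]].
    rewrite /below -fsumEFin; last exact: finite_below.
    by apply: eq_fsbigr => e /set_mem /stepP[].
  by move=> e f _ _ [t [[_ <-] [_ <-]]].
have lowerS M : lower M.+1 = lower M `|` steps M.
  apply/seteqP; split=> t /=.
    move=> [k]; rewrite ltnS leq_eqVlt => /predU1P[->|kM] [hx lt].
      by right; exists (h t M).
    by left; exists k.
  move=> [[k kM htk]|[e lte [hx hte]]]; first by exists k => //; exact: ltnW.
  by exists M; rewrite ?hte.
have lowerP M : measurable (lower M) /\ mu (lower M) = (psum nu x M)%:E.
  elim: M => [|M [IH1 IH2]].
    rewrite (_ : lower _ = set0); first by rewrite measure0 psum0; split.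
    by apply/seteqP; split=> t // [].
  rewrite lowerS; split; first exact: measurableU.
  rewrite measureU //; first by rewrite psumS EFinD; congr (_ + _)%E; [exact: IH2|exact: mu_steps].
  apply/seteqP; split=> t // [[k kM [_ lt]] [e _ [hx _]]].
  by move: lt; rewrite hx // (negbTE (lts_irr _)).
pose L : set T' := [set t | lex_le lts (h t) x].
have mL : measurable L.
  rewrite (_ : L = (\bigcup_M lower M) `|` (\bigcap_M cyl x M.+1)).
    apply: measurableU; first by apply: bigcupT_measurable => M; case: (lowerP M).
    by apply: bigcapT_measurable => M; exact: mcyl.
  apply/seteqP; split=> t /=.
    move=> [hx|[k [hx lt]]]; first by right => M _ k _; rewrite hx.
    by left; exists k.+1 => //; exists k.
  move=> [[M _ [k _ htk]]|hx]; first by right; exists k.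
  by left; apply/funext => k; exact: (hx k I).
have lowerL M : lower M `<=` L by move=> t [k _ htk]; right; exists k.
have Lupper M : L `<=` lower M `|` cyl x M.
  move=> t [hx|[k [hx lt]]]; first by right => k _; rewrite hx.
  have [kM|Mk] := ltnP k M; first by left; exists k.
  by right => j jM; apply: hx; exact: leq_trans jM Mk.
have main M : (0 < M)%N ->
    ((psum nu x M)%:E <= mu L <= (psum nu x M + w (src (x M)))%:E)%E.
  move=> M0; have [mM muM] := lowerP M; rewrite -{1}muM; apply/andP; split.
    by apply: le_measure; rewrite ?inE.
  rewrite EFinD -muM -muC //; apply: (@le_trans _ _ (mu (lower M `|` cyl x M))).
    by apply: le_measure; rewrite ?inE //; apply: measurableU => //; exact: mcyl.
  rewrite measureU //; first exact: mcyl.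
  apply/seteqP; split=> t // [[k kM [_ lt]] hx].
  by move: lt; rewrite hx // (negbTE (lts_irr _)).
have Lfin : mu L \is a fin_num.
  rewrite ge0_fin_numE //; have /andP[_ /le_lt_trans] := main 1%N isT.
  by apply; rewrite ltry.
have {}main M : (0 < M)%N ->
    psum nu x M <= fine (mu L) <= psum nu x M + w (src (x M)).
  by move=> /main; rewrite -{1 2}(fineK Lfin) !lee_fin.
(* Length 0 is separate because finite paths have at least one edge, so [mu] is only prescribed on
   cylinders of positive length. *)
case: N => [|N]; last exact: main.
rewrite psum0 add0r fine_ge0 //=.
have /andP[_ /le_trans] := main 1%N isT; apply.
by have := psum_w_le nu xv (leq0n 1); rewrite psum0 add0r.
Qed.

End PathMeasure.

Lemma set_val_surj (T : Type) (A : set T) y : A y ->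
  exists t : set_type A, set_val t = y.
Proof. by move=> Ay; exists (SigSub (mem_set Ay)). Qed.

Definition dual_state (R : realType) (B : bratteli) (nu : state R B) :
    state R (dual B) :=
  @State R (dual B) (nus nu) (nur nu) (nus_ge0 nu) (nur_ge0 nu)
    (nus_neq0 nu) (nur_neq0 nu) (nusE nu) (nurE nu).

(** The only property of the coding functions used afterwards. As the weights along a path tend to
    0, it determines [phi]. *)
Definition is_cdf (R : realType) (B : bratteli) (nu : state R B)
    (phi : BV B -> (nat -> BE B) -> R) :=
  forall v x N, Xplus v x ->
    psum nu x N <= phi v x <= psum nu x N + nus nu (src (x N)).

Section Cdf.
Context {R : realType} {B : bratteli} (nu : state R B).
Local Notation E := (BE B).
Implicit Types (v : BV B) (x y : nat -> E) (N : nat).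

Lemma cyl_plusE v m n (p : finpath B m n) : Epath p -> fsrc p = v ->
  exists x, [/\ Xplus v x, frng p = src (x (absz (n - m)%R)) &
    cyl_plus v p = cyl (fun y : plusT v => set_val y) x (absz (n - m)%R)].
Proof.
move=> pE pv; have mn : m < n by case: pE.
have [x xB xp] := ex_XB_restr pE; exists (rtail m x); split.
- by rewrite -pv -xp fsrc_restr //; exact: Xplus_rtail.
- rewrite -xp frng_restr // (XB_next _ xB) /rtail.
  by congr (src (x _)); lia.
- apply/seteqP; split=> y /= yp.
    move=> k kN; have klt : (k < (absz (n - m)%R).-1.+1)%N by lia.
    by rewrite (yp (Ordinal klt)) -xp restrE.
  move=> i; have := ltn_ord i => ilt; rewrite yp; last by lia.
  by rewrite -xp restrE.
Qed.

(** Backward indexing makes a cylinder of X_v^- a cylinder of the dual diagram, with the edges of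
    [p] in reverse order. *)
Lemma cyl_minusE v m n (p : finpath B m n) : Epath p -> frng p = v ->
  exists x, [/\ Xminus v x, fsrc p = rng (x (absz (n - m)%R)) &
    cyl_minus v p =
      @cyl (dual B) _ (fun y : minusT v => set_val y) x (absz (n - m)%R)].
Proof.
move=> pE pv; have mn : m < n by case: pE.
have [x xB xp] := ex_XB_restr pE; exists (ltail n x); split.
- rewrite -pv -xp frng_restr // (XB_next _ xB); exact: Xminus_ltail.
- rewrite -xp fsrc_restr // /ltail.
  by congr (rng (x _)); lia.
- apply/seteqP; split=> y /= yp.
    move=> k kN; have klt : (k < (absz (n - m)%R).-1.+1)%N by lia.
    rewrite (yp (Ordinal klt)) -xp restrE /ltail; congr x => /=.
    by rewrite subSS; lia.
  move=> i; have := ltn_ord i => ilt; rewrite yp; last by lia.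
  by rewrite -xp restrE /ltail; congr x => /=; rewrite subSS; lia.
Qed.

Lemma Xplus_cyl v x N : (0 < N)%N -> Xplus v x ->
  exists m n (p : finpath B m n), [/\ Epath p, fsrc p = v,
    frng p = src (x N) & cyl_plus v p = cyl (fun y : plusT v => set_val y) x N].
Proof.
move=> N0 xv; exists (lvV v), (lvV v + N%:Z), [ffun i => x (nat_of_ord i)].
have lt (i : fidx (lvV v) (lvV v + N%:Z)) : (i < N)%N.
  by have := ltn_ord i; lia.
split.
- split; first by lia.
    by move=> i; rewrite ffunE (Xplus_lv _ xv).
  by move=> i j ij; rewrite !ffunE ij xv.2.
- by rewrite /fsrc ffunE xv.1.
- by rewrite /frng ffunE xv.2; congr (src (x _)); rewrite /=; lia.
- apply/seteqP; split=> y /= yx; last by move=> i; rewrite ffunE yx.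
  move=> k kN.
  have klt : (k < (absz (lvV v + N%:Z - lvV v)%R).-1.+1)%N by lia.
  by rewrite (yx (Ordinal klt)) ffunE.
Qed.

Lemma Xminus_cyl v x N : (0 < N)%N -> Xminus v x ->
  exists m n (p : finpath B m n), [/\ Epath p, frng p = v,
    fsrc p = rng (x N) &
    cyl_minus v p = @cyl (dual B) _ (fun y : minusT v => set_val y) x N].
Proof.
move=> N0 xv.
exists (lvV v - N%:Z), (lvV v), [ffun i => x (nat_of_ord (rev_ord i))].
have lt (i : fidx (lvV v - N%:Z) (lvV v)) : (i < N)%N.
  by have := ltn_ord i; lia.
split.
- split; first by lia.
    by move=> i; rewrite ffunE (Xminus_lv _ xv) /= subSS; have := lt i; lia.
  move=> i j ij; rewrite !ffunE xv.2; congr (rng (x _)) => /=.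
  by rewrite !subSS ij; have := lt j; rewrite ij; lia.
- rewrite /frng ffunE -xv.1; congr (rng (x _)) => /=; lia.
- rewrite /fsrc ffunE xv.2; congr (rng (x _)) => /=; lia.
- apply/seteqP; split=> y /= yx.
    move=> k kN.
    have klt : (k < (absz (lvV v - (lvV v - N%:Z))%R).-1.+1)%N by lia.
    by rewrite (yx (Ordinal klt)) ffunE; congr (x _) => /=; lia.
  move=> i; have := ltn_ord i => ilt; rewrite ffunE yx; last exact: lt.
  by congr (x _) => /=; lia.
Qed.

(** [ex_path_measure] shows that the definite description of the measure is not the junk value.
    Whichever measure it selects, only its values on cylinders enter. *)
Lemma phi_s_cdf : is_cdf nu (phi_s nu).
Proof.
move=> v x N xv; rewrite /phi_s.
pose h (t : plusT v) : nat -> E := set_val t.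
have hS := @set_val_surj _ (Xplus v).
have [|mu muP] := ex_path_measure nu (G := @cyls_plus B v) hS.
  move=> A [m [n [p [pE pv ->]]]].
  have [y [yv _ ->]] := cyl_plusE pE pv.
  by exists y, (absz (n - m)%R).
have muex : exists mu : {measure set (plusM v) -> \bar R}, is_nus_measure nu mu.
  exists mu => m n p pE pv; have [y [yv -> ->]] := cyl_plusE pE pv.
  exact: muP.
apply: path_measure_bounds xv => //.
  move=> y M M0 yv; have [m [n [p [pE pv _ <-]]]] := Xplus_cyl M0 yv.
  by exists m, n, p.
move=> y M M0 yv; have [m [n [p [pE pv <- <-]]]] := Xplus_cyl M0 yv.
rewrite /nus_measure; case: pselect => // H.
exact: (projT2 (cid H)).
Qed.

Lemma phi_r_cdf : is_cdf (dual_state nu) (phi_r nu).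
Proof.
move=> v x N xv; rewrite /phi_r.
pose h (t : @minusT B v) : nat -> E := set_val t.
have hS := @set_val_surj _ (@Xminus B v).
have [|mu muP] := @ex_path_measure R (dual B) (dual_state nu) v (@minusT B v) h (@cyls_minus B v) hS.
  move=> A [m [n [p [pE pv ->]]]].
  have [y [yv _ ->]] := cyl_minusE pE pv.
  by exists y, (absz (n - m)%R).
have muex : exists mu : {measure set (@minusM B v) -> \bar R}, is_nur_measure nu mu.
  exists mu => m n p pE pv; have [y [yv -> ->]] := cyl_minusE pE pv.
  exact: muP.
apply: (@path_measure_bounds R (dual B) (dual_state nu) v (@minusT B v) h (@cyls_minus B v)) xv => //.
  move=> y M M0 yv; have [m [n [p [pE pv _ <-]]]] := Xminus_cyl M0 yv.
  by exists m, n, p.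
move=> y M M0 yv; have [m [n [p [pE pv /= <- <-]]]] := Xminus_cyl M0 yv.
rewrite /nur_measure; case: pselect => // H.
exact: (projT2 (cid H)).
Qed.

End Cdf.

(** * Coding one-sided paths by an interval *)

Section CdfTheory.
Context {R : realType} {B : bratteli} (nu : state R B).
Context {phi : BV B -> (nat -> BE B) -> R}.
Hypotheses (br : branching B) (cdf : is_cdf nu phi).
Local Notation w := (nus nu).
Local Notation E := (BE B).
Implicit Types (v : BV B) (x y : nat -> E) (N : nat).

Definition dropn N x : nat -> E := fun k => x (N + k)%N.

Lemma Xplus_dropn v x N : Xplus v x -> Xplus (src (x N)) (dropn N x).
Proof.
move=> xv; split=> [|k]; first by rewrite /dropn addn0.
by rewrite /dropn addnS xv.2.
Qed.

Lemma pcdf_eq v x s : Xplus v x ->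
  (forall N, psum nu x N <= s <= psum nu x N + w (src (x N))) -> phi v x = s.
Proof.
move=> xv xs; apply/eqP; apply: contraT => neq.
have d0 : 0 < `|phi v x - s| by rewrite normr_gt0 subr_eq0.
have [N hN] := w_small nu br xv d0.
have /andP[h1 h2] := cdf N xv; have /andP[h3 h4] := xs N.
suff: `|phi v x - s| <= w (src (x N)) by lra.
by rewrite ler_norml; lra.
Qed.

Lemma pcdf_ge0 v x : Xplus v x -> 0 <= phi v x.
Proof. by move=> xv; have /andP[+ _] := cdf 0%N xv; rewrite psum0. Qed.

Lemma pcdf_le v x : Xplus v x -> phi v x <= w v.
Proof. by move=> xv; have /andP[_] := cdf 0%N xv; rewrite psum0 add0r xv.1. Qed.

Lemma psum_dropn x N M : psum nu x (N + M)%N = psum nu x N + psum nu (dropn N x) M.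
Proof.
elim: M => [|M IH]; first by rewrite addn0 psum0 addr0.
by rewrite addnS !psumS IH addrA.
Qed.

(** Self-similarity: inside the cylinder of the first [N] edges the coding is a translate of the
    coding at [src (x N)]. The transition maps are translations for this reason. *)
Lemma pcdf_dropn v x N : Xplus v x ->
  phi v x = psum nu x N + phi (src (x N)) (dropn N x).
Proof.
move=> xv; apply: pcdf_eq => // M.
have xs := Xplus_dropn N xv.
have /andP[h1 h2] := cdf M xs.
have h3 := psum_le nu x (leq_addl N M).
have h4 := psum_w_le nu xv (leq_addl N M).
rewrite psum_dropn in h3 h4; rewrite {2}/dropn in h2.
by apply/andP; split; lra.
Qed.

Lemma pcdf_smin v x : Xplus v x -> (forall k, smin (x k)) -> phi v x = 0.
Proof.
move=> xv xmin; apply: pcdf_eq => // N.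
have -> : psum nu x N = 0 by apply: big1 => k _; exact: below_smin.
by rewrite add0r lexx nus_ge0.
Qed.

Lemma pcdf_smax v x : Xplus v x -> (forall k, smax (x k)) -> phi v x = w v.
Proof.
move=> xv xmax; apply: pcdf_eq => // N.
have -> : psum nu x N = w v - w (src (x N)).
  elim: N => [|N IH]; first by rewrite psum0 xv.1 subrr.
  rewrite psumS IH -xv.2; have := below_smax nu (xmax N); lra.
by have := nus_ge0 nu (src (x N)); lra.
Qed.

Lemma pcdf_eq0 v x : Xplus v x -> phi v x = 0 -> forall k, smin (x k).
Proof.
move=> xv x0 k f; apply/negP => fx.
have /andP[+ _] := cdf k.+1 xv; rewrite x0 psumS.
have := psum_ge0 nu x k; have := below_lt nu fx; have := below_ge0 nu f.
have := nus_gt0 nu br (rng f); lra.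
Qed.

Lemma pcdf_eq_max v x : Xplus v x -> phi v x = w v -> forall k, smax (x k).
Proof.
move=> xv x1 k f; apply/negP => xf.
have /andP[_ +] := cdf k.+1 xv; rewrite x1 psumS -xv.2.
have := psum_w_le nu xv (leq0n k); rewrite psum0 add0r xv.1.
have := below_lt nu xf; have := below_src nu f; rewrite -(lts_src xf).
have := nus_gt0 nu br (rng f); lra.
Qed.

Definition oadj x y := exists k, [/\ forall j, (j < k)%N -> x j = y j,
  esucc (x k) (y k), forall j, (k < j)%N -> smax (x j) &
  forall j, (k < j)%N -> smin (y j)].

Lemma pcdf_oadj v x y : Xplus v x -> Xplus v y -> oadj x y -> phi v x = phi v y.
Proof.
move=> xv yv [k [xy xyk xmax ymin]].
rewrite (pcdf_dropn k.+1 xv) (pcdf_dropn k.+1 yv).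
rewrite (pcdf_smax (Xplus_dropn _ xv)); last by move=> j; apply: xmax; lia.
rewrite (pcdf_smin (Xplus_dropn _ yv)); last by move=> j; apply: ymin; lia.
by rewrite !psumS (eq_psum nu xy) -(below_esucc nu xyk) -xv.2 addr0 addrA.
Qed.

(** At the first difference the intervals of the two edges are ordered, so equal codes force the
    upper end of one to meet the lower end of the other. An edge in between would have positive
    weight, and the two tails must have full and zero code. *)
Lemma pcdf_inj v x y : Xplus v x -> Xplus v y -> phi v x = phi v y ->
  [\/ x = y, oadj x y | oadj y x].
Proof.
move=> xv yv; have [->|/ex_first_diff[k xyk xy]] := pselect (x = y).
  by constructor 1.
wlog lt : x y xv yv xyk xy / lts (x k) (y k) => [hw pxy|].
  have [//|lt|lt] := lts_total (src_first_diff xv yv xy); first exact: hw.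
  have [->|h|h] := hw y x yv xv (nesym xyk) (fun j jk => esym (xy j jk)) lt (esym pxy).
  - by constructor 1.
  - by constructor 3.
  - by constructor 2.
rewrite (pcdf_dropn k.+1 xv) (pcdf_dropn k.+1 yv) !psumS (eq_psum nu xy) => e.
have xs := Xplus_dropn k.+1 xv; have ys := Xplus_dropn k.+1 yv.
have h1 := pcdf_le xs; have h2 := pcdf_ge0 ys; have h3 := below_lt nu lt.
rewrite xv.2 in h3.
have hx : phi (src (x k.+1)) (dropn k.+1 x) = w (src (x k.+1)) by lra.
have hy : phi (src (y k.+1)) (dropn k.+1 y) = 0 by lra.
constructor 2; exists k; split=> //.
- split=> // f xf; have [->|yf|fy] : [\/ f = y k, lts f (y k) | lts (y k) f].
    by apply: lts_total; rewrite -(lts_src xf) (lts_src lt).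
  + exact: les_refl.
  + have := below_lt nu xf; have := below_lt nu yf; have := nus_gt0 nu br (rng f).
    by rewrite xv.2; lra.
  + by case/andP: fy.
- move=> j kj; have := pcdf_eq_max xs hx (j - k.+1)%N.
  by rewrite /dropn subnKC.
- move=> j kj; have := pcdf_eq0 ys hy (j - k.+1)%N.
  by rewrite /dropn subnKC.
Qed.

(** The value [w v] is treated apart: [path_code] works with half-open intervals and misses the
    right endpoint, which is the code of the maximal path. *)
Lemma pcdf_surj v s : 0 <= s <= w v -> exists2 x, Xplus v x & phi v x = s.
Proof.
move=> /andP[s0]; rewrite le_eqVlt => /predU1P[->|sv].
  have [x xv xmax] := tail_choice v (@ex_smax B).
  by exists x => //; exact: pcdf_smax.
have s0v : 0 <= s < w v by rewrite s0.
exists (path_code nu v s); first exact: Xplus_path_code.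
apply: pcdf_eq => [|N]; first exact: Xplus_path_code.
by have := path_code_bounds N s0v; lra.
Qed.

End CdfTheory.

(** * The boundaries of the path space *)

Section Boundary.
Context {B : bratteli}.
Local Notation E := (BE B).
Implicit Types (x y z : int -> E) (n m : int).

(** An edge that is both s-maximal and s-minimal is alone at its source. Excluding tails of such
    edges is what prevents a path from having both a successor and a predecessor. *)
Definition no_flat := forall x n, XB B x ->
  ~ forall j, n < j -> smax (x j) /\ smin (x j).

Definition snbr x y := Defs.adjacent (XB B) (@xlts B) x y.

Lemma snbr_sym x y : snbr x y -> snbr y x.
Proof. by case; [right|left]. Qed.

Lemma snbr_XB x y : snbr x y -> XB B x /\ XB B y.
Proof. by case=> -[]. Qed.

(** The type of the right tail of a path that has a successor ([false]) or a predecessor ([true]);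
    its neighbour then has tail type [~~ d]. *)
Definition sext (d : bool) (e : E) := if d then smin e else smax e.

Lemma ex_sext d v : exists e, src e = v /\ sext d e.
Proof. by case: d; [exact: ex_smin|exact: ex_smax]. Qed.

Lemma sext_uniq d e f : sext d e -> sext d f -> src e = src f -> e = f.
Proof. by case: d; [exact: smin_uniq|exact: smax_uniq]. Qed.

(* [snbr_at d n x y]: [y] is the successor ([d = false]) or the predecessor
   ([d = true]) of [x], and differs from [x] from the index [n] on. *)
Definition snbr_at (d : bool) n x y := if d then sadj n y x else sadj n x y.

Lemma snbr_atP x y : snbr x y <->
  [/\ XB B x, XB B y & exists d n, snbr_at d n x y].
Proof.
split=> [[/ssuccP|/ssuccP][xB yB [n h]]|[xB yB [[] [n h]]]].
- by split=> //; exists false, n.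
- by split=> //; exists true, n.
- by right; apply/ssuccP; split=> //; exists n.
- by left; apply/ssuccP; split=> //; exists n.
Qed.

Lemma snbr_at_sym d n x y : snbr_at d n x y -> snbr_at (~~ d) n y x.
Proof. by case: d. Qed.

Lemma snbr_at_eq d n x y j : snbr_at d n x y -> j < n -> x j = y j.
Proof. by case: d => -[xy _ _ _] jn; rewrite xy. Qed.

Lemma snbr_at_ext d n x y j : snbr_at d n x y -> n < j -> sext d (x j).
Proof. by case: d => -[_ _ h1 h2] jn; [exact: h2|exact: h1]. Qed.

Lemma snbr_at_next d n x y : snbr_at d n x y -> ~ sext d (x n).
Proof.
case: d => -[_ [lt _] _ _] h; first by have := h (y n); rewrite lt.
by have := h (y n); rewrite lt.
Qed.

Lemma snbr_at_src d n x y : snbr_at d n x y -> src (x n) = src (y n).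
Proof. by case: d => -[_ /esucc_src]. Qed.

Lemma snbr_at_uniq d m n x y z : XB B y -> XB B z ->
  snbr_at d m x y -> snbr_at d n x z -> m = n /\ y = z.
Proof. by case: d; [exact: sadj_uniql|exact: sadj_uniq]. Qed.

(** The carry takes place at the last index whose edge is not extremal of type [d]. Predecessors
    come from successors in [orev B]. *)
Lemma ex_snbr_at d n x : XB B x -> (forall j, n < j -> sext d (x j)) ->
  ~ (forall j, sext d (x j)) -> exists m y, XB B y /\ snbr_at d m x y.
Proof.
have hs (C : bratteli) (u : int -> BE C) : XB C u ->
    (forall j, n < j -> smax (u j)) -> ~ (forall j, smax (u j)) ->
    exists m (y : int -> BE C), XB C y /\ sadj m u y.
  move=> uB umax /existsNP[j0 uj0].
  have [|m um umaxm] := @last_int (fun j => ~ smax (u j)) n _ (ex_intro _ j0 uj0).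
    by move=> j /umax h; apply.
  have [f uf] := ex_esucc um.
  have [|y [yB yu ym ymin]] := extend (@ex_smin C) uB (e := f) (n := m).
    by rewrite (esucc_src uf).
  exists m, y; split=> //; split=> // [j jm|| j mj]; first by rewrite yu.
    by rewrite ym.
  by apply: contrapT; apply: umaxm.
case: d => /= xB xe nx; last exact: hs.
have [| |m [y [yB xy]]] := hs (orev B) x xB.
- by move=> j /xe h; apply/smax_orev.
- by apply: contra_not nx => h j; apply/smax_orev.
- by exists m, y; split=> //; exact/sadj_orev.
Qed.

Hypothesis nf : no_flat.

Lemma sext_excl d d' m n x : XB B x -> (forall j, m < j -> sext d (x j)) ->
  (forall j, n < j -> sext d' (x j)) -> d = d'.
Proof.
wlog : d d' m n / d = false => [hw|-> {d}] xB h1 h2.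
  case: d h1 => h1; last exact: (hw false d' m n).
  by case: d' h2 => // h2; apply/esym; apply: (hw false true n m).
case: d' h2 => // h2; exfalso; apply: (nf (n := Num.max m n) xB) => j.
by rewrite gt_max => /andP[/h1 ? /h2].
Qed.

Lemma snbr_uniq x y z : snbr x y -> snbr x z -> y = z.
Proof.
move=> /snbr_atP[xB yB [d [n xy]]] /snbr_atP[_ zB [d' [m xz]]].
have dd : d = d'.
  exact: (sext_excl xB (fun j => snbr_at_ext xy) (fun j => snbr_at_ext xz)).
subst d'; exact: (snbr_at_uniq yB zB xy xz).2.
Qed.

Lemma Delta_sE x y : snbr x y -> Delta_s x = y.
Proof.
by move=> xy; apply: (xget_unique _ xy) => z xz; exact: snbr_uniq xz xy.
Qed.

Lemma Delta_s_snbr x : bd_s B x -> snbr x (Delta_s x).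
Proof. by move=> [y xy]; rewrite (Delta_sE xy). Qed.

Lemma Delta_s_junk x : ~ bd_s B x -> Delta_s x = x.
Proof. by move=> h; apply: xgetPN => y xy; apply: h; exists y. Qed.

(** Having an s-neighbour depends only on the right tail, unless no edge is left where a carry could
    stop. *)
Lemma bd_s_tail n x y : XB B y -> bd_s B x -> (forall j, n < j -> x j = y j) ->
  bd_s B y \/ exists d, forall j, sext d (y j).
Proof.
move=> yB [z /snbr_atP[xB zB [d [m xz]]]] xy.
have [h|h] := pselect (forall j, sext d (y j)); first by right; exists d.
left; have [|k [u [uB yu]]] := ex_snbr_at (n := Num.max m n) yB _ h.
  move=> j; rewrite gt_max => /andP[mj nj]; rewrite -xy //.
  exact: snbr_at_ext xz mj.
by exists u; apply/snbr_atP; split=> //; exists d, k.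
Qed.

End Boundary.
Arguments no_flat : clear implicits.

(** * Transfer to the r-order by reading paths backwards *)

Definition flip {T : Type} (x : int -> T) : int -> T := fun n => x (1 - n).

Lemma flipE {T : Type} (x : int -> T) n : flip x (1 - n) = x n.
Proof. by rewrite /flip opprB addrC subrK. Qed.

Lemma flipK {T : Type} : involutive (@flip T).
Proof. by move=> x; apply/funext => n; rewrite /flip opprB addrC subrK. Qed.

Section Flip.
Context {B : bratteli}.
Local Notation E := (BE B).
Implicit Types (x y z : int -> E) (n m j : int).

Lemma XB_flip x : XB (dual B) (flip x) <-> XB B x.
Proof.
split=> h n.
  have [h1 h2] := h (1 - n); have [_ h3] := h (- n).
  rewrite /= flipE in h1; rewrite /= /flip in h2 h3.
  split; first by lia.
  rewrite (_ : 1 - - n = n + 1) in h3; last by lia.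
  by rewrite h3; congr (rng (x _)); lia.
have [h1 _] := h (1 - n); have [_ h2] := h (- n).
split; first by rewrite /= /flip h1; lia.
rewrite /= /flip (_ : 1 - (n + 1) = - n); last by lia.
by rewrite h2 addrC.
Qed.

Lemma xlts_flip x y : @xlts (dual B) (flip x) (flip y) <-> xltr x y.
Proof.
split=> -[n [xy lt]].
  exists (1 - n); split=> // j nj.
  by have := xy (1 - j); rewrite !flipE; apply; lia.
by exists (1 - n); rewrite !flipE; split=> // j jn; apply: xy; lia.
Qed.

Definition rnbr x y := Defs.adjacent (XB B) (@xltr B) x y.

Lemma rnbr_flip x y : rnbr x y <-> @snbr (dual B) (flip x) (flip y).
Proof.
have h u v : imm_succ (XB B) (@xltr B) u v <->
    imm_succ (XB (dual B)) (@xlts (dual B)) (flip u) (flip v).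
  split=> -[uB vB uv nb].
    split; [exact/XB_flip|exact/XB_flip|exact/xlts_flip|].
    move=> z /= zB [uz zv]; apply: (nb (flip z)).
      by apply/XB_flip; rewrite flipK.
    by split; apply/xlts_flip; rewrite flipK.
  split; [exact/XB_flip|exact/XB_flip|exact/xlts_flip|].
  move=> z zB [uz zv]; apply: (nb (flip z)); first exact/XB_flip.
  by split; apply/xlts_flip.
by split; case=> /h; [left|right|left|right].
Qed.

Definition rext (d : bool) (e : E) := if d then rmin e else rmax e.

Lemma rext_dual d e : rext d e = @sext (dual B) d e.
Proof. by []. Qed.

(** The index is reflected, so that [n] is the last index at which [x] and [y] differ. *)
Definition rnbr_at (d : bool) n x y := @snbr_at (dual B) d (1 - n) (flip x) (flip y).

Lemma rnbr_atP x y : rnbr x y <->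
  [/\ XB B x, XB B y & exists d n, rnbr_at d n x y].
Proof.
split.
  move=> /rnbr_flip/snbr_atP[/XB_flip xB /XB_flip yB [d [n h]]]; split=> //.
  by exists d, (1 - n); rewrite /rnbr_at opprB addrC subrK.
move=> [xB yB [d [n h]]]; apply/rnbr_flip/snbr_atP.
by split; [exact/XB_flip|exact/XB_flip|exists d, (1 - n)].
Qed.

Lemma rnbr_sym x y : rnbr x y -> rnbr y x.
Proof. by case; [right|left]. Qed.

Lemma rnbr_XB x y : rnbr x y -> XB B x /\ XB B y.
Proof. by case=> -[]. Qed.

Lemma rnbr_at_eq d n x y j : rnbr_at d n x y -> n < j -> x j = y j.
Proof.
by move=> h nj; have := snbr_at_eq (j := 1 - j) h; rewrite !flipE; apply; lia.
Qed.

Lemma rnbr_at_ext d n x y j : rnbr_at d n x y -> j < n -> rext d (x j).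
Proof.
by move=> h nj; have := snbr_at_ext (j := 1 - j) h; rewrite !flipE; apply; lia.
Qed.

Lemma rnbr_at_next d n x y : rnbr_at d n x y -> ~ rext d (x n).
Proof. by move=> /snbr_at_next; rewrite flipE. Qed.

Lemma rnbr_at_rng d n x y : rnbr_at d n x y -> rng (x n) = rng (y n).
Proof. by move=> /snbr_at_src; rewrite !flipE. Qed.

Lemma rnbr_at_sym d n x y : rnbr_at d n x y -> rnbr_at (~~ d) n y x.
Proof. exact: snbr_at_sym. Qed.

Lemma ex_rnbr_at d n x : XB B x -> (forall j, j < n -> rext d (x j)) ->
  ~ (forall j, rext d (x j)) -> exists m y, XB B y /\ rnbr_at d m x y.
Proof.
move=> /XB_flip xB h nh.
have [| |m [y [yB xy]]] := @ex_snbr_at (dual B) d (1 - n) _ xB.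
- by move=> j nj; apply: h; lia.
- by apply: contra_not nh => h' j; rewrite -[x j]flipE; exact: h'.
exists (1 - m), (flip y); split; first by apply/XB_flip; rewrite flipK.
by rewrite /rnbr_at flipK opprB addrC subrK.
Qed.

Lemma XB_uniq_left (P : E -> Prop) n x y :
  (forall e f, P e -> P f -> rng e = rng f -> e = f) ->
  XB B x -> XB B y -> src (x n) = src (y n) ->
  (forall j, j < n -> P (x j)) -> (forall j, j < n -> P (y j)) ->
  forall j, j < n -> x j = y j.
Proof.
move=> Pu /XB_flip xB /XB_flip yB xyn xP yP j jn.
have := @XB_uniq_right (dual B) P (1 - n) _ _ Pu xB yB.
rewrite !flipE => /(_ xyn) h; have := h _ _ (1 - j); rewrite !flipE; apply.
- by move=> i ni; apply: xP; lia.
- by move=> i ni; apply: yP; lia.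
- by lia.
Qed.

Lemma rext_uniq d e f : rext d e -> rext d f -> rng e = rng f -> e = f.
Proof. exact: (@sext_uniq (dual B)). Qed.

Hypothesis nf : no_flat (dual B).

Lemma rext_excl d d' m n x : XB B x -> (forall j, j < m -> rext d (x j)) ->
  (forall j, j < n -> rext d' (x j)) -> d = d'.
Proof.
move=> /XB_flip xB h h'; apply: (sext_excl nf xB (m := 1 - m) (n := 1 - n)).
  by move=> j mj; apply: h; lia.
by move=> j mj; apply: h'; lia.
Qed.

Lemma rnbr_uniq x y z : rnbr x y -> rnbr x z -> y = z.
Proof.
move=> /rnbr_flip xy /rnbr_flip xz.
by rewrite -[y]flipK (snbr_uniq nf xy xz) flipK.
Qed.

Lemma Delta_rE x y : rnbr x y -> Delta_r x = y.
Proof.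
by move=> xy; apply: (xget_unique _ xy) => z xz; exact: rnbr_uniq xz xy.
Qed.

Lemma Delta_r_rnbr x : bd_r B x -> rnbr x (Delta_r x).
Proof. by move=> [y xy]; rewrite (Delta_rE xy). Qed.

Lemma Delta_r_junk x : ~ bd_r B x -> Delta_r x = x.
Proof. by move=> h; apply: xgetPN => y xy; apply: h; exists y. Qed.

Lemma bd_r_flip x : bd_r B x <-> bd_s (dual B) (flip x).
Proof.
split=> -[y xy]; first by exists (flip y); exact/rnbr_flip.
by exists (flip y); apply/rnbr_flip; rewrite flipK.
Qed.

Lemma bd_r_tail n x y : XB B y -> bd_r B x -> (forall j, j < n -> x j = y j) ->
  bd_r B y \/ exists d, forall j, rext d (y j).
Proof.
move=> /XB_flip yB /bd_r_flip xb xy.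
have [|h|[d h]] := bd_s_tail (n := 1 - n) yB xb.
- by move=> j nj; apply: xy; lia.
- by left; apply/bd_r_flip.
- by right; exists d => j; rewrite -[y j]flipE; exact: h.
Qed.

End Flip.

(** * Openness of Y_B and its stability under neighbours *)

Section Interior.
Context {B : bratteli}.
Local Notation E := (BE B).
Implicit Types (x y z u : int -> E) (n m j : int) (d : bool).

Lemma XextP x : Xext B x <->
  XB B x /\ ((exists d, forall j, rext d (x j)) \/ (exists d, forall j, sext d (x j))).
Proof.
split=> [[xB h]|[xB h]]; split=> //.
  by case: h => h; [left; exists false|left; exists true|right; exists false|
    right; exists true].
by case: h => -[[] h]; [constructor 2|constructor 1|constructor 4|constructor 3].
Qed.

(** A carry at [n] does not see the indices before [n], so the common left part may be replaced. *)
Lemma snbr_at_congr d n x y z u : snbr_at d n x y ->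
  (forall j, n <= j -> z j = x j) -> (forall j, n <= j -> u j = y j) ->
  (forall j, j < n -> z j = u j) -> snbr_at d n z u.
Proof.
have h x' y' z' u' : sadj n x' y' -> (forall j, n <= j -> z' j = x' j) ->
    (forall j, n <= j -> u' j = y' j) -> (forall j, j < n -> z' j = u' j) ->
    sadj n z' u'.
  move=> [_ h1 h2 h3] zx uy zu; split=> //; first by rewrite zx ?uy.
    by move=> j nj; rewrite zx ?(ltW nj) //; exact: h2.
  by move=> j nj; rewrite uy ?(ltW nj) //; exact: h3.
case: d => /= h' zx uy zu; apply: h h' _ _ _ => //.
by move=> j jn; rewrite zu.
Qed.

End Interior.

Section InteriorFlip.
Context {B : bratteli}.
Local Notation E := (BE B).
Implicit Types (x y z u : int -> E) (n m j : int) (d : bool).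

Lemma rnbr_at_congr d n x y z u : rnbr_at d n x y ->
  (forall j, j <= n -> z j = x j) -> (forall j, j <= n -> u j = y j) ->
  (forall j, n < j -> z j = u j) -> rnbr_at d n z u.
Proof.
move=> xy zx uy zu; apply: (snbr_at_congr xy) => j nj.
- by apply: zx; lia.
- by apply: uy; lia.
- by apply: zu; lia.
Qed.

(** The s-move changes indices from [b] on and the r-move indices up to [a]. For a < b they do not
    interfere, and [u] performs both. *)
Lemma nbr_commute d d' a b x y z : XB B y -> XB B z -> a < b ->
  snbr_at d b x y -> rnbr_at d' a x z -> exists u, rnbr y u /\ snbr z u.
Proof.
move=> yB zB ab xy xz; pose u := splice (b - 1) z y.
have uB : XB B u.
  apply: XB_splice => //; rewrite -(snbr_at_eq xy); last by lia.
  have [ab1|ab1] := ltP a (b - 1); first by rewrite (rnbr_at_eq xz).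
  by rewrite (_ : b - 1 = a) ?(rnbr_at_rng xz) //; lia.
have uz j : j < b -> u j = z j by move=> jb; rewrite /u /splice ifT //; lia.
have uy j : b <= j -> u j = y j by move=> jb; rewrite /u /splice ifF //; lia.
exists u; split; [apply/rnbr_atP|apply/snbr_atP]; split=> //.
  exists d', a; apply: (rnbr_at_congr xz) => j ja.
  - by rewrite (snbr_at_eq xy) //; lia.
  - by rewrite uz //; lia.
  - have [jb|bj] := ltP j b; last by rewrite uy.
    by rewrite uz // -(snbr_at_eq xy) // (rnbr_at_eq xz).
exists d, b; apply: (snbr_at_congr xy) => // j jb.
- by rewrite (rnbr_at_eq xz) //; lia.
- by rewrite uz.
Qed.

(** The range is open on the left, so that agreement means equality of the windows in E_{-N,N}. *)
Definition agree (N : nat) x y := forall j, - N%:Z < j -> j <= N%:Z -> x j = y j.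

Lemma agree_sym N x y : agree N x y -> agree N y x.
Proof. by move=> xy j h1 h2; rewrite xy. Qed.

Lemma agree_trans N x y z : agree N x y -> agree N y z -> agree N x z.
Proof. by move=> xy yz j h1 h2; rewrite xy // yz. Qed.

Lemma agree_le M N x y : (M <= N)%N -> agree N x y -> agree M x y.
Proof. by move=> MN xy j h1 h2; apply: xy; lia. Qed.

Lemma neq_agree x y : x <> y -> exists N, ~ agree N x y.
Proof.
move=> xy; have [j xyj] : exists j, x j <> y j.
  by apply: contra_notP xy => /forallNP h; apply/funext => j; apply: contrapT => /h.
exists (absz j).+1 => h; apply: xyj; apply: h; lia.
Qed.

(** A finite certificate that [x] is not in [Xext]. It persists under [agree N] and also makes the
    window itself non-extremal in all four senses. *)
Definition noext (N : nat) x :=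
  (forall d, exists j, [/\ - N%:Z < j, j <= N%:Z & ~ rext d (x j)]) /\
  (forall d, exists j, [/\ - N%:Z < j, j <= N%:Z & ~ sext d (x j)]).

Lemma noext_agree N x y : agree N x y -> noext N x -> noext N y.
Proof.
by move=> xy [h1 h2]; split=> d; [have [j [j1 j2]] := h1 d|
  have [j [j1 j2]] := h2 d]; rewrite xy // => h; exists j.
Qed.

Lemma noext_le M N x : (M <= N)%N -> noext M x -> noext N x.
Proof.
move=> MN [h1 h2]; split=> d.
  by have [j [? ? ?]] := h1 d; exists j; split=> //; lia.
by have [j [? ? ?]] := h2 d; exists j; split=> //; lia.
Qed.

Lemma noext_Xext N x : noext N x -> ~ Xext B x.
Proof.
move=> [h1 h2] /XextP[_ [[d h]|[d h]]].
  by have [j [_ _]] := h1 d; apply.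
by have [j [_ _]] := h2 d; apply.
Qed.

Lemma ex_noext x : XB B x -> ~ Xext B x -> exists N, noext N x.
Proof.
move=> xB nx.
have hr d : exists j, ~ rext d (x j).
  apply: contra_notP nx => /forallNP h; apply/XextP; split=> //.
  by left; exists d => j; apply: contrapT.
have hs d : exists j, ~ sext d (x j).
  apply: contra_notP nx => /forallNP h; apply/XextP; split=> //.
  by right; exists d => j; apply: contrapT.
have [[a ha] [a' ha']] := (hr true, hr false).
have [[b hb] [b' hb']] := (hs true, hs false).
exists (absz a + absz a' + absz b + absz b').+1; split=> -[].
- by exists a; split=> //; lia.
- by exists a'; split=> //; lia.
- by exists b; split=> //; lia.
- by exists b'; split=> //; lia.
Qed.

Hypotheses (nfs : no_flat B) (nfr : no_flat (dual B)).

Lemma Sigma_tails x : XB B x -> SigmaB B x -> exists d d' a b, [/\ b <= a,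
  forall j, b < j -> sext d (x j) & forall j, j < a -> rext d' (x j)].
Proof.
move=> xB [/(Delta_s_snbr nfs) xy /(Delta_r_rnbr nfr) xz nc].
have /snbr_atP[_ yB [d [b xyb]]] := xy; have /rnbr_atP[_ zB [d' [a xza]]] := xz.
exists d, d', a, b; split=> [|j|j].
- rewrite leNgt; apply/negP => ab.
  have [u [yu zu]] := nbr_commute yB zB ab xyb xza.
  by apply: nc; rewrite (Delta_sE nfs zu) (Delta_rE nfr yu).
- exact: snbr_at_ext xyb.
- exact: rnbr_at_ext xza.
Qed.

Lemma YB_open x : YB B x -> exists N : nat, noext N x /\
  forall y, XB B y -> agree N x y -> YB B y.
Proof.
move=> [xB nx]; have [nxe nxs] : ~ Xext B x /\ ~ SigmaB B x.
  by split=> h; apply: nx; [left|right].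
have [N0 x0] := ex_noext xB nxe.
pose tails d d' y := [/\ XB B y, agree N0 x y,
  forall j, N0%:Z < j -> sext d (y j) & forall j, j <= - N0%:Z -> rext d' (y j)].
have tails_uniq d d' y z : tails d d' y -> tails d d' z -> y = z.
  move=> [yB xy y1 y2] [zB xz z1 z2].
  have N0gt : - N0%:Z < N0%:Z by have [j [? ? _]] := x0.1 d; lia.
  apply/funext => j; have [jN|Nj] := leP j N0%:Z; last first.
    apply: (XB_uniq_right (@sext_uniq B d) yB zB _ y1 z1) => //.
    by rewrite -xy ?xz //; lia.
  have [jN'|Nj'] := leP j (- N0%:Z); last by rewrite -xy ?xz.
  have e : src (y (- N0%:Z + 1)) = src (z (- N0%:Z + 1)).
    by rewrite -xy ?xz //; lia.
  apply: (XB_uniq_left (@rext_uniq B d') yB zB e); last by lia.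
    by move=> i iN; apply: y2; lia.
  by move=> i iN; apply: z2; lia.
(* For each pair of tail types there is at most one candidate. It differs from [x], which is not in
   [SigmaB], and a larger window separates the two. *)
have avoid d d' : exists N, forall y, tails d d' y -> SigmaB B y -> ~ agree N x y.
  have [[y [yt yS]]|h] := pselect (exists y, tails d d' y /\ SigmaB B y).
    have [|N xyN] := @neq_agree x y; first by move=> xy; rewrite -xy in yS.
    by exists N => z zt _; rewrite (tails_uniq _ _ _ _ zt yt).
  by exists 0%N => y yt yS; exfalso; apply: h; exists y.
have [N1 h1] := avoid true true; have [N2 h2] := avoid true false.
have [N3 h3] := avoid false true; have [N4 h4] := avoid false false.
exists (N0 + N1 + N2 + N3 + N4)%N; split; first by apply: noext_le x0; lia.
move=> y yB xy; have xy0 : agree N0 x y by apply: agree_le xy; lia.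
have y0 := noext_agree xy0 x0.
split=> // -[|yS]; first exact: noext_Xext y0.
have [d [d' [a [b [ba yb ya]]]]] := Sigma_tails yB yS.
have [i [i1 i2 i3]] := y0.1 d'; have [k [k1 k2 k3]] := y0.2 d.
have ai : a <= i by rewrite leNgt; apply/negP => /ya.
have kb : k <= b by rewrite leNgt; apply/negP => /yb.
have yt : tails d d' y.
  split=> // j hj; first by apply: yb; lia.
  by apply: ya; lia.
by case: d d' yt {ya yb i3 k3} => -[] yt;
  [apply: (h1 y)|apply: (h2 y)|apply: (h3 y)|apply: (h4 y)] => //;
  apply: agree_le xy; lia.
Qed.

Hypothesis hext : ext_not_bd B.

Lemma bd_s_notext x : bd_s B x -> ~ Xext B x.
Proof. by move=> xs xe; have : (Xext B `&` bd_s B) x by []; rewrite hext.1. Qed.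

Lemma bd_r_notext x : bd_r B x -> ~ Xext B x.
Proof. by move=> xs xe; have : (Xext B `&` bd_r B) x by []; rewrite hext.2. Qed.

Lemma snbr_bd_s x y : snbr x y -> bd_s B x /\ bd_s B y.
Proof. by move=> xy; split; [exists y|exists x; exact: snbr_sym]. Qed.

Lemma rnbr_bd_r x y : rnbr x y -> bd_r B x /\ bd_r B y.
Proof. by move=> xy; split; [exists y|exists x; exact: rnbr_sym]. Qed.

(** [y] inherits the left tail of [x]. The exceptional case of [bd_r_tail] would put [y] in [Xext],
    although [y] lies on the s-boundary; [hext] excludes this. *)
Lemma snbr_bd_r x y : snbr x y -> bd_r B x -> bd_r B y.
Proof.
move=> xy xr; have [_ ys] := snbr_bd_s xy.
have /snbr_atP[_ yB [d [n xyn]]] := xy.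
have [|//|h] := bd_r_tail (n := n) yB xr; first by move=> j; exact: snbr_at_eq xyn.
by exfalso; apply: (bd_s_notext ys); apply/XextP; split=> //; left.
Qed.

Lemma rnbr_bd_s x y : rnbr x y -> bd_s B x -> bd_s B y.
Proof.
move=> xy xr; have [_ ys] := rnbr_bd_r xy.
have /rnbr_atP[_ yB [d [n xyn]]] := xy.
have [|//|h] := bd_s_tail (n := n) yB xr; first by move=> j; exact: rnbr_at_eq xyn.
by exfalso; apply: (bd_r_notext ys); apply/XextP; split=> //; right.
Qed.

(** By [snbr_bd_r] and [rnbr_bd_s] both composites of the two moves exist, and [x] not being in
    [SigmaB] says that they coincide. *)
Lemma nbr_square x y z : YB B x -> snbr x y -> rnbr x z ->
  exists u, rnbr y u /\ snbr z u.
Proof.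
move=> [_ nx] xy xz; have [xs _] := snbr_bd_s xy; have [xr _] := rnbr_bd_r xz.
have yr := snbr_bd_r xy xr; have zs := rnbr_bd_s xz xs.
exists (Delta_r y); split; first exact: Delta_r_rnbr.
suff <- : Delta_s z = Delta_r y by exact: Delta_s_snbr.
apply: contrapT => h; apply: nx; right; split=> //.
by rewrite (Delta_sE nfs xy) (Delta_rE nfr xz).
Qed.

(** The commuting square at [x], read from the corner [y], shows that the moves commute at [y] as
    well. *)
Lemma YB_snbr x y : YB B x -> snbr x y -> YB B y.
Proof.
move=> xY xy; have [_ yB] := snbr_XB xy; have [xs ys] := snbr_bd_s xy.
split=> // -[|[_ yr]]; first exact: bd_s_notext.
have /(Delta_r_rnbr nfr) xz := snbr_bd_r (snbr_sym xy) yr.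
have [u [yu zu]] := nbr_square xY xy xz; apply.
rewrite (Delta_rE nfr yu) (Delta_sE nfs (snbr_sym zu)).
by rewrite (Delta_sE nfs (snbr_sym xy)).
Qed.

Lemma YB_rnbr x y : YB B x -> rnbr x y -> YB B y.
Proof.
move=> xY xy; have [_ yB] := rnbr_XB xy; have [xs ys] := rnbr_bd_r xy.
split=> // -[|[yr _]]; first exact: bd_r_notext.
have /(Delta_s_snbr nfs) xz := rnbr_bd_s (rnbr_sym xy) yr.
have [u [zu yu]] := nbr_square xY xz xy; apply.
rewrite (Delta_sE nfs yu) (Delta_rE nfr (rnbr_sym zu)).
by rewrite (Delta_rE nfr (rnbr_sym xy)).
Qed.

End InteriorFlip.

(** * Charts *)

(* One coordinate of a chart: [half_dom] and [half_psi] are the conditions on the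
   right tail in V_(i,j)(p) and the second coordinate of psi^p, the family [q]
   being p^(i,1), p^(i,2).  The first coordinate is the same notion in [dual B]. *)
Section HalfChart.
Context {R : realType} {B : bratteli} (nu : state R B).
Context {phi : BV B -> (nat -> BE B) -> R}.
Hypotheses (br : branching B) (cdf : is_cdf nu phi) (nf : no_flat B).
Context {a b : int}.
Hypothesis ab : a < b.
Local Notation E := (BE B).
Local Notation w := (nus nu).
Local Notation win := (restr a b).
Implicit Types (x y z u : int -> E) (p : finpath B a b) (d : bool).

Definition fnbr_s d p p' := if d then fsucc_s p' p else fsucc_s p p'.

Lemma fsucc_s_fsrc p p' : fsucc_s p p' -> fsrc p = fsrc p'.
Proof.
move=> [_ _ [i [pp lt]] _]; rewrite /fsrc.
have [i0|i0] := eqVneq (i : nat) 0%N; last by rewrite pp // lt0n.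
have <- : i = ord0 by exact: val_inj.
exact: lts_src lt.
Qed.

Lemma fnbr_s_Epath d p p' : fnbr_s d p p' -> Epath p /\ Epath p'.
Proof. by case: d => -[]. Qed.

Lemma fnbr_s_lift d p p' x : fnbr_s d p p' -> XB B x -> win x = p ->
  (forall k, b < k -> sext d (x k)) ->
  exists y, [/\ XB B y, win y = p', forall k, k <= a -> x k = y k,
    forall k, b < k -> sext (~~ d) (y k) & snbr x y].
Proof.
move=> pp xB xp xd; have [pE p'E] := fnbr_s_Epath pp.
have srcE : fsrc p' = src (x (a + 1)).
  rewrite -(XB_next _ xB) -(fsrc_restr a b xB) xp.
  by case: d pp {xd} => /fsucc_s_fsrc.
have [t tp te] := tail_choice (frng p') (ex_sext (~~ d)).
have [|y [yB yp yl yt]] := ex_XB p'E (l := ltail a x) _ tp.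
  by rewrite srcE; exact: Xminus_ltail.
have xy k : k <= a -> x k = y k.
  move=> ka; have := congr1 (fun l => l (absz (a - k)%R)) yl.
  by rewrite /ltail (_ : a - _ = k) //; lia.
have ye k : b < k -> sext (~~ d) (y k).
  move=> bk; have := te (absz (k - b - 1)%R); rewrite -yt /rtail.
  by rewrite (_ : b + 1 + _ = k) //; lia.
exists y; split=> //.
rewrite -xp -yp in pp; case: d pp xd ye {te} => /= pp xd ye.
  by right; apply: (fsucc_ssucc ab) pp _ ye xd => // k /xy.
by left; apply: (fsucc_ssucc ab) pp _ xd ye => // k /xy.
Qed.

Definition half_dom (q : bool -> finpath B a b) (j : bool) x :=
  [/\ XB B x, win x = q j & ~ forall k, b < k -> sext (~~ j) (x k)].

Definition half_psi (q : bool -> finpath B a b) (j : bool) x : R :=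
  phi (frng (q j)) (rtail b x) - (j == false)%:R * w (frng (q j)).

Section OneQuad.
Variable q : bool -> finpath B a b.
Hypotheses (q01 : fsucc_s (q false) (q true)).
Hypotheses (qmax : forall j, ~ fsmax (q j)) (qmin : forall j, ~ fsmin (q j)).

Lemma half_nbr j : fnbr_s j (q j) (q (~~ j)).
Proof. by case: j. Qed.

Lemma half_frng j x : XB B x -> win x = q j -> frng (q j) = rng (x b).
Proof. by move=> xB <-; rewrite frng_restr. Qed.

Lemma rtail_ext x d : (forall k, b < k -> sext d (x k)) ->
  forall k, sext d (rtail b x k).
Proof. by move=> h k; apply: h; lia. Qed.

(** The two pieces occupy opposite sides of 0, and the extremal tail of type [j] is the end of piece
    [j] that is glued to the other piece. *)
Lemma half_psi_ext j x : XB B x -> win x = q j ->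
  (forall k, b < k -> sext j (x k)) -> half_psi q j x = 0.
Proof.
move=> xB xq xj; have := rtail_ext xj; have := Xplus_rtail b xB.
rewrite /half_psi (half_frng xB xq); case: j {xq xj} => xp /= xe.
  by rewrite (pcdf_smin br cdf xp) // mul0r subr0.
by rewrite (pcdf_smax br cdf xp) // mul1r subrr.
Qed.

Lemma rtail_oadj d n0 x y : snbr_at d n0 x y -> b < n0 ->
  oadj (rtail b x) (rtail b y) \/ oadj (rtail b y) (rtail b x).
Proof.
have h u v : sadj n0 u v -> b < n0 -> oadj (rtail b u) (rtail b v).
  move=> [uv uvn umax vmin] bn; exists (absz (n0 - b - 1)%R).
  rewrite /rtail; split.
  - by move=> j jn; apply: uv; lia.
  - by rewrite (_ : b + 1 + _ = n0) //; lia.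
  - by move=> j jn; apply: umax; lia.
  - by move=> j jn; apply: vmin; lia.
by case: d => /h xy /xy; [right|left].
Qed.

(** A carry beyond the window stays in the same piece and preserves the code by [pcdf_oadj]. A carry
    inside the window forces the right tail to have type [j], so the coordinate is 0; the neighbour
    then lies in the other piece, again with coordinate 0. *)
Lemma half_dom_snbr j x y : half_dom q j x -> snbr x y -> exists j',
  [/\ half_dom q j' y, half_psi q j' y = half_psi q j x &
      forall k, k <= a -> x k = y k].
Proof.
move=> [xB xq xn] xy.
have /snbr_atP[_ yB [d [n0 xyn]]] := xy.
have xt := Xplus_rtail b xB; have yt := Xplus_rtail b yB.
have [bn|nb] := ltP b n0.
  have xyb k : k <= b -> x k = y k by move=> kb; apply: (snbr_at_eq xyn); lia.
  have yq : win y = q j by rewrite -xq; apply: eq_restr => // k _ /xyb.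
  exists j; split; [split=> //| |by move=> k ka; apply: xyb; lia].
    move=> yj; have yd := @snbr_at_ext _ _ _ _ _ _ (snbr_at_sym xyn).
    have e := sext_excl nf yB yd yj.
    by apply: (snbr_at_next (snbr_at_sym xyn)); rewrite e; exact: yj.
  rewrite /half_psi (half_frng yB yq); congr (_ - _).
  rewrite -xyb // in yt *.
  by case: (rtail_oadj xyn bn) => h; rewrite (pcdf_oadj br cdf _ _ h).
have xd k : b < k -> sext d (x k) by move=> bk; apply: (snbr_at_ext xyn); lia.
have dj : d = j.
  case: (eqVneq d j) => // dj; exfalso; apply: xn => k /xd.
  by case: (d) (j) dj => -[].
subst d.
(* A carry at or before [a] would make every edge of the window extremal, against [qmax] or
   [qmin]. *)
have an : a < n0.
  rewrite ltNge; apply/negP => na.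
  have win_ext i : sext j (win x i).
    by rewrite restrE; apply: (snbr_at_ext xyn); lia.
  case: j {xd xn xyn} xq win_ext => xq e.
    apply: (@qmin true) => r _ [i [_ lt]]; rewrite -xq in lt.
    by have := e i (r i); rewrite lt.
  by apply: (@qmax false); rewrite -xq; exact: smax_path.
have [y' [y'B y'q xy' y'e xny']] := fnbr_s_lift (half_nbr j) xB xq xd.
have yy' := snbr_uniq nf xny' xy; subst y'.
exists (~~ j); split=> //.
  split=> // h; have := sext_excl nf yB y'e h.
  by case: (j).
by rewrite (half_psi_ext xB xq xd) half_psi_ext.
Qed.

(** Within one piece this is injectivity of the coding up to one-sided neighbours. Across pieces one
    coordinate is at most 0 and the other at least 0, so both vanish, and the tails are the ones
    glued together. *)
Lemma half_psi_inj j j' x y : half_dom q j x -> half_dom q j' y ->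
  (forall k, k <= a -> x k = y k) -> half_psi q j x = half_psi q j' y ->
  x = y \/ snbr x y.
Proof.
move=> [xB xq xn] [yB yq yn] xya.
have xt := Xplus_rtail b xB; have yt := Xplus_rtail b yB.
have eqxy : (forall k, k <= b -> x k = y k) -> rtail b x = rtail b y -> x = y.
  move=> xyb e; rewrite -(join_tails a b x) -(join_tails a b y) e.
  apply/funext => k; rewrite /join /ltail; case: ifP => ka.
    by apply: xya; lia.
  by case: ifP => // kb; exact: xyb.
have [jj|jj] := eqVneq j j'.
  subst j'; have xyb k : k <= b -> x k = y k.
    have [ka _|ak kb] := leP k a; first exact: xya.
    by apply: (restr_inj ab) => //; rewrite xq yq.
  rewrite /half_psi => /addIr; rewrite (half_frng xB xq).
  rewrite -xyb // in yt.
  have radj u v : XB B u -> XB B v -> (forall k, k <= b -> u k = v k) ->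
      oadj (rtail b u) (rtail b v) -> snbr u v.
    move=> uB vB uvb [n0 [h1 h2 h3 h4]]; apply/snbr_atP; split=> //.
    exists false, (b + 1 + n0%:Z).
    have tE (z : int -> E) k : b < k -> z k = rtail b z (absz (k - b - 1)%R).
      by move=> bk; rewrite /rtail; congr z; lia.
    split=> // k kn.
    - have [/uvb//|bk] := leP k b.
      by rewrite (tE u) ?(tE v) //; apply: h1; lia.
    - by rewrite (tE u); [apply: h3|]; lia.
    - by rewrite (tE v); [apply: h4|]; lia.
  move=> /(pcdf_inj br cdf xt yt)[/(eqxy xyb)|h|h]; first by left.
    by right; exact: radj.
  by right; apply: snbr_sym; apply: radj => // k /xyb.
wlog jE : j j' x y xB xq xn yB yq yn xya xt yt jj {eqxy} / j = false.
  case: j jj xq xn => jj xq xn hw; last exact: (hw false j' x y).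
  case: j' jj yq yn => // _ yq yn e.
  have := hw false true y x yB yq yn xB xq xn (fun k ka => esym (xya k ka)) yt xt
    isT erefl (esym e).
  by case=> [->|/snbr_sym]; [left|right].
subst j; case: j' jj yq yn => // _ yq yn.
have x0 := pcdf_ge0 cdf xt; have y0 := pcdf_ge0 cdf yt.
have x1 := pcdf_le cdf xt; have y1 := pcdf_le cdf yt.
rewrite /half_psi /= (half_frng xB xq) (half_frng yB yq) mul1r mul0r subr0 => e.
have xmax := pcdf_eq_max br cdf xt ltac:(lra).
have ymin := pcdf_eq0 br cdf yt ltac:(lra).
right; left.
apply: (fsucc_ssucc ab) => //; first by rewrite xq yq.
  by move=> k bk; have := xmax (absz (k - b - 1)%R); rewrite /rtail;
    rewrite (_ : b + 1 + _ = k) //; lia.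
by move=> k bk; have := ymin (absz (k - b - 1)%R); rewrite /rtail;
  rewrite (_ : b + 1 + _ = k) //; lia.
Qed.

Lemma half_psi_cont j x (eps : R) : half_dom q j x -> 0 < eps ->
  exists2 M : int, b <= M & forall y, XB B y ->
    (forall k, a < k -> k <= M -> x k = y k) ->
    half_dom q j y /\ `|half_psi q j x - half_psi q j y| < eps.
Proof.
move=> [xB xq xn] eps0; have xt := Xplus_rtail b xB.
have [K hK] := w_small nu br xt eps0.
have [k0 bk0 xk0] : exists2 k, b < k & ~ sext (~~ j) (x k).
  apply: contra_notP xn => h k bk; apply: contrapT => xk; apply: h.
  by exists k.
(* The range covers the first [K] edges after [b], which confine both codes to one interval shorter
   than [eps], and the index [k0] showing that the tail is not the removed one. *)
exists (b + K%:Z + (absz (k0 - b)%R)%:Z); first by lia.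
move=> y yB xy.
have yq : win y = q j by rewrite -xq; apply: eq_restr => // k ak kb; rewrite xy //; lia.
split; first by split=> // h; apply: xk0; rewrite xy; [exact: h|lia|lia].
rewrite /half_psi opprB addrA subrK (half_frng xB xq).
have yt := Xplus_rtail b yB; rewrite -xy in yt; [|lia|lia].
have /andP[h1 h2] := cdf K xt; have /andP[h3 h4] := cdf K yt.
have xyK k : (k < K)%N -> rtail b y k = rtail b x k.
  by move=> kK; rewrite /rtail xy //; lia.
rewrite (eq_psum nu xyK) in h3 h4; rewrite (src_first_diff yt xt xyK) in h4.
by rewrite ltr_norml; apply/andP; split; lra.
Qed.

(** The bounds are strict because the removed tails are the only ones at which the outer endpoints
    are attained. *)
Lemma half_psi_bounds j x : half_dom q j x ->
  - w (frng (q false)) < half_psi q j x < w (frng (q true)).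
Proof.
move=> [xB xq xn]; have xt := Xplus_rtail b xB.
have x0 := pcdf_ge0 cdf xt; have x1 := pcdf_le cdf xt.
have gt0 := nus_gt0 nu br.
have nE : phi (rng (x b)) (rtail b x) <> (if j then w (rng (x b)) else 0).
  move=> e; apply: xn => k bk.
  have -> : x k = rtail b x (absz (k - b - 1)%R) by rewrite /rtail; congr x; lia.
  by case: j {xq} e => /= e; [exact: (pcdf_eq_max br cdf xt)|exact: (pcdf_eq0 br cdf xt)].
rewrite /half_psi (half_frng xB xq); case: j xq xn nE => xq xn /eqP nE /=.
  rewrite mul0r subr0 (half_frng xB xq); have := gt0 (frng (q false)).
  by move=> g; apply/andP; split; [lra|rewrite lt_neqAle nE].
rewrite mul1r (half_frng xB xq); have := gt0 (frng (q true)).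
have : 0 < phi (rng (x b)) (rtail b x) by rewrite lt_neqAle eq_sym nE.
by lra.
Qed.

Lemma half_psi_surj s : - w (frng (q false)) < s < w (frng (q true)) ->
  exists j t, [/\ Xplus (frng (q j)) t, ~ (forall k, sext (~~ j) (t k)) &
    phi (frng (q j)) t - (j == false)%:R * w (frng (q j)) = s].
Proof.
move=> /andP[s1 s2]; have [s0|s0] := ltP s 0.
  have [|t tv ts] := pcdf_surj br cdf (v := frng (q false)) (s := s + w (frng (q false))).
    by apply/andP; split; lra.
  exists false, t; split=> // [h|]; last by rewrite ts mul1r addrK.
  by have := pcdf_smin br cdf tv h; rewrite ts; lra.
have [|t tv ts] := pcdf_surj br cdf (v := frng (q true)) (s := s).
  by rewrite s0 ltW.
exists true, t; split=> // [h|]; last by rewrite ts mul0r subr0.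
by have := pcdf_smax br cdf tv h; rewrite ts; lra.
Qed.

End OneQuad.
End HalfChart.

(** Along a flat tail each vertex emits a single edge, so the weight stays constant instead of
    tending to 0. *)
Lemma branching_no_flat (R : realType) (B : bratteli) (nu : state R B) :
  branching B -> no_flat B.
Proof.
move=> br x n xB flat; have xt := Xplus_rtail n xB.
have wE k : nus nu (src (rtail n x k)) = nus nu (rng (x n)).
  elim: k => [|k IH]; first by rewrite xt.1.
  rewrite -xt.2 -IH; have [emax emin] : smax (rtail n x k) /\ smin (rtail n x k).
    by apply: flat; lia.
  by have := below_smax nu emax; rewrite (below_smin nu emin) add0r.
have [N] := w_small nu br xt (nus_gt0 nu br (rng (x n))).
by rewrite wE ltxx.
Qed.

Definition frev {T : Type} {k : nat} (p : {ffun 'I_k -> T}) : {ffun 'I_k -> T} :=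
  [ffun i => p (rev_ord i)].

Lemma frevK {T : Type} {k : nat} : involutive (@frev T k).
Proof. by move=> p; apply/ffunP => i; rewrite !ffunE rev_ordK. Qed.

Section FlipWindow.
Context {B : bratteli} {n : nat}.
Hypothesis n0 : (0 < n)%N.
Local Notation a := (- n%:Z).
Local Notation b := (n%:Z).
Local Notation E := (BE B).
Implicit Types (x y : int -> E) (p q : finpath B a b).

Lemma sym_window : a < b.
Proof. by lia. Qed.

Lemma restr_flip x : @restr (dual B) a b (flip x) = frev (restr a b x).
Proof.
apply/ffunP => i; rewrite !ffunE /flip /=; congr x.
by have := ltn_ord i => ilt; lia.
Qed.

Lemma Epath_frev p : @Epath (dual B) a b (frev p) <-> Epath p.
Proof.
split=> [h|h].
  have [x xB xp] := ex_XB_restr h.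
  rewrite -[p]frevK -xp -restr_flip.
  change (Epath (@restr B a b (flip x))).
  by apply: Epath_restr; [exact: sym_window|apply/XB_flip; rewrite flipK].
have [x xB <-] := ex_XB_restr h; rewrite -restr_flip.
by apply: Epath_restr; [exact: sym_window|apply/XB_flip].
Qed.

Lemma flts_frev p q : @flts (dual B) a b (frev p) (frev q) <-> fltr p q.
Proof.
split=> -[i [pq lt]]; exists (rev_ord i).
  split; last by move: lt; rewrite !ffunE.
  move=> j ij; have := pq (rev_ord j); rewrite !ffunE !rev_ordK; apply.
  by move: ij => /=; have := ltn_ord j; have := ltn_ord i; lia.
rewrite !ffunE !rev_ordK; split=> // j ij; rewrite !ffunE; apply: pq.
by move: ij => /=; have := ltn_ord j; have := ltn_ord i; lia.
Qed.

Lemma fsucc_s_frev p q : @fsucc_s (dual B) a b (frev p) (frev q) <-> fsucc_r p q.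
Proof.
split=> -[pE qE pq nb]; split; try exact/Epath_frev; try exact/flts_frev.
  by move=> z zE [pz zq]; apply: (nb (frev z)); [apply/Epath_frev|split; apply/flts_frev].
move=> z zE; rewrite -[z]frevK => -[/flts_frev pz /flts_frev zq].
by apply: (nb (frev z)) => //; apply/Epath_frev; rewrite frevK.
Qed.

Lemma fsmax_frev p : @fsmax (dual B) a b (frev p) -> frmax p.
Proof. by move=> h q /Epath_frev qE /flts_frev; apply: h. Qed.

Lemma fsmin_frev p : @fsmin (dual B) a b (frev p) -> frmin p.
Proof. by move=> h q /Epath_frev qE /flts_frev; apply: h. Qed.

Lemma frng_frev p : @frng (dual B) a b (frev p) = fsrc p.
Proof.
rewrite /frng ffunE /fsrc /=; congr (src (p _)); apply: val_inj => /=.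
by rewrite subnn.
Qed.

Lemma rtail_flip x : rtail b (flip x) = ltail a x.
Proof. by apply/funext => k; rewrite /rtail /ltail /flip; congr x; lia. Qed.

(** Membership splits into one condition per tail, so that each coordinate can be treated as a
    half-chart, the first one in [dual B]. *)
Lemma VijE (p : quad B a b) i j x : Epath (p i j) -> Vij p i j x <->
  half_dom (p i) j x /\ @half_dom (dual B) a b (fun i' => frev (p i' j)) i (flip x).
Proof.
move=> pE; have mn := sym_window.
pose Q := ~` (if i then xrmax (fsrc (p i j)) else xrmin (fsrc (p i j))).
pose P := ~` (if j then xsmax (frng (p i j)) else xsmin (frng (p i j))).
have h := juxtE Q P x pE.
have lE : XB B x -> restr a b x = p i j ->
    Q (ltail a x) <-> ~ forall k, b < k -> rext (~~ i) (flip x k).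
  move=> xB xp; have lP : Xminus (fsrc (p i j)) (ltail a x).
    by rewrite -xp fsrc_restr // (XB_next _ xB); exact: Xminus_ltail.
  rewrite /Q; split=> nh hh; apply: nh.
    have e k : rext (~~ i) (ltail a x k).
      by have := hh (b + 1 + k%:Z); rewrite /flip /ltail (_ : 1 - _ = a - k%:Z);
        [apply|]; lia.
    by move: lP e; case: (i) => /= lP e; split.
  move=> k bk; have e : flip x k = ltail a x (absz (k - b - 1)%R).
    by rewrite /flip /ltail; congr x; lia.
  by case: (i) hh => -[_ hh] /=; rewrite e; exact: hh.
have rE : XB B x -> restr a b x = p i j ->
    P (rtail b x) <-> ~ forall k, b < k -> sext (~~ j) (x k).
  move=> xB xp; have lP : Xplus (frng (p i j)) (rtail b x).
    by rewrite -xp frng_restr //; exact: Xplus_rtail.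
  rewrite /P; split=> nh hh; apply: nh.
    have e k : sext (~~ j) (rtail b x k) by apply: hh; lia.
    by move: lP e; case: (j) => /= lP e; split.
  move=> k bk; have e : x k = rtail b x (absz (k - b - 1)%R).
    by rewrite /rtail; congr x; lia.
  by case: (j) hh => -[_ hh] /=; rewrite e; exact: hh.
split=> [/h[xB xp /lE xl /rE xr]|[[xB xp xr] [_ _ xl]]].
  split; split=> //; [exact: xr| |by rewrite restr_flip xp|exact: xl].
  exact/XB_flip.
by apply/h; split=> //; [apply/lE|apply/rE].
Qed.

End FlipWindow.

Section Chart.
Context {R : realType} {B : bratteli} (nu : state R B).
Hypotheses (brs : branching B) (brr : branching (dual B)).
Local Notation E := (BE B).
Implicit Types (x y u : int -> E).

Let nfs : no_flat B := branching_no_flat nu brs.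
Let nfr : no_flat (dual B) := branching_no_flat (dual_state nu) brr.

Section OneChart.
Context {n : nat} (p : quad B (- n%:Z) n%:Z).
Hypotheses (n0 : (0 < n)%N) (pE : Ers p).
Local Notation a := (- n%:Z).
Local Notation b := (n%:Z).

(** For fixed [j], the two paths stacked in the r-direction, reversed so that they form a family for
    a half-chart of [dual B]. *)
Definition dquad (j : bool) : bool -> finpath (dual B) a b := fun i => frev (p i j).

Lemma psiE i j x : psi nu p i j x =
  (half_psi (dual_state nu) (phi := phi_r nu) (dquad j) i (flip x),
   half_psi nu (phi := phi_s nu) (p i) j x).
Proof. by rewrite /half_psi frng_frev (rtail_flip n0). Qed.

Lemma quad_Epath i j : Epath (p i j).
Proof. by have [/(_ i j)[]] := pE. Qed.

Lemma quad_inj i j i' j' : p i j = p i' j' -> i = i' /\ j = j'.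
Proof. by have [_ h _ _ _] := pE; exact: h. Qed.

Lemma quad_fsucc_s i : fsucc_s (p i false) (p i true).
Proof. by have [_ _ h1 _ [h2 _]] := pE; case: i. Qed.

Lemma quad_fsucc_r j : @fsucc_s (dual B) a b (dquad j false) (dquad j true).
Proof.
by have [_ _ _ h1 [_ h2]] := pE; apply/(fsucc_s_frev n0); case: j.
Qed.

Lemma quad_fsmax i j : ~ fsmax (p i j).
Proof. by have [/(_ i j)[_ []]] := pE. Qed.

Lemma quad_fsmin i j : ~ fsmin (p i j).
Proof. by have [/(_ i j)[_ []]] := pE. Qed.

Lemma quad_frmax i j : ~ @fsmax (dual B) a b (dquad j i).
Proof. by move=> /(fsmax_frev n0); have [/(_ i j)[_ _ []]] := pE. Qed.

Lemma quad_frmin i j : ~ @fsmin (dual B) a b (dquad j i).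
Proof. by move=> /(fsmin_frev n0); have [/(_ i j)[_ _ []]] := pE. Qed.

Lemma quad_fsrc i j j' : fsrc (p i j) = fsrc (p i j').
Proof.
by have := fsucc_s_fsrc (quad_fsucc_s i); case: j j' => -[].
Qed.

Lemma quad_frng i i' j : frng (p i j) = frng (p i' j).
Proof.
have := fsucc_s_fsrc (quad_fsucc_r j).
have e k : @fsrc (dual B) a b (dquad j k) = frng (p k j).
  by rewrite /fsrc ffunE /=; congr (rng (p _ _ _)); apply: val_inj => /=; lia.
by rewrite !e; case: i i' => -[].
Qed.

Lemma quad_YB i j x : Vij p i j x -> YB B x.
Proof.
have [/(_ i j)[_ _ _ h] _ _ _ _] := pE.
by move=> [[h1 _] h2 [h3 _]]; apply: h.
Qed.

Lemma Vij_XB i j x : Vij p i j x -> XB B x.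
Proof. by move=> /quad_YB[]. Qed.

Lemma Vij_restr i j x : Vij p i j x -> restr a b x = p i j.
Proof. by move=> [_ h _]; apply/ffunP => k; rewrite restrE. Qed.

Lemma Vij_uniq i j i' j' x : Vij p i j x -> Vij p i' j' x -> i = i' /\ j = j'.
Proof. by move=> /Vij_restr h /Vij_restr; rewrite h => /quad_inj. Qed.

(** The second coordinate is handled by [half_dom_snbr]. The first one is unchanged because [y] has
    the left tail of [x] and the paths [p i j] and [p i j'] start at the same vertex. *)
Lemma Vij_snbr i j x y : Vij p i j x -> snbr x y ->
  exists j', Vij p i j' y /\ psi nu p i j' y = psi nu p i j x.
Proof.
move=> /(VijE n0 _ (quad_Epath i j))[xs xr] xy.
have [j' [ys yx xya]] := half_dom_snbr brs (phi_s_cdf nu) nfs (sym_window n0)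
  (quad_fsucc_s i) (fun j => @quad_fsmax i j) (fun j => @quad_fsmin i j) xs xy.
exists j'; rewrite !psiE yx; split.
  apply/(VijE n0 _ (quad_Epath i j')); split=> //.
  have [yB yq _] := ys; have [_ _ xn] := xr.
  split; [exact/XB_flip|by rewrite (restr_flip n0) yq|].
  by apply: contra_not xn => h k bk; rewrite /flip xya; [exact: h|lia].
congr pair; rewrite /half_psi /dquad !frng_frev !(rtail_flip n0) !(quad_fsrc i j' j).
by congr (phi_r _ _ _ - _); apply/funext => k; rewrite /ltail xya //; lia.
Qed.

Lemma Vij_rnbr i j x y : Vij p i j x -> rnbr x y ->
  exists i', Vij p i' j y /\ psi nu p i' j y = psi nu p i j x.
Proof.
move=> /(VijE n0 _ (quad_Epath i j))[xs xr] /rnbr_flip xy.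
have [i' [yr yx xya]] := half_dom_snbr brr (phi_r_cdf nu) nfr (sym_window n0)
  (quad_fsucc_r j) (fun i => @quad_frmax i j) (fun i => @quad_frmin i j) xr xy.
have xyb k : b < k -> x k = y k.
  by move=> bk; have := xya (1 - k); rewrite !flipE; apply; lia.
exists i'; rewrite !psiE yx; split.
  apply/(VijE n0 _ (quad_Epath i' j)); split=> //.
  have [/XB_flip yB yq _] := yr; have [_ _ xn] := xs.
  split=> //; first by rewrite -[LHS]frevK -(restr_flip n0) yq /dquad frevK.
  by apply: contra_not xn => h k bk; rewrite xyb //; exact: h.
congr pair; rewrite /half_psi !(quad_frng i' i).
by congr (phi_s _ _ _ - _); apply/funext => k; rewrite /rtail xyb //; lia.
Qed.

(** The coordinates are changed one at a time: [u] has the left tail of [x] and the right tail of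
    [y], so that it differs from [x] by an s-move and from [y] by an r-move. *)
Lemma psi_inj i j i' j' x y : Vij p i j x -> Vij p i' j' y ->
  psi nu p i j x = psi nu p i' j' y ->
  exists u, [/\ Vij p i j' u, x = u \/ snbr x u & u = y \/ rnbr u y].
Proof.
move=> /(VijE n0 _ (quad_Epath i j))[xs xr] /(VijE n0 _ (quad_Epath i' j'))[ys yr].
rewrite !psiE => -[er es]; have ab := sym_window n0.
have [xB xq xsn] := xs; have [yB yq ysn] := ys.
have [_ _ xrn] := xr; have [_ _ yrn] := yr.
have [||u [uB uq ul ut]] := ex_XB (quad_Epath i j') (l := ltail a x) (t := rtail b y).
- by rewrite (quad_fsrc i j' j) -xq fsrc_restr // (XB_next _ xB); exact: Xminus_ltail.
- by rewrite (quad_frng i i') -yq frng_restr //; exact: Xplus_rtail.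
have xua k : k <= a -> x k = u k.
  move=> ka; have := congr1 (fun l => l (absz (a - k)%R)) ul.
  by rewrite /ltail (_ : a - _ = k) //; lia.
have uyb k : b < k -> u k = y k.
  move=> bk; have := congr1 (fun l => l (absz (k - b - 1)%R)) ut.
  by rewrite /rtail (_ : b + 1 + _ = k) //; lia.
have us : half_dom (p i) j' u.
  by split=> // h; apply: ysn => k bk; rewrite -uyb //; exact: h.
have ur : half_dom (dquad j') i (flip u).
  split; [exact/XB_flip|by rewrite (restr_flip n0) uq|].
  by apply: contra_not xrn => h k bk; rewrite /flip xua; [exact: h|lia].
exists u; split.
- exact/(VijE n0 _ (quad_Epath i j')).
- apply: (half_psi_inj brs (phi_s_cdf nu) ab (quad_fsucc_s i) xs us xua).
  by rewrite es /half_psi ut !(quad_frng i' i).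
have [||h|h] := half_psi_inj brr (phi_r_cdf nu) ab (quad_fsucc_r j') ur yr.
- by move=> k ka; rewrite /flip uyb //; lia.
- rewrite -er /half_psi !frng_frev !(rtail_flip n0).
  by rewrite (ul : @ltail (dual B) a u = _) !(quad_fsrc i j' j).
- by left; rewrite -[u]flipK h flipK.
- by right; apply/rnbr_flip.
Qed.

Lemma psi_cont i j x (eps : R) : Vij p i j x -> 0 < eps ->
  exists M : nat, forall y, XB B y -> agree M x y -> Vij p i j y /\
    (`|(psi nu p i j x).1 - (psi nu p i j y).1| < eps /\
     `|(psi nu p i j x).2 - (psi nu p i j y).2| < eps).
Proof.
move=> /(VijE n0 _ (quad_Epath i j))[xs xr] eps0; have ab := sym_window n0.
have [M bM hM] := half_psi_cont brs (phi_s_cdf nu) ab xs eps0.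
have [M' bM' hM'] := half_psi_cont brr (phi_r_cdf nu) ab xr eps0.
exists (absz M + absz M')%N => y yB xy; rewrite !psiE /=.
have [k aK kM|ys ys'] := hM y yB; first by apply: xy; lia.
have [|k aK kM|yr yr'] := hM' (flip y); first exact/XB_flip.
  by rewrite /flip; apply: xy; lia.
by split=> //; apply/(VijE n0 _ (quad_Epath i j)).
Qed.

Definition rect : set (R * R) := [set t |
  - nur nu (fsrc (p false false)) < t.1 < nur nu (fsrc (p true false)) /\
  - nus nu (frng (p false false)) < t.2 < nus nu (frng (p false true))].

Lemma psi_rect i j x : Vij p i j x -> rect (psi nu p i j x).
Proof.
move=> /(VijE n0 _ (quad_Epath i j))[xs xr]; have ab := sym_window n0.
have := half_psi_bounds brs (phi_s_cdf nu) ab xs.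
have := half_psi_bounds brr (phi_r_cdf nu) ab xr.
rewrite psiE !frng_frev /rect /= !(quad_frng i false).
by rewrite !(quad_fsrc _ j false).
Qed.

Lemma psi_surj t : rect t -> exists i j x, Vij p i j x /\ psi nu p i j x = t.
Proof.
have ab := sym_window n0; case: t => t1 t2 [/= h1 h2].
have [|j [r [rv rn rt]]] := half_psi_surj brs (phi_s_cdf nu) (q := p false) (s := t2).
  exact: h2.
have [|i [l [lv ln lt]]] := half_psi_surj brr (phi_r_cdf nu) (q := dquad j) (s := t1).
  by rewrite !frng_frev !(quad_fsrc _ j false).
rewrite frng_frev in lv lt.
have [||x [xB xq xl xt]] := @ex_XB B _ _ _ l r (quad_Epath i j).
- exact: lv.
- by rewrite (quad_frng i false).
exists i, j, x; split; last first.
  by rewrite /psi xl xt (quad_frng i false) rt lt.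
apply/(VijE n0 _ (quad_Epath i j)); split; split=> //.
- apply: contra_not rn => h k; rewrite -xt; apply: h; lia.
- exact/XB_flip.
- by rewrite (restr_flip n0) xq.
- apply: contra_not ln => h k; rewrite -xl -(rtail_flip n0); apply: h; lia.
Qed.

(* The points of V_(i,j)(p) sent to the origin by psi^p. *)
Definition corner i j x := [/\ XB B x, restr a b x = p i j,
  forall k, k <= a -> rext i (x k) & forall k, b < k -> sext j (x k)].

Lemma corner_snbr i j x : corner i j x -> exists2 y, corner i (~~ j) y & snbr x y.
Proof.
move=> [xB xq xr xs]; have pp := half_nbr (quad_fsucc_s i) j.
have [y [yB yq xy ys xyn]] := fnbr_s_lift (sym_window n0) pp xB xq xs.
by exists y => //; split=> // k ka; rewrite -xy //; exact: xr.
Qed.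

Lemma corner_rnbr i j x : corner i j x -> exists2 y, corner (~~ i) j y & rnbr x y.
Proof.
move=> [xB xq xr xs]; have pp := half_nbr (quad_fsucc_r j) i.
have [|||y [yB yq xy yr xyn]] := @fnbr_s_lift (dual B) _ _ (sym_window n0) _ _ _ (flip x) pp.
- exact/XB_flip.
- by rewrite (restr_flip n0) xq.
- by move=> k bk; rewrite -rext_dual; apply: xr; lia.
exists (flip y); last by apply/rnbr_flip; rewrite flipK.
split.
- by apply/XB_flip; rewrite flipK.
- rewrite -[LHS]frevK -(restr_flip n0) flipK yq /dquad frevK //.
- by move=> k ka; apply: yr; lia.
- move=> k bk; have := xy (1 - k); rewrite flipE /flip => <-; last by lia.
  exact: xs.
Qed.

Lemma ex_corner : exists x, corner false false x.
Proof.
have [l lv le] := tail_choice (B := dual B) (fsrc (p false false)) (ex_sext false).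
have [t tv te] := tail_choice (frng (p false false)) (ex_sext false).
have [x [xB xq xl xt]] := @ex_XB B _ _ _ l t (quad_Epath false false) lv tv.
exists x; split=> // k hk.
  have -> : x k = l (absz (a - k)%R) by rewrite -xl /ltail; congr x; lia.
  exact: le.
have -> : x k = t (absz (k - b - 1)%R) by rewrite -xt /rtail; congr x; lia.
exact: te.
Qed.

Lemma corner_Vij i j x : corner i j x -> Vij p i j x /\ psi nu p i j x = 0.
Proof.
move=> [xB xq xr xs]; have ab := sym_window n0.
have fB : XB (dual B) (flip x) by exact/XB_flip.
have fq : @restr (dual B) a b (flip x) = dquad j i by rewrite (restr_flip n0) xq.
have fe k : b < k -> @sext (dual B) i (flip x k).
  by move=> bk; rewrite -rext_dual; apply: xr; lia.
split; last first.
  rewrite psiE (half_psi_ext brs (phi_s_cdf nu) ab xB xq xs).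
  by rewrite (half_psi_ext brr (phi_r_cdf nu) ab fB fq fe).
apply/(VijE n0 _ (quad_Epath i j)); split; split=> // h.
  by have := sext_excl nfs xB xs h; case: (j).
by have := sext_excl nfr fB fe h; case: (i).
Qed.

End OneChart.
End Chart.

(** * Comparison of two charts *)

Section HalfCompare.
Context {R : realType} {B : bratteli} (nu : state R B).
Context {phi : BV B -> (nat -> BE B) -> R}.
Hypotheses (br : branching B) (cdf : is_cdf nu phi).
Context {a b a' b' : int}.
Hypotheses (ab : a < b) (ab' : a' < b') (bb' : b <= b').
Implicit Types (x y : int -> BE B).

(** By [pcdf_dropn] the two coordinates differ by constants of the pieces and by the partial sum
    over the edges in (b, b'], on which [x] and [y] agree. *)
Lemma half_psi_diff (q : bool -> finpath B a b) (q' : bool -> finpath B a' b')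
    j l x y : XB B x -> XB B y ->
  restr a b x = q j -> restr a b y = q j ->
  restr a' b' x = q' l -> restr a' b' y = q' l ->
  (forall k, b < k -> k <= b' -> x k = y k) ->
  half_psi nu (phi := phi) q j x - half_psi nu (phi := phi) q' l x =
  half_psi nu (phi := phi) q j y - half_psi nu (phi := phi) q' l y.
Proof.
move=> xB yB xq yq xq' yq' xy; pose N := absz (b' - b)%R.
have split z : XB B z -> restr a b z = q j -> restr a' b' z = q' l ->
    half_psi nu (phi := phi) q j z - half_psi nu (phi := phi) q' l z =
    psum nu (rtail b z) N - (j == false)%:R * nus nu (frng (q j)) +
    (l == false)%:R * nus nu (frng (q' l)).
  move=> zB zq zq'; rewrite /half_psi (pcdf_dropn br cdf N) /=; last first.
    by rewrite -zq frng_restr //; exact: Xplus_rtail.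
  have -> : src (rtail b z N) = frng (q' l).
    rewrite -zq' frng_restr // (XB_next _ zB) /rtail.
    by congr (src (z _)); lia.
  have -> : dropn N (rtail b z) = rtail b' z.
    by apply/funext => k; rewrite /dropn /rtail; congr z; lia.
  by lra.
rewrite !split //; congr (_ - _ + _); apply: eq_psum => k kN.
by rewrite /rtail xy //; lia.
Qed.

End HalfCompare.

Section TwoCharts.
Context {R : realType} {B : bratteli} (nu : state R B).
Hypotheses (brs : branching B) (brr : branching (dual B)).
Context {n n' : nat} (p : quad B (- n%:Z) n%:Z) (q : quad B (- n'%:Z) n'%:Z).
Hypotheses (n0 : (0 < n)%N) (nn' : (n <= n')%N) (pE : Ers p) (qE : Ers q).
Implicit Types (x y : int -> BE B).

Let n'0 : (0 < n')%N := leq_trans n0 nn'.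

Lemma psi_diff i j k l x y : Vij p i j x -> Vij p i j y ->
  Vij q k l x -> Vij q k l y ->
  psi nu p i j x - psi nu q k l x = psi nu p i j y - psi nu q k l y.
Proof.
move=> px py qx qy; have xB := Vij_XB pE px; have yB := Vij_XB pE py.
have xy h : - n'%:Z < h -> h <= n'%:Z -> x h = y h.
  apply: (restr_inj (sym_window n'0)).
  by rewrite (Vij_restr qx) (Vij_restr qy).
have bb' : n%:Z <= n'%:Z by lia.
rewrite !psiE //; congr pair => /=.
  apply: (half_psi_diff brr (phi_r_cdf nu) (sym_window n0) (sym_window n'0) bb').
  - exact/XB_flip.
  - exact/XB_flip.
  - by rewrite (restr_flip n0) (Vij_restr px).
  - by rewrite (restr_flip n0) (Vij_restr py).
  - by rewrite (restr_flip n'0) (Vij_restr qx).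
  - by rewrite (restr_flip n'0) (Vij_restr qy).
  - by move=> h h1 h2; apply: xy; lia.
apply: (half_psi_diff brs (phi_s_cdf nu) (sym_window n0) (sym_window n'0) bb').
- by [].
- by [].
- exact: Vij_restr px.
- exact: Vij_restr py.
- exact: Vij_restr qx.
- exact: Vij_restr qy.
- by move=> h h1 h2; apply: xy; lia.
Qed.

Lemma psi_translation : VB q `<=` VB p -> exists w : R * R,
  forall i j k l x, Vij p i j x -> Vij q k l x ->
    psi nu p i j x = psi nu q k l x + w.
Proof.
move=> qp; have [c00 c00P] := ex_corner n'0 qE.
have inV i j x : corner q i j x -> exists i' j', Vij p i' j' x.
  by move=> /(corner_Vij nu brs brr n'0 qE)[xV _]; apply: qp; exists i, j.
have [i0 [j0 c00p]] := inV _ _ _ c00P.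
pose w := psi nu p i0 j0 c00; exists w.
pose good x := exists i j, Vij p i j x /\ psi nu p i j x = w.
have good_s x y : good x -> snbr x y -> good y.
  move=> [i [j [xV xw]]] xy; have [j' [yV yx]] := Vij_snbr nu brs n0 pE xV xy.
  by exists i, j'; rewrite yx.
have good_r x y : good x -> rnbr x y -> good y.
  move=> [i [j [xV xw]]] xy; have [i' [yV yx]] := Vij_rnbr nu brr n0 pE xV xy.
  by exists i', j; rewrite yx.
have g00 : good c00 by exists i0, j0.
have cs l : exists2 x, corner q false l x & good x.
  case: l; last by exists c00.
  have [y yc xy] := corner_snbr n'0 qE c00P.
  by exists y => //; exact: good_s xy.
have cw k l : exists2 x, corner q k l x & good x.
  have [x xc xg] := cs l; case: k; last by exists x.
  have [y yc xy] := corner_rnbr n'0 qE xc.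
  by exists y => //; exact: good_r xy.
move=> i j k l x px qx; have [c cc [i' [j' [cp cpw]]]] := cw k l.
have [cq c0] := corner_Vij nu brs brr n'0 qE cc.
(* The longer window of [q] contains that of [p], so a piece of [q] meets only one piece of [p]. *)
have [ii jj] : i = i' /\ j = j'.
  apply: (quad_inj pE); rewrite -(Vij_restr px) -(Vij_restr cp).
  apply: (eq_restr (sym_window n0)) => h h1 h2.
  apply: (restr_inj (sym_window n'0)); [|lia|lia].
  by rewrite (Vij_restr qx) (Vij_restr cq).
subst i' j'; have := psi_diff px cp qx cq.
by rewrite c0 subr0 cpw => <-; rewrite addrC subrK.
Qed.

End TwoCharts.

(** * Small charts around a point *)

Section Near.
Context {B : bratteli}.
Hypothesis nf : no_flat B.
Implicit Types (x y z : int -> BE B).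

Lemma snbr_at_val d n x y x' y' : snbr_at d n x y -> snbr_at d n x' y' ->
  x n = x' n -> y n = y' n.
Proof.
case: d => -[_ h1 _ _] [_ h2 _ _] xx; rewrite xx in h1.
  exact: esucc_uniql h1 h2.
exact: esucc_uniq h1 h2.
Qed.

(** If the right tail of [y] is eventually of type [d], then [z] and [y] carry at the same index and
    [z'] follows [Delta_s y]. Otherwise [y] has an edge not of type [d] beyond [M], so [z] carries
    after [M] and [z'] still follows [y]. Agreement shrinks only on the right; the two lengths are
    kept apart because a later r-move needs the full left one. *)
Lemma snbr_near d y (M : nat) : XB B y -> ~ (forall j, sext d (y j)) ->
  exists K : nat, forall (L N : nat) z z', (K <= L)%N -> (K <= N)%N ->
    (forall j, - L%:Z < j -> j <= N%:Z -> z j = y j) ->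
    (forall j, N%:Z < j -> sext d (z j)) -> snbr z z' ->
    (forall j, - L%:Z < j -> j <= M%:Z -> z' j = y j) \/
    (snbr y (Delta_s y) /\
      forall j, - L%:Z < j -> j <= M%:Z -> z' j = Delta_s y j).
Proof.
move=> yB ny.
have nbrd N z z' : (forall j, N < j -> sext d (z j)) -> snbr z z' ->
    [/\ XB B z, XB B z' & exists2 n0, snbr_at d n0 z z' & n0 <= N].
  move=> ze /snbr_atP[zB z'B [d' [n0 zz']]]; split=> //.
  have dd : d' = d.
    exact: (sext_excl nf zB (fun j => snbr_at_ext zz') ze).
  subst d'; exists n0 => //; rewrite leNgt; apply/negP => Nn.
  exact: snbr_at_next zz' (ze _ Nn).
have [[n1 ye]|nye] := pselect (exists n1, forall j, n1 < j -> sext d (y j)).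
  have [m [y' [y'B yy']]] := ex_snbr_at yB ye ny.
  have yny' : snbr y y' by apply/snbr_atP; split=> //; exists d, m.
  exists (absz m + M).+1 => L N z z' KL KN zy ze zz'.
  have [zB z'B [n0 zz n0N]] := nbrd _ _ _ ze zz'.
  right; rewrite (Delta_sE nf yny'); split=> //.
  have n0m : n0 = m.
    have [mn|nm|//] := ltgtP m n0; exfalso.
      apply: (snbr_at_next zz); rewrite zy //; last by lia.
      exact: snbr_at_ext yy' mn.
    apply: (snbr_at_next yy'); rewrite -zy; [|lia|lia].
    exact: snbr_at_ext zz nm.
  subst n0; have e : z' m = y' m.
    by apply: (snbr_at_val zz yy'); rewrite zy //; lia.
  move=> j Lj jM; have [jm|mj|->//] := ltgtP j m.
    by rewrite -(snbr_at_eq zz jm) -(snbr_at_eq yy' jm) zy //; lia.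
  apply: (XB_uniq_right (@sext_uniq B (~~ d)) z'B y'B (n := m)) => //.
  - by rewrite e.
  - by move=> i; exact: snbr_at_ext (snbr_at_sym zz).
  - by move=> i; exact: snbr_at_ext (snbr_at_sym yy').
have [j1 Mj1 yj1] : exists2 j, M%:Z < j & ~ sext d (y j).
  apply: contra_notP nye => h; exists M%:Z => j Mj.
  by apply: contrapT => yj; apply: h; exists j.
exists (absz j1).+1 => L N z z' KL KN zy ze zz'; left.
have [zB z'B [n0 zz n0N]] := nbrd _ _ _ ze zz'.
have j1n : j1 <= n0.
  rewrite leNgt; apply/negP => nj; apply: yj1.
  by rewrite -zy; [exact: snbr_at_ext zz nj|lia|lia].
by move=> j Lj jM; rewrite -(snbr_at_eq zz) ?zy //; lia.
Qed.

End Near.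

Section NearFlip.
Context {B : bratteli}.
Hypotheses (nfs : no_flat B) (nfr : no_flat (dual B)).
Implicit Types (x y z : int -> BE B).

Lemma rnbr_near d y (M : nat) : XB B y -> ~ (forall j, rext d (y j)) ->
  exists K : nat, forall (L N : nat) z z', (K <= L)%N -> (K <= N)%N ->
    (forall j, - N%:Z < j -> j <= L%:Z -> z j = y j) ->
    (forall j, j <= - N%:Z -> rext d (z j)) -> rnbr z z' ->
    (forall j, - M%:Z < j -> j <= L%:Z -> z' j = y j) \/
    (rnbr y (Delta_r y) /\
      forall j, - M%:Z < j -> j <= L%:Z -> z' j = Delta_r y j).
Proof.
move=> /XB_flip yB ny.
have [|K hK] := snbr_near nfr (d := d) M yB.
  by apply: contra_not ny => h j; rewrite -[y j]flipE; exact: h.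
exists K => L N z z' KL KN zy ze /rnbr_flip zz'.
have [||h|[h1 h2]] := hK L N (flip z) (flip z') KL KN _ _ zz'.
- by move=> j jL jN; apply: zy; lia.
- by move=> j Nj; apply: ze; lia.
- by left=> j Mj jL; have := h (1 - j); rewrite !flipE; apply; lia.
right; have yy : rnbr y (flip (Delta_s (B := dual B) (flip y))).
  by apply/rnbr_flip; rewrite flipK.
rewrite (Delta_rE nfr yy); split=> // j Mj jL.
have := h2 (1 - j); rewrite flipE => ->; [|lia|lia].
by rewrite /flip.
Qed.

(** r-neighbours have left tails of opposite extremal types, whereas s-neighbours share their left
    tail. *)
Lemma snbr_rnbr_False x y : snbr x y -> rnbr x y -> False.
Proof.
move=> /snbr_atP[xB yB [d [n xy]]] /rnbr_atP[_ _ [d' [m xy']]].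
have xd := @rnbr_at_ext _ _ _ _ _ _ xy'.
have yd := @rnbr_at_ext _ _ _ _ _ _ (rnbr_at_sym xy').
suff : d' = ~~ d' by case: (d').
apply: (@rext_excl B nfr d' (~~ d') (Num.min n m) m y yB) => [j|j]; last exact: yd.
by rewrite lt_min => /andP[jn jm]; rewrite -(snbr_at_eq xy jn); exact: xd.
Qed.

(* The points identified with [x]; the junk value x of the Delta's off the
   boundaries makes this right for every [x] in Y_B. *)
Definition cls (i j : bool) x :=
  (if i then @Delta_r B else id) ((if j then @Delta_s B else id) x).

Hypothesis hext : ext_not_bd B.

Lemma YB_Delta_s x : YB B x -> YB B (Delta_s x).
Proof.
move=> xY; have [xs|xs] := pselect (bd_s B x); last by rewrite Delta_s_junk.
exact (YB_snbr nfs nfr hext xY (Delta_s_snbr nfs xs)).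
Qed.

Lemma YB_Delta_r x : YB B x -> YB B (Delta_r x).
Proof.
move=> xY; have [xs|xs] := pselect (bd_r B x); last by rewrite Delta_r_junk.
exact (YB_rnbr nfs nfr hext xY (Delta_r_rnbr nfr xs)).
Qed.

Lemma YB_cls i j x : YB B x -> YB B (cls i j x).
Proof.
by rewrite /cls => xY; case: i j => -[] //=;
  do ?[exact: YB_Delta_s|apply: YB_Delta_r].
Qed.

End NearFlip.

Lemma snbr_at_neq (B : bratteli) d n (x y : int -> BE B) :
  snbr_at d n x y -> x n <> y n.
Proof.
by case: d => -[_ [lt _] _ _] h; move: lt; rewrite h (negbTE (lts_irr _)).
Qed.

Section Base.
Context {B : bratteli}.
Hypotheses (nfs : no_flat B) (nfr : no_flat (dual B)) (hext : ext_not_bd B).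
Implicit Types (x y z c : int -> BE B).

(** Selects the type of the left completion so that [x] avoids the tail removed from the
    corresponding piece. By [rext_excl] a left tail is eventually extremal of at most one type. *)
Lemma left_dir x : XB B x ->
  exists d, forall n, ~ forall k, k <= n -> rext (~~ d) (x k).
Proof.
move=> xB.
have [[n xn]|nx] := pselect (exists n, forall k, k < n -> rext true (x k)).
  exists true => m h.
  suff : true = false by [].
  apply: (rext_excl nfr xB xn (n := m)) => k km; apply: h; exact: ltW.
exists false => m h; apply: nx; exists m => k km; apply: h; exact: ltW.
Qed.

Lemma right_dir x : XB B x ->
  exists d, forall n, ~ forall k, n < k -> sext (~~ d) (x k).
Proof.
move=> xB.
have [[n xn]|nx] := pselect (exists n, forall k, n < k -> sext true (x k)).
  exists true => m h.
  suff : true = false by [].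
  exact: (sext_excl nfs xB xn h).
by exists false => m h; apply: nx; exists m.
Qed.

Lemma ex_extremal_tails x (N : nat) d d' : XB B x -> (0 < N)%N ->
  exists c, [/\ XB B c, agree N x c, forall k, k <= - N%:Z -> rext d (c k) &
    forall k, N%:Z < k -> sext d' (c k)].
Proof.
move=> xB N0; have ab := sym_window N0.
have xE := Epath_restr ab xB.
have [l lv le] := tail_choice (B := dual B) (fsrc (restr (- N%:Z) N%:Z x)) (ex_sext d).
have [t tv te] := tail_choice (frng (restr (- N%:Z) N%:Z x)) (ex_sext d').
have [c [cB cq cl ct]] := @ex_XB B _ _ _ l t xE lv tv.
exists c; split=> //.
- by move=> k h1 h2; apply: (restr_inj ab).
- move=> k kN; have -> : c k = l (absz (- N%:Z - k)%R).
    by rewrite -cl /ltail; congr c; lia.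
  exact: le.
- move=> k Nk; have -> : c k = t (absz (k - N%:Z - 1)%R).
    by rewrite -ct /rtail; congr c; lia.
  exact: te.
Qed.

Lemma noext_snbr N d n z z' : noext N z -> snbr_at d n z z' -> - N%:Z < n.
Proof.
move=> [_ /(_ d)[j [Nj _ zj]]] zz'; apply: lt_le_trans Nj _.
by rewrite leNgt; apply/negP => /(snbr_at_ext zz').
Qed.

Lemma noext_rnbr N d n z z' : noext N z -> rnbr_at d n z z' -> n <= N%:Z.
Proof.
move=> [/(_ d)[j [_ jN zj]] _] zz'; apply: le_trans jN.
by rewrite leNgt; apply/negP => /(rnbr_at_ext zz').
Qed.

Lemma rnbr_at_neq d n x y : rnbr_at d n x y -> x n <> y n.
Proof.
by move=> h e; apply: (@snbr_at_neq (dual B) d (1 - n) _ _ h); rewrite !flipE.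
Qed.

(* In the second case Delta_r and Delta_s change [c] at disjoint places. *)
Lemma corner_dichotomy x dr ds : XB B x -> ~ Xext B x ->
  exists K : nat, forall (N : nat) c cs cr a b, (K <= N)%N -> XB B c ->
    agree N x c -> (forall k, k <= - N%:Z -> rext dr (c k)) ->
    (forall k, N%:Z < k -> sext ds (c k)) ->
    snbr_at ds b c cs -> rnbr_at dr a c cr -> c = x \/ a < b.
Proof.
move=> xB nx; have [M [xr xs]] := ex_noext xB nx.
have low j c cs b N : agree N x c -> - N%:Z < j -> j <= N%:Z ->
    ~ sext ds (x j) -> snbr_at ds b c cs -> j <= b.
  move=> xc h1 h2 xj cc; rewrite leNgt; apply/negP => bj; apply: xj.
  by rewrite xc //; exact: snbr_at_ext cc bj.
have high j c cr a N : agree N x c -> - N%:Z < j -> j <= N%:Z ->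
    ~ rext dr (x j) -> rnbr_at dr a c cr -> a <= j.
  move=> xc h1 h2 xj cc; rewrite leNgt; apply/negP => bj; apply: xj.
  by rewrite xc //; exact: rnbr_at_ext cc bj.
have [js [js1 js2 xjs]] := xs ds; have [jr [jr1 jr2 xjr]] := xr dr.
have [[ns xns]|nxs] := pselect (exists n, forall j, n < j -> sext ds (x j)); last first.
  have [j1 Mj1 xj1] : exists2 j, M%:Z < j & ~ sext ds (x j).
    apply: contra_notP nxs => h; exists M%:Z => j Mj.
    by apply: contrapT => xj; apply: h; exists j.
  exists (M + absz j1)%N.+1 => N c cs cr a b KN cB xc cl cr' cc cc'; right.
  have := low j1 _ _ _ _ xc _ _ xj1 cc; have := high jr _ _ _ _ xc _ _ xjr cc'.
  by lia.
have [[nr xnr]|nxr] := pselect (exists n, forall j, j < n -> rext dr (x j)); last first.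
  have [j1 Mj1 xj1] : exists2 j, j < - M%:Z & ~ rext dr (x j).
    apply: contra_notP nxr => h; exists (- M%:Z) => j Mj.
    by apply: contrapT => xj; apply: h; exists j.
  exists (M + absz j1)%N.+1 => N c cs cr a b KN cB xc cl cr' cc cc'; right.
  have := low js _ _ _ _ xc _ _ xjs cc; have := high j1 _ _ _ _ xc _ _ xj1 cc'.
  by lia.
exists (M + absz ns + absz nr)%N.+1 => N c cs cr a b KN cB xc cl cr' cc cc'; left.
apply/funext => j; have [jN|Nj] := leP j N%:Z; last first.
  apply: (XB_uniq_right (@sext_uniq B ds) cB xB _ cr' _ Nj).
    by rewrite xc //; lia.
  by move=> i Ni; apply: xns; lia.
have [jN'|Nj'] := leP j (- N%:Z); last by rewrite xc.
apply: (XB_uniq_left (@rext_uniq B dr) cB xB (n := - N%:Z + 1)); last by lia.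
- by rewrite xc //; lia.
- by move=> i Ni; apply: cl; lia.
- by move=> i Ni; apply: xnr; lia.
Qed.

(** [P false false] is the base point, and [true] marks a move in direction [dr] or [ds]. The
    exclusive or converts this into the indexing of a quadruple: if the move leads to a predecessor,
    the base point gets index 2. Sides have distinct windows because each carry happens inside the
    window; only the diagonals need a hypothesis. *)
Lemma Ers_of_points (M N : nat) (P : bool -> bool -> int -> BE B) dr ds :
  (0 < N)%N -> (M <= N)%N -> (forall i j, XB B (P i j)) ->
  (forall i j, noext M (P i j)) ->
  (forall i j y, XB B y -> agree M (P i j) y -> YB B y) ->
  (forall i, exists2 n, snbr_at ds n (P i false) (P i true) & n <= N%:Z) ->
  (forall j, exists2 n, rnbr_at dr n (P false j) (P true j) & - N%:Z < n) ->
  ~ agree N (P false false) (P true true) ->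
  ~ agree N (P false true) (P true false) ->
  Ers (fun i j => restr (- N%:Z) N%:Z (P (i (+) dr) (j (+) ds))).
Proof.
move=> N0 MN PB Pn PY Ps Pr dist1 dist2; have ab := sym_window N0.
have nsm i j d : exists2 k : int, - N%:Z < k <= N%:Z & ~ sext d (P i j k).
  by have [_ /(_ d)[k [k1 k2 k3]]] := Pn i j; exists k => //; lia.
have nrm i j d : exists2 k : int, - N%:Z < k <= N%:Z & ~ rext d (P i j k).
  by have [/(_ d)[k [k1 k2 k3]] _] := Pn i j; exists k => //; lia.
have nsm' (C : bratteli) (z : int -> BE C) (k : int) : XB C z ->
    - N%:Z < k <= N%:Z -> ~ smin (z k) -> ~ fsmin (restr (- N%:Z) N%:Z z).
  move=> zB /andP[k1 k2] zk h.
  apply: (@not_fsmax (orev C) (- N%:Z) N%:Z z k) => //.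
    by move=> /smax_orev.
  move=> r rE [i [zr lt]]; apply: (h r rE); exists i; split.
    by move=> j ji; rewrite zr.
  by rewrite -lts_orev.
have agreeE y z : restr (- N%:Z) N%:Z y = restr (- N%:Z) N%:Z z -> agree N y z.
  by move=> h k; exact: (restr_inj ab h).
have fs i : fsucc_s (restr (- N%:Z) N%:Z (P i ds)) (restr (- N%:Z) N%:Z (P i (~~ ds))).
  have [k Pk kN] := Ps i; have Nk := noext_snbr (Pn i false) Pk.
  have Nk' : - N%:Z < k by lia.
  by case: (ds) Pk => Pk; apply: (ssucc_fsucc _ _ Pk).
have fr j : fsucc_r (restr (- N%:Z) N%:Z (P dr j)) (restr (- N%:Z) N%:Z (P (~~ dr) j)).
  have [k Pk kN] := Pr j; have Nk := noext_rnbr (Pn false j) Pk.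
  apply/(fsucc_s_frev N0); rewrite -!(restr_flip N0).
  by case: (dr) Pk => Pk; apply: (ssucc_fsucc _ _ Pk); try (exact/XB_flip); lia.
split.
- move=> i j; set z := P _ _.
  have zB : XB B z by exact: PB.
  split; first exact: Epath_restr.
  + split.
      have [k /andP[k1 k2] zk] := nsm (i (+) dr) (j (+) ds) false.
      exact: (not_fsmax ab zB k1 k2 zk).
    have [k kN zk] := nsm (i (+) dr) (j (+) ds) true.
    exact: (nsm' B z k).
  + have fzB : XB (dual B) (flip z) by exact/XB_flip.
    split=> h.
      have [k /andP[k1 k2] zk] := nrm (i (+) dr) (j (+) ds) false.
      apply: (@not_fsmax (dual B) (- N%:Z) N%:Z (flip z) (1 - k) ab fzB); [lia|lia| |].
        by rewrite flipE.
      rewrite (restr_flip N0) => r rE.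
      by rewrite -[r]frevK => /(flts_frev N0); apply: h; apply/(Epath_frev N0); rewrite frevK.
    have [k /andP[k1 k2] zk] := nrm (i (+) dr) (j (+) ds) true.
    apply: (nsm' (dual B) (flip z) (1 - k)) => //; [lia|by rewrite flipE|].
    rewrite (restr_flip N0) => r rE.
    by rewrite -[r]frevK => /(flts_frev N0); apply: h; apply/(Epath_frev N0); rewrite frevK.
  + move=> y yz; apply: (PY (i (+) dr) (j (+) ds)).
      have := (juxtE setT setT y (Epath_restr ab zB)).1.
      by rewrite !setIT => /(_ yz)[].
    apply: (agree_le MN); apply: agreeE.
    have := (juxtE setT setT y (Epath_restr ab zB)).1.
    by rewrite !setIT => /(_ yz)[_ ->].
- have dist i j i' j' : restr (- N%:Z) N%:Z (P i j) = restr (- N%:Z) N%:Z (P i' j') ->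
      i = i' /\ j = j'.
    have ds1 k : ~ agree N (P k false) (P k true).
      have [m Pm mN] := Ps k; have := noext_snbr (Pn k false) Pm => Nm h.
      by apply: (snbr_at_neq Pm); apply: h => //; lia.
    have dr1 k : ~ agree N (P false k) (P true k).
      have [m Pm mN] := Pr k; have := noext_rnbr (Pn false k) Pm => Nm h.
      by apply: (rnbr_at_neq Pm); apply: h => //; lia.
    move=> /agreeE h; have h' := agree_sym h.
    case: i j i' j' h h' => -[] [] [] // h h'; exfalso;
      by [exact: (ds1 _ h)|exact: (ds1 _ h')|exact: (dr1 _ h)|exact: (dr1 _ h')|
          exact: (dist1 h)|exact: (dist1 h')|exact: (dist2 h)|exact: (dist2 h')].
  move=> i j i' j' /dist[].
  by case: i i' j j' (dr) (ds) => -[] [] [] [] [].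
- by have := fs dr; case: (ds).
- by have := fr ds; case: (dr).
- by split; [have := fs (~~ dr); case: (ds) (dr) => -[]|
    have := fr (~~ ds); case: (ds) (dr) => -[]].
Qed.

End Base.

Section TailIndex.
Context {B : bratteli}.
Implicit Types (x y : int -> BE B).

Lemma snbr_at_tail d (N : int) x y : no_flat B -> snbr x y ->
  (forall k, N < k -> sext d (x k)) -> exists2 n, snbr_at d n x y & n <= N.
Proof.
move=> nf /snbr_atP[xB yB [d' [n xy]]] xd.
have dd := sext_excl nf xB (fun j => snbr_at_ext xy) xd; subst d'.
exists n => //; rewrite leNgt; apply/negP => Nn.
exact: snbr_at_next xy (xd _ Nn).
Qed.

Lemma ex_bool_bound (Q : bool -> nat -> Prop) :
  (forall b m n, (m <= n)%N -> Q b m -> Q b n) -> (forall b, exists n, Q b n) ->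
  exists n, forall b, Q b n.
Proof.
move=> mono h; have [[m hm] [n hn]] := (h true, h false).
exists (m + n)%N => -[]; [apply: mono hm|apply: mono hn]; lia.
Qed.

End TailIndex.

Lemma rnbr_at_tail (B : bratteli) d (N : int) (x y : int -> BE B) :
  no_flat (dual B) -> rnbr x y ->
  (forall k, k <= N -> rext d (x k)) -> exists2 n, rnbr_at d n x y & N < n.
Proof.
move=> nf /rnbr_flip xy xd.
have [|n h nN] := @snbr_at_tail (dual B) d (- N) _ _ nf xy.
  by move=> k Nk; apply: xd; lia.
exists (1 - n); last by lia.
by rewrite /rnbr_at (_ : 1 - (1 - n) = n) //; lia.
Qed.

Section ChartBase.
Context {B : bratteli}.
Hypotheses (nfs : no_flat B) (nfr : no_flat (dual B)) (hext : ext_not_bd B).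
Implicit Types (x y z c : int -> BE B).

Lemma YB_noext x : YB B x -> ~ Xext B x.
Proof. by move=> [_ nx] xe; apply: nx; left. Qed.

Lemma YB_XB x : YB B x -> XB B x. Proof. by case. Qed.

(** Every large window length works, so a chart finer than a given one can be requested. The last
    clause confines V(p) to the [M]-neighbourhoods of the points identified with [x]. *)
Lemma chart_base x (M : nat) : YB B x -> exists N0 : nat, forall N, (N0 <= N)%N ->
  exists p : quad B (- N%:Z) N%:Z, [/\ (0 < N)%N, Ers p, VB p x &
    forall k l y, Vij p k l y -> exists i j, agree M (cls i j x) y].
Proof.
move=> xY; have xB := YB_XB xY; have xne := YB_noext xY.
have clsY i j : YB B (cls i j x) by exact: YB_cls.
have [dr hdr] := left_dir nfr xB; have [ds hds] := right_dir nfs xB.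
have [M0 [MM0 M0P]] : exists M0, (M <= M0)%N /\ forall i j, noext M0 (cls i j x) /\
    forall y, XB B y -> agree M0 (cls i j x) y -> YB B y.
  have [|i|M0 hM0] := @ex_bool_bound (fun i m => forall j, noext m (cls i j x) /\
    forall y, XB B y -> agree m (cls i j x) y -> YB B y).
  - move=> i m n mn h j; have [h1 h2] := h j; split; first exact: noext_le h1.
    by move=> y yB xy; apply: h2 => //; exact: agree_le xy.
  - apply: (@ex_bool_bound (fun j m => noext m (cls i j x) /\
      forall y, XB B y -> agree m (cls i j x) y -> YB B y)) => [j m n mn [h1 h2]|j].
      split; first exact: noext_le h1.
      by move=> y yB xy; apply: h2 => //; exact: agree_le xy.
    exact: YB_open.
  exists (M + M0)%N; split=> [|i j]; first by lia.
  have [h1 h2] := hM0 i j; split; first by apply: noext_le h1; lia.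
  by move=> y yB xy; apply: h2 => //; apply: agree_le xy; lia.
have sep y z : exists N, y <> z -> ~ agree N y z.
  have [yz|yz] := pselect (y = z); first by exists 0%N.
  by have [N hN] := neq_agree yz; exists N.
(* These two bounds separate the diagonals of the square in the case where the completion [c] is [x]
   itself. *)
have [N1 hN1] := sep x (cls true true x).
have [N2 hN2] := sep (cls false true x) (cls true false x).
have nall d y : YB B y -> ~ forall j, rext d (y j).
  by move=> [yB ny] h; apply: ny; left; apply/XextP; split=> //; left; exists d.
have [Kr hKr] := @rnbr_near B nfr dr x M0 xB (nall dr x xY).
have [Kr' hKr'] := @rnbr_near B nfr dr (cls false true x) M0
  (YB_XB (clsY _ _)) (nall dr _ (clsY _ _)).
(* After the s-move, agreement reaches only up to [M1] on the right, which must still meet the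
   bounds [Kr] and [Kr'] of the r-move that follows. *)
pose M1 := (M0 + Kr + Kr')%N.
have [|Ks hKs] := @snbr_near B nfs ds x M1 xB.
  by move=> h; apply: xne; apply/XextP; split=> //; right; exists ds.
have [Kd hKd] := corner_dichotomy dr ds xB xne.
exists (M1 + N1 + N2 + Ks + Kd).+1 => N N0N.
have N0 : (0 < N)%N by lia.
have [c [cB xc cl cr']] := ex_extremal_tails dr ds xB N0.
have xc0 : agree M0 x c by apply: agree_le xc; lia.
have [x0 xcyl] := M0P false false.
have c0 : noext M0 c := noext_agree xc0 x0.
have cY : YB B c := xcyl c cB xc0.
have cne := YB_noext cY.
have [b [cs [csB ccs]]] : exists b cs, XB B cs /\ snbr_at ds b c cs.
  apply: (ex_snbr_at cB cr') => h; apply: cne; apply/XextP; split=> //.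
  by right; exists ds.
have [a [cr [crB ccr]]] : exists a cr, XB B cr /\ rnbr_at dr a c cr.
  apply: (@ex_rnbr_at B dr (- N%:Z) _ cB) => [j jN|h]; first by apply: cl; lia.
  by apply: cne; apply/XextP; split=> //; left; exists dr.
have ncs : snbr c cs by apply/snbr_atP; split=> //; exists ds, b.
have ncr : rnbr c cr by apply/rnbr_atP; split=> //; exists dr, a.
have [u [csu cru]] := nbr_square nfs nfr hext cY ncs ncr.
have uB : XB B u by have [] := rnbr_XB csu.
have Mb := noext_snbr c0 ccs; have aM := noext_rnbr c0 ccr.
have bN : b <= N%:Z.
  by rewrite leNgt; apply/negP => Nb; exact: snbr_at_next ccs (cr' _ Nb).
have Na : - N%:Z < a.
  by rewrite ltNge; apply/negP => aN; exact: rnbr_at_next ccr (cl _ aN).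
have csl k : k <= - N%:Z -> rext dr (cs k).
  by move=> kN; rewrite -(snbr_at_eq ccs); [exact: cl|lia].
have crr k : N%:Z < k -> sext ds (cr k).
  by move=> kN; rewrite -(rnbr_at_eq ccr); [exact: cr'|lia].
have [j0 csE] : exists j0, forall j, - N%:Z < j -> j <= M1%:Z ->
    cs j = cls false j0 x j.
  have [||||h|[_ h]] := hKs N N c cs _ _ _ _ ncs; try by lia.
  - by move=> j h1 h2; rewrite xc.
  - exact: cr'.
  - by exists false.
  - by exists true.
have [i0 uE] : exists i0, agree M0 (cls i0 j0 x) u.
  have [h|[_ h]] : (forall j, - M0%:Z < j -> j <= M1%:Z -> u j = cls false j0 x j) \/
      (rnbr (cls false j0 x) (cls true j0 x) /\
        forall j, - M0%:Z < j -> j <= M1%:Z -> u j = cls true j0 x j).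
    case: (j0) csE => csE; first by apply: (hKr' M1 N cs u _ _ csE csl csu); lia.
    by apply: (hKr M1 N cs u _ _ csE csl csu); lia.
  - by exists false => j h1 h2; rewrite h //; lia.
  - by exists true => j h1 h2; rewrite h //; lia.
have [i1 crE] : exists i1, agree M0 (cls i1 false x) cr.
  have [||||h|[_ h]] := hKr N N c cr _ _ _ _ ncr; try by lia.
  - by move=> j h1 h2; rewrite xc.
  - exact: cl.
  - by exists false => j h1 h2; rewrite h //; lia.
  - by exists true => j h1 h2; rewrite h //; lia.
have csE0 : agree M0 (cls false j0 x) cs.
  by move=> j h1 h2; rewrite csE //; lia.
pose P (i j : bool) := if i then (if j then u else cr) else (if j then cs else c).
have PE i j : exists i' j', agree M0 (cls i' j' x) (P i j).
  case: i j => -[] /=; [by exists i0, j0|by exists i1, false|by exists false, j0|].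
  by exists false, false.
have dist : ~ agree N c u /\ ~ agree N cs cr.
  (* If [c] is [x], the points are the identified ones and [N1], [N2] separate them. Otherwise the
     moves act at disjoint places, and the edges at index [b] tell the diagonal points apart. *)
  have [cx|ab] := hKd N c cs cr a b ltac:(lia) cB xc cl cr' ccs ccr.
    subst c; have csx := Delta_sE nfs ncs; have crx := Delta_rE nfr ncr.
    have ux := Delta_rE nfr csu.
    have e11 : cls true true x = u by rewrite /cls csx.
    have e01 : cls false true x = cs by rewrite /cls csx.
    have e10 : cls true false x = cr by rewrite /cls.
    rewrite e11 in hN1; rewrite e01 e10 in hN2; split=> h.
      apply: hN1; last by apply: agree_le h; lia.
      move=> xu; rewrite -xu in csu.
      exact: (snbr_rnbr_False nfr (snbr_sym ncs) csu).
    apply: hN2; last by apply: agree_le h; lia.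
    move=> e; rewrite -e in ncr.
    exact: (snbr_rnbr_False nfr ncs ncr).
  have [a' csu' a'N] := rnbr_at_tail nfr csu csl.
  have a'a : a' <= a.
    rewrite leNgt; apply/negP => aa'; apply: (rnbr_at_next ccr).
    by rewrite (snbr_at_eq ccs ab); exact: rnbr_at_ext csu' aa'.
  split=> h; apply: (snbr_at_neq ccs).
    rewrite h; [|lia|lia]; rewrite (rnbr_at_eq csu') //; lia.
  by rewrite h; [|lia|lia]; rewrite (rnbr_at_eq ccr).
exists (fun i j => restr (- N%:Z) N%:Z (P (i (+) dr) (j (+) ds))).
have pE : Ers (fun i j => restr (- N%:Z) N%:Z (P (i (+) dr) (j (+) ds))).
  apply: (@Ers_of_points _ M0 N P dr ds N0); first by lia.
  - by move=> -[] [].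
  - move=> i j; have [i' [j' h]] := PE i j.
    by have [h' _] := M0P i' j'; exact: noext_agree h h'.
  - move=> i j y yB Py; have [i' [j' h]] := PE i j.
    by have [_] := M0P i' j'; apply=> //; exact: agree_trans h Py.
  - move=> [] /=; last by exists b.
    exact: snbr_at_tail.
  - move=> [] /=; last by exists a.
    exact: rnbr_at_tail.
  - by case: dist.
  - by case: dist.
split=> //.
(* The exclusive or cancels, so piece [dr], [ds] carries the window of [c], which is that of [x];
   [hdr] and [hds] say that the tails of [x] are not the removed ones. *)
- exists dr, ds; apply/(VijE N0 _ (quad_Epath pE _ _)).
  have xq : restr (- N%:Z) N%:Z x = restr (- N%:Z) N%:Z c.
    exact: (eq_restr (sym_window N0)).
  split; split=> //.
  + by rewrite !addbb.
  + exact/XB_flip.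
  + by rewrite (restr_flip N0) !addbb xq.
  + move=> h; apply: (hdr (- N%:Z)) => k kN; rewrite -[x k]flipE; apply: h; lia.
- move=> k l y /Vij_restr yq.
  have [i [j h]] := PE (k (+) dr) (l (+) ds); exists i, j.
  apply: (agree_le MM0); apply: agree_trans h _ => m h1 h2.
  by apply: (restr_inj (sym_window N0)); rewrite ?yq //; lia.
Qed.

End ChartBase.

(** * The topology of the quotient *)

Section PathTopology.
Context (B : bratteli).
Implicit Types (x y : pathspace B).

Lemma nbhs_agree (N : nat) x : nbhs x [set y : pathspace B | agree N x y].
Proof.
have proj_nbhs (i : int) : nbhs x [set y : pathspace B | y i = x i].
  have h := @proj_continuous int (fun=> discrete_topology (BE B)) i x.
  apply: (h [set e : discrete_topology (BE B) | e = x i]).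
  exact/principal_filterP.
elim: N => [|N IH]; first by apply: filterE => y j; lia.
apply: filterS3 IH (proj_nbhs (N.+1%:Z)) (proj_nbhs (- N%:Z)) => y h1 h2 h3 j j1 j2.
have [->|jN] := eqVneq j N.+1%:Z; first exact/esym.
have [->|jN'] := eqVneq j (- N%:Z); first exact/esym.
by apply: h1; lia.
Qed.

(** The sets containing a window neighbourhood of [x] form a filter. The product topology is a
    supremum over the coordinates, so its convergence to [x] is checked at one index at a time. *)
Lemma nbhs_agreeP x (A : set (pathspace B)) :
  nbhs x A -> exists N : nat, forall y : pathspace B, agree N x y -> A y.
Proof.
pose F : set_system (pathspace B) :=
  [set C | exists N : nat, forall y : pathspace B, agree N x y -> C y].
have FF : Filter F.
  split; first by exists 0%N.
    move=> P Q [N PN] [M QM]; exists (N + M)%N => y xy; split.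
      by apply: PN; apply: agree_le xy; lia.
    by apply: QM; apply: agree_le xy; lia.
  by move=> P Q PQ [N PN]; exists N => y /PN /PQ.
suff : F --> x by apply.
apply/cvg_sup => i C [_ [[D oD <-] Dx DC]].
exists (absz i).+1 => y xy; apply: DC => /=.
suff <- : x i = y i by [].
by apply: xy; lia.
Qed.

Lemma open_YspaceP (A : set (Yspace B)) : open A <->
  forall x : Yspace B, A x -> exists N : nat, forall y : Yspace B,
    agree N (set_val x) (set_val y) -> A y.
Proof.
split=> [[C oC <-] x Cx|h].
  have [N hN] := nbhs_agreeP (open_nbhs_nbhs (conj oC Cx)).
  by exists N => y /hN.
have [f hf] : exists f : Yspace B -> nat, forall x : Yspace B, A x -> forall y : Yspace B,
    agree (f x) (set_val x) (set_val y) -> A y.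
  suff /choice[f hf] : forall x : Yspace B, exists n, A x -> forall y : Yspace B,
      agree n (set_val x) (set_val y) -> A y by exists f.
  move=> x; have [Ax|Ax] := pselect (A x); last by exists 0%N.
  by have [N hN] := h x Ax; exists N.
exists [set y : pathspace B | exists2 x : Yspace B, A x & agree (f x) (set_val x) y].
  rewrite openE => y [x Ax xy]; rewrite /interior.
  apply: filterS (nbhs_agree (f x) y) => z yz; exists x => //.
  exact: agree_trans xy yz.
apply/seteqP; split=> y /=; first by move=> [x Ax]; exact: hf.
by move=> Ay; exists y.
Qed.

End PathTopology.

Section Quotient.
Context (B : bratteli).
Implicit Types (x y : Yspace B).

Lemma piB_surj (z : SB B) : exists x, piB x = z.
Proof. by exists (repr z); rewrite /piB reprK. Qed.

Lemma piB_eq x y : piB x = piB y <-> clos_refl_sym_trans _ (@ident B) x y.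
Proof.
have e := @eqmodP _ (Yequiv B) x y.
by split=> [/e/asboolP|/asboolP xy] //; exact/e.
Qed.

Lemma open_SBP (W : set (SB B)) : open W <->
  forall x, W (piB x) -> exists N : nat, forall y,
    agree N (set_val x) (set_val y) -> W (piB y).
Proof. by split=> [/open_YspaceP|h]; [|apply/open_YspaceP]. Qed.

End Quotient.

Section Plane.
Context {R : realType}.

Lemma nbhs_planeP (t : R * R) (A : set (R * R)) : nbhs t A <->
  exists2 e : R, 0 < e &
    forall u : R * R, `|t.1 - u.1| < e -> `|t.2 - u.2| < e -> A u.
Proof.
split=> [/nbhs_ballP[e /= e0 h]|[e e0 h]].
  exists e => // u u1 u2; apply: h; rewrite /ball /= /prod_ball /=.
  by rewrite -!ball_normE.
apply/nbhs_ballP; exists e => // u.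
by rewrite /ball /= /prod_ball /= -!ball_normE => -[]; exact: h.
Qed.

Lemma open_box (a b c d : R) (w : R * R) :
  open [set u : R * R | a < u.1 - w.1 < b /\ c < u.2 - w.2 < d].
Proof.
rewrite openE => u /= [/andP[h1 h2] /andP[h3 h4]]; apply/nbhs_planeP.
exists (Num.min (Num.min (u.1 - w.1 - a) (b - (u.1 - w.1)))
                (Num.min (u.2 - w.2 - c) (d - (u.2 - w.2)))).
  by rewrite !lt_min !subr_gt0 h1 h2 h3 h4.
move=> v; rewrite !lt_min !ltr_norml => /andP[/andP[p1 p2] _] /andP[_ /andP[p3 p4]].
by split; lra.
Qed.

End Plane.

(** * The maps eta^p on the quotient *)

Section Charts.
Context {R : realType} {B : bratteli} (nu : state R B).
Hypotheses (brs : branching B) (brr : branching (dual B)) (hext : ext_not_bd B).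
Implicit Types (x y : Yspace B) (z : SB B).

Let nfs : no_flat B := branching_no_flat nu brs.
Let nfr : no_flat (dual B) := branching_no_flat (dual_state nu) brr.

Lemma Yspace_YB x : YB B (set_val x).
Proof. exact: set_valP. Qed.

Lemma ex_Yspace u : YB B u -> exists x, set_val x = u.
Proof. exact: (@set_val_surj _ (YB B)). Qed.

Lemma Yspace_inj x y : set_val x = set_val y -> x = y.
Proof. exact: val_inj. Qed.

Lemma ident_nbr x y : ident x y ->
  rnbr (set_val x) (set_val y) \/ snbr (set_val x) (set_val y).
Proof.
by case=> -[xb ->]; [left; exact: Delta_r_rnbr|right; exact: Delta_s_snbr].
Qed.

Lemma piB_snbr x y : snbr (set_val x) (set_val y) -> piB x = piB y.
Proof.
move=> xy; apply/piB_eq/rst_step; right; split; first by exists (set_val y).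
by rewrite (Delta_sE nfs xy).
Qed.

Lemma piB_rnbr x y : rnbr (set_val x) (set_val y) -> piB x = piB y.
Proof.
move=> xy; apply/piB_eq/rst_step; left; split; first by exists (set_val y).
by rewrite (Delta_rE nfr xy).
Qed.

Lemma piB_cls i j x : exists2 y, set_val y = cls i j (set_val x) & piB y = piB x.
Proof.
have hs y : exists2 y', set_val y' = Delta_s (set_val y) & piB y' = piB y.
  have [y' y'E] := ex_Yspace (YB_Delta_s nfs nfr hext (Yspace_YB y)).
  exists y' => //; have [yb|yb] := pselect (bd_s B (set_val y)).
    by apply/esym/piB_snbr; rewrite y'E; exact: Delta_s_snbr.
  by congr piB; apply: Yspace_inj; rewrite y'E Delta_s_junk.
have hr y : exists2 y', set_val y' = Delta_r (set_val y) & piB y' = piB y.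
  have [y' y'E] := ex_Yspace (YB_Delta_r nfs nfr hext (Yspace_YB y)).
  exists y' => //; have [yb|yb] := pselect (bd_r B (set_val y)).
    by apply/esym/piB_rnbr; rewrite y'E; exact: Delta_r_rnbr.
  by congr piB; apply: Yspace_inj; rewrite y'E Delta_r_junk.
have [y yE yx] : exists2 y, set_val y = (if j then @Delta_s B else id) (set_val x) &
    piB y = piB x by case: j; [exact: hs|exists x].
rewrite /cls -yE -yx; case: i; [exact: hr|by exists y].
Qed.

Section OneChart.
Context {n : nat} (p : quad B (- n%:Z) n%:Z).
Hypotheses (n0 : (0 < n)%N) (pE : Ers p).

(** Induction on the generated equivalence. Both directions are carried along because of its
    symmetric closure. The result says that V(p) is saturated and that psi^p is constant on
    classes. *)
Lemma psi_piB x y i j : piB x = piB y -> Vij p i j (set_val x) ->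
  exists i' j', Vij p i' j' (set_val y) /\
    psi nu p i' j' (set_val y) = psi nu p i j (set_val x).
Proof.
pose follows u v := forall i1 j1, Vij p i1 j1 u ->
  exists i2 j2, Vij p i2 j2 v /\ psi nu p i2 j2 v = psi nu p i1 j1 u.
have step u v : rnbr u v \/ snbr u v -> follows u v.
  move=> [uv|uv] i1 j1 uV.
    by have [i2 [h1 h2]] := Vij_rnbr nu brr n0 pE uV uv; exists i2, j1.
  by have [j2 [h1 h2]] := Vij_snbr nu brs n0 pE uV uv; exists i1, j2.
move=> /piB_eq xy xV.
suff [h _] : follows (set_val x) (set_val y) /\ follows (set_val y) (set_val x).
  exact: h.
elim: xy {i j xV} => {x y} [x y|x|x y _ [h1 h2]|x y t _ [h1 h2] _ [h3 h4]].
- move=> /ident_nbr xy; split; apply: step => //.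
  by case: xy => h; [left; exact: rnbr_sym|right; exact: snbr_sym].
- by split=> i j xV; exists i, j.
- by [].
- split=> i j uV.
    have [i1 [j1 [k1 k2]]] := h1 _ _ uV; have [i2 [j2 [k3 k4]]] := h3 _ _ k1.
    by exists i2, j2; rewrite k4.
  have [i1 [j1 [k1 k2]]] := h4 _ _ uV; have [i2 [j2 [k3 k4]]] := h2 _ _ k1.
  by exists i2, j2; rewrite k4.
Qed.

Lemma psi_eq_piB x y i j i' j' : Vij p i j (set_val x) -> Vij p i' j' (set_val y) ->
  psi nu p i j (set_val x) = psi nu p i' j' (set_val y) -> piB x = piB y.
Proof.
move=> xV yV e; have [u [uV xu uy]] := psi_inj brs brr n0 pE xV yV e.
have [u' u'E] := ex_Yspace (quad_YB pE uV).
rewrite -u'E in xu uy.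
transitivity (piB u').
  case: xu => [xu|]; last exact: piB_snbr.
  by congr piB; exact: Yspace_inj.
case: uy => [uy|]; last exact: piB_rnbr.
by congr piB; exact: Yspace_inj.
Qed.

Lemma YP_piB x : YP p (piB x) <-> VB p (set_val x).
Proof.
split=> [[y [i [j yV]] /psi_piB h]|xV]; last by exists x.
by have [i' [j' [xV _]]] := h _ _ yV; exists i', j'.
Qed.

Lemma YPP z : YP p z <-> exists x i j, z = piB x /\ Vij p i j (set_val x).
Proof.
split=> [[x [i [j xV]] <-]|[x [i [j [-> xV]]]]]; first by exists x, i, j.
by exists x => //; exists i, j.
Qed.

Lemma YP_open : open (YP p).
Proof.
apply/open_SBP => x /YP_piB[i [j xV]].
have [M hM] := psi_cont nu brs brr n0 pE xV (@ltr01 R).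
exists M => y xy; apply/YP_piB; exists i, j.
by have [] := hM (set_val y) (YB_XB (Yspace_YB y)) xy.
Qed.

Lemma ex_eta : exists f : SB B -> R * R, is_eta nu p f.
Proof.
pose Q z t := exists x i j, [/\ piB x = z, Vij p i j (set_val x) &
  psi nu p i j (set_val x) = t].
exists (fun z => xget 0 (Q z)) => i j x xV.
apply: xget_unique; first by exists x, i, j.
move=> t [y [i1 [j1 [yx yV <-]]]].
have [i2 [j2 [xV' <-]]] := psi_piB yx yV.
by have [-> ->] := Vij_uniq pE xV xV'.
Qed.

Section Eta.
Variable f : SB B -> R * R.
Hypothesis fE : is_eta nu p f.

Lemma eta_uniq g : is_eta nu p g -> {in YP p, f =1 g}.
Proof.
by move=> gE z /set_mem /YPP[x [i [j [-> xV]]]]; rewrite (fE xV) (gE _ _ _ xV).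
Qed.

Lemma eta_inj : set_inj (YP p) f.
Proof.
move=> z z' /set_mem /YPP[x [i [j [-> xV]]]] /set_mem /YPP[y [i' [j' [-> yV]]]].
by rewrite (fE xV) (fE yV); exact: psi_eq_piB xV yV.
Qed.

Lemma eta_image : f @` YP p = rect nu p.
Proof.
apply/seteqP; split=> t.
  by move=> [_ /YPP[x [i [j [-> xV]]]] <-]; rewrite (fE xV); exact: psi_rect.
move=> /(psi_surj brs brr n0 pE)[i [j [u [uV ut]]]].
have [x xu] := ex_Yspace (quad_YB pE uV); subst u.
exists (piB x); first by apply/YP_piB; exists i, j.
by rewrite (fE uV).
Qed.

Lemma eta_preimage_open (O : set (R * R)) : open O -> open (YP p `&` f @^-1` O).
Proof.
move=> oO; apply/open_SBP => x [/YP_piB[i [j xV]]] /=; rewrite (fE xV) => Ox.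
have /nbhs_planeP[e e0 he] := open_nbhs_nbhs (conj oO Ox).
have [M hM] := psi_cont nu brs brr n0 pE xV e0.
exists M => y xy; have [yV [y1 y2]] := hM (set_val y) (YB_XB (Yspace_YB y)) xy.
split; first by apply/YP_piB; exists i, j.
by rewrite /= (fE yV); exact: he.
Qed.

Lemma eta_continuous : {within YP p, continuous f}.
Proof.
rewrite continuous_open_subspace; last exact: YP_open.
move=> z /set_mem zp A; rewrite nbhsE => -[C [oC Cz] CA].
rewrite nbhsE /=; exists (YP p `&` f @^-1` C); last by move=> z' [_ /CA].
by split=> //; exact: eta_preimage_open.
Qed.

End Eta.
End OneChart.

(** The lower bound [m] on the window length is there for [eta_translate], which compares a chart
    only with one of at least the same length. *)
Lemma SB_base z (W : set (SB B)) (m : nat) : open W -> W z ->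
  exists n (q : quad B (- n%:Z) n%:Z), [/\ (0 < n)%N, (m <= n)%N, Ers q, YP q z & YP q `<=` W].
Proof.
have [x <-] := piB_surj z => oW Wx.
have [M hM] : exists M : nat, forall i j y,
    agree M (cls i j (set_val x)) (set_val y) -> W (piB y).
  have mono i j a b : (a <= b)%N -> (forall y, agree a (cls i j (set_val x)) (set_val y) ->
      W (piB y)) -> forall y, agree b (cls i j (set_val x)) (set_val y) -> W (piB y).
    by move=> ab h y xy; apply: h; exact: agree_le xy.
  apply: (@ex_bool_bound (fun i M => forall j y, agree M (cls i j (set_val x)) (set_val y) -> W (piB y))).
    by move=> i a b ab h j; apply: (mono i j a b ab) => y; exact: h.
  move=> i; apply: (@ex_bool_bound (fun j M => forall y, agree M (cls i j (set_val x)) (set_val y) -> W (piB y))).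
    by move=> j a b; exact: mono.
  move=> j; have [y yE yx] := piB_cls i j x; rewrite -yE.
  by apply: (proj1 (open_SBP _) oW); rewrite yx.
have [N0 hN0] := chart_base nfs nfr hext M (Yspace_YB x).
have [|q [n0 qE xq qM]] := hN0 (N0 + m)%N; first by lia.
exists (N0 + m)%N, q; split=> //; first by lia.
  by exists x.
move=> _ /(YPP q)[y [k [l [-> yV]]]].
by have [i [j]] := qM _ _ _ yV; exact: hM.
Qed.

End Charts.

(** * Surface structure and transition maps *)

Lemma countable_edges (B : bratteli) : countable [set: BE B].
Proof.
rewrite (_ : [set: BE B] = \bigcup_(n in [set: int]) [set e | lvE e = n]).
  by apply: bigcup_countable => // n _; exact/finite_set_countable/finE.
by apply/seteqP; split=> // e _; exists (lvE e).
Qed.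

Lemma countable_quads (B : bratteli) (m n : int) : countable [set: quad B m n].
Proof.
have /countable_injP[f finj] := countable_edges B.
pose code (p : finpath B m n) := [ffun i => f (p i)].
have code_inj : injective code.
  move=> p q pq; apply/ffunP => i; apply: finj; rewrite ?inE //.
  by move/ffunP: pq => /(_ i); rewrite !ffunE.
apply/countable_injP.
exists (fun p : quad B m n => pickle (code (p false false), code (p false true),
  code (p true false), code (p true true))).
move=> p q _ _ /(pcan_inj pickleK)[/code_inj h1 /code_inj h2 /code_inj h3 /code_inj h4].
by apply/funext => -[]; apply/funext => -[].
Qed.

Section Atlas.
Context {R : realType} {B : bratteli} (nu : state R B).
Hypotheses (brs : branching B) (brr : branching (dual B)) (hext : ext_not_bd B).
Implicit Types (x y : Yspace B) (z : SB B).

Let nfs : no_flat B := branching_no_flat nu brs.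
Let nfr : no_flat (dual B) := branching_no_flat (dual_state nu) brr.

Lemma eta_translate n n' (p : quad B (- n%:Z) n%:Z) (q : quad B (- n'%:Z) n'%:Z) f g :
  (0 < n)%N -> (n <= n')%N -> Ers p -> Ers q -> YP q `<=` YP p ->
  is_eta nu p f -> is_eta nu q g ->
  exists w : R * R, forall z, YP q z -> f z = g z + w.
Proof.
move=> n0 nn' pE qE qp fE gE; have n'0 : (0 < n')%N := leq_trans n0 nn'.
have [|w hw] := psi_translation nu brs brr n0 nn' pE qE.
  move=> u [i [j uV]]; have [x xu] := ex_Yspace (quad_YB qE uV); subst u.
  by apply/(YP_piB nu brs brr n0 pE)/qp; exists x => //; exists i, j.
exists w => z zq; have [x [i [j [zx xV]]]] := (YPP q z).1 zq; subst z.
have [i' [j' xV']] := (YP_piB nu brs brr n0 pE x).1 (qp _ zq).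
by rewrite (fE _ _ _ xV') (gE _ _ _ xV); exact: hw.
Qed.

(** Around [z] a finer chart fits into [YP p] and [W]. There [f] is a translate of the finer
    coordinate, whose image is an open rectangle. *)
Lemma eta_open n (p : quad B (- n%:Z) n%:Z) f (W : set (SB B)) :
  (0 < n)%N -> Ers p -> is_eta nu p f -> open W -> open (f @` (YP p `&` W)).
Proof.
move=> n0 pE fE oW; rewrite openE => _ [z [zp zW] <-].
have oU : open (YP p `&` W) by apply: openI => //; exact (YP_open nu brs brr n0 pE).
have [n' [q [n'0 nn' qE zq qU]]] := SB_base nu brs brr hext n oU (conj zp zW).
have [g gE] := ex_eta nu brs brr n'0 qE.
have [w hw] := eta_translate n0 nn' pE qE (subset_trans qU (@subIsetl _ _ _)) fE gE.
have gim := eta_image brs brr n'0 qE gE.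
rewrite /interior.
have imE : [set u | rect nu q (u - w)] `<=` f @` (YP p `&` W).
  move=> u /=; rewrite -gim => -[z' z'q gz']; exists z'; first exact: qU.
  by rewrite hw // gz' subrK.
apply: filterS imE _; apply: open_nbhs_nbhs; split; first exact: open_box.
by rewrite /= hw // addrK -gim; exists z.
Qed.

Lemma eta_homeo n (p : quad B (- n%:Z) n%:Z) f :
  (0 < n)%N -> Ers p -> is_eta nu p f -> homeo_to_image (YP p) f.
Proof.
move=> n0 pE fE; split.
- exact (eta_inj brs brr n0 pE fE).
- exact (eta_continuous brs brr n0 pE fE).
- move=> W oW; exists (f @` (YP p `&` W)); first exact: eta_open.
  by apply/esym/setIidPr => _ [z [zp _] <-]; exists z.
Qed.

Lemma eta_chart n (p : quad B (- n%:Z) n%:Z) f :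
  (0 < n)%N -> Ers p -> is_eta nu p f -> planar_chart (YP p) f.
Proof.
move=> n0 pE fE; split; [exact (YP_open nu brs brr n0 pE)| |exact: eta_homeo].
by rewrite -[YP p]setIT; apply: eta_open => //; exact: openT.
Qed.

(** All representatives of the two classes are separated by one window length [M]. Charts whose
    points stay [M]-close to representatives are then disjoint, because V(q) is saturated. *)
Lemma SB_hausdorff : hausdorff_space (SB B).
Proof.
rewrite open_hausdorff => z z' /eqP zz'.
have [x xz] := piB_surj z; have [x' xz'] := piB_surj z'; subst z z'.
have sep (i j i' j' : bool) : exists M, ~ agree M (cls i j (set_val x)) (cls i' j' (set_val x')).
  apply: neq_agree => e; apply: zz'.
  have [y yE <-] := piB_cls nu brs brr hext i j x.
  have [y' yE' <-] := piB_cls nu brs brr hext i' j' x'.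
  by congr piB; apply: Yspace_inj; rewrite yE yE'.
have [M hM] : exists M : nat, forall i j i' j',
    ~ agree M (cls i j (set_val x)) (cls i' j' (set_val x')).
  pose Q (i j i' j' : bool) M := ~ agree M (cls i j (set_val x)) (cls i' j' (set_val x')).
  have mono i j i' j' a b : (a <= b)%N -> Q i j i' j' a -> Q i j i' j' b.
    by move=> ab h xy; apply: h; exact: agree_le xy.
  apply: (@ex_bool_bound (fun i M => forall j i' j', Q i j i' j' M)).
    by move=> i a b ab h j i' j'; exact: mono (h _ _ _).
  move=> i; apply: (@ex_bool_bound (fun j M => forall i' j', Q i j i' j' M)).
    by move=> j a b ab h i' j'; exact: mono (h _ _).
  move=> j; apply: (@ex_bool_bound (fun i' M => forall j', Q i j i' j' M)).
    by move=> i' a b ab h j'; exact: mono (h _).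
  move=> i'; apply: (@ex_bool_bound (Q i j i')) => [j' a b ab|j'].
    exact: mono.
  exact: sep.
have [N hN] := chart_base nfs nfr hext M (Yspace_YB x).
have [N' hN'] := chart_base nfs nfr hext M (Yspace_YB x').
have [|p [n0 pE xp pM]] := hN (N + N')%N; first by lia.
have [|q [_ qE xq qM]] := hN' (N + N')%N; first by lia.
exists (YP p, YP q) => /=; first by rewrite !inE; split; [exists x|exists x'].
split; [exact (YP_open nu brs brr n0 pE)|exact (YP_open nu brs brr n0 qE)|].
apply/eqP/seteqP; split=> // t [/YPP[y [i [j [-> yp]]]]].
move=> /(YP_piB nu brs brr n0 qE)[i' [j' yq]].
have [k [l h1]] := pM _ _ _ yp; have [k' [l' h2]] := qM _ _ _ yq.
by apply: (hM k l k' l'); exact: agree_trans h1 (agree_sym h2).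
Qed.

Lemma SB_second_countable : @second_countable (SB B).
Proof.
exists (\bigcup_(n in [set: nat]) ((fun p : quad B (- n%:Z) n%:Z => YP p) @`
    [set p | (0 < n)%N /\ Ers p])).
  apply: bigcup_countable => // n _.
  apply: sub_countable (card_image_le _ _) _.
  by apply: sub_countable (countable_quads B (- n%:Z) n%:Z); exact: subset_card_le.
split=> [_ [n _ [p [n0 pE] <-]]|z W]; first exact (YP_open nu brs brr n0 pE).
rewrite nbhsE => -[C [oC Cz] CW].
have [n [q [n0 _ qE zq qC]]] := SB_base nu brs brr hext 0 oC Cz.
exists (YP q); last exact: subset_trans qC CW.
by split=> //; exists n => //; exists q.
Qed.

Variable eta : forall n : nat, quad B (- n%:Z) n%:Z -> SB B -> R * R.
Hypothesis etaE : forall (n : nat) (p : quad B (- n%:Z) n%:Z), (1 <= n)%N -> Ers p ->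
  is_eta nu p (eta p).

Lemma eta_atlas : translation_atlas
  [set c : set (SB B) * (SB B -> R * R) |
    exists (n : nat) (p : quad B (- n%:Z) n%:Z),
      [/\ (1 <= n)%N, Ers p & c = (YP p, eta p)]].
Proof.
split.
- by move=> _ [n [p [n0 pE ->]]]; apply: eta_chart => //; exact: etaE.
- apply/seteqP; split=> // z _.
  have [n [q [n0 _ qE zq _]]] := SB_base nu brs brr hext 0 openT (I : setT z).
  by exists (YP q, eta q) => //; exists n, q.
move=> _ _ [n [p [n0 pE ->]]] [m [q [m0 qE ->]]] _ [z [zp zq] <-] /=.
have fE := etaE n0 pE; have gE := etaE m0 qE.
have oU : open (YP p `&` YP q).
  by apply: openI; [exact (YP_open nu brs brr n0 pE)|exact (YP_open nu brs brr m0 qE)].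
(* A chart inside both domains: the two coordinates are translates of its coordinate, so they differ
   by [w1 - w2] on it. *)
have [k [r [k0 kn rE zr rU]]] := SB_base nu brs brr hext (n + m) oU (conj zp zq).
have hE := etaE k0 rE.
have [||w1 hw1] := eta_translate n0 _ pE rE _ fE hE; first by lia.
  by move=> t /rU[].
have [||w2 hw2] := eta_translate m0 _ qE rE _ gE hE; first by lia.
  by move=> t /rU[].
exists (w1 - w2).
(* The image of [YP r] is a neighbourhood of the value at [z], and injectivity on [YP q] shows that
   every point over it lies in [YP r]. *)
have oV := eta_open m0 qE gE (YP_open nu brs brr k0 rE).
apply: filterS (open_nbhs_nbhs (conj oV _)); last by exists z.
move=> _ [t [tq tr] <-] t' t'p t'q t't.
have -> : t' = t by apply: (eta_inj brs brr m0 qE gE) => //; rewrite inE.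
by rewrite hw1 // hw2 // addrACA subrr addr0.
Qed.

Lemma SB_surface : surface R (SB B).
Proof.
split; [exact: SB_hausdorff|exact: SB_second_countable|] => z.
have [n [q [n0 _ qE zq _]]] := SB_base nu brs brr hext 0 openT (I : setT z).
by exists (YP q), (eta q); split=> //; apply: eta_chart => //; exact: etaE.
Qed.

End Atlas.

Theorem theorem6p16 (R : realType) (B : bratteli) (nu : state R B)
    (hrank : finite_rank B) (hsimple : strongly_simple B)
    (hext : ext_not_bd B) :
  (forall (n : nat) (p : quad B (- n%:Z) n%:Z), (1 <= n)%N -> Ers p ->
     exists f : SB B -> R * R,
       is_eta nu p f /\
       forall g : SB B -> R * R, is_eta nu p g -> {in YP p, f =1 g}) /\
  (forall eta : forall n : nat, quad B (- n%:Z) n%:Z -> SB B -> R * R,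
     (forall (n : nat) (p : quad B (- n%:Z) n%:Z), (1 <= n)%N -> Ers p ->
        is_eta nu p (eta n p)) ->
     [/\ forall (n : nat) (p : quad B (- n%:Z) n%:Z), (1 <= n)%N -> Ers p ->
           open (YP p) /\ homeo_to_image (YP p) (eta n p),
         surface R (SB B) &
         translation_atlas
           [set c : set (SB B) * (SB B -> R * R) |
             exists (n : nat) (p : quad B (- n%:Z) n%:Z),
               [/\ (1 <= n)%N, Ers p & c = (YP p, eta n p)]]]).
Proof.
have brs := strongly_simple_branching hsimple.
have brr := strongly_simple_branching_dual hsimple.
split=> [n p n0 pE|eta etaE].
  have [f fE] := ex_eta nu brs brr n0 pE.
  by exists f; split=> // g; exact: eta_uniq.
split.
- move=> n p n0 pE; split; first exact (YP_open nu brs brr n0 pE).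
  by apply: (eta_homeo brs brr hext n0 pE); exact: etaE.
- exact: SB_surface etaE.
- exact: eta_atlas etaE.
Qed.
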